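(* If $X$ is a Banach space, then the following conditions are equivalent: (i) $X$ is $K$-convex and there is a constant $K>0$ so that $K^{-1}\gamma_\infty(T)\le \ell(T)\le K\gamma_\infty(T)$ for all $T\in\ell_2\otimes X$. (ii) $X^*$ has the Gaussian average property $\mathrm{GAP}$ and $X$ is of finite cotype.
   Context: $\pi_1$ denotes the 1-summing norm. $\ell_2\otimes X$ is identified with the finite rank operators from $\ell_2$ to $X$. $(g_n)$ is a sequence of independent standard Gaussian variables on a probability space $(\Omega,\mathcal{S},\mu)$ and $(e_n)$ is the unit vector basis of $\ell_2$. For a Banach space $Z$ and $T\in \ell_2\otimes Z$ the $\ell$-norm is $\ell(T)=\left(\int\|\sum_{n=1}^\infty g_n(t)Te_n\|^2d\mu(t)\right)^{1/2}$ (the series converges in $L_2(\mu,Z)$). $\mathrm{GAP}$: a Banach space $Z$ has $\mathrm{GAP}$ if there is a constant $K$ so that $\ell(T)\le K\pi_1(T^* )$ for all $T\in\ell_2\otimes Z$. $\gamma_\infty(T)=\inf\{\|A\|\|B\|\}$, the infimum over all factorizations $T=BA$ with $A$ a bounded operator from $\ell_2$ to some $L_\infty(\nu)$ and $B$ a bounded operator from $L_\infty(\nu)$ to $X$. $X$ is $K$-convex if the projections $f\mapsto\sum_{j=1}^n g_j\int f g_j\,d\mu$ on $L_2(\mu,X)$ are bounded uniformly in $n$. *)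

(* Defs.v *)
From HB Require Import structures.
From mathcomp Require Import all_boot all_order all_algebra finmap.
From mathcomp Require Import generic_quotient ring_quotient.
From mathcomp Require Import all_classical all_reals all_analysis ess_sup_inf measurable_realfun.

Set Implicit Arguments.
Unset Strict Implicit.
Unset Printing Implicit Defensive.

Import Order.TTheory GRing.Theory Num.Theory.
Import numFieldNormedType.Exports.

Local Open Scope classical_set_scope.
Local Open Scope ring_scope.
(* All Banach spaces are real: a [completeNormedModType R] with [R : realType].
   [bop V W] is the space of bounded operators, normed by the operator norm. *)
Section BoundedOperators.
Context {R : realType} (V W : normedModType R).

Definition bounded_linear : {pred V -> W} :=
  mem [set f : V -> W | linear f /\ exists C : R, forall x, `|f x| <= C * `|x|].

Record bop := Bop { bop_fun :> V -> W; _ : bop_fun \in bounded_linear }.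

HB.instance Definition _ := [isSub for bop_fun].
HB.instance Definition _ := [Choice of bop by <:].

Lemma bounded_linearP (f : V -> W) : f \in bounded_linear <->
  linear f /\ exists C : R, forall x, `|f x| <= C * `|x|.
Proof. by split=> [|h]; [rewrite inE|rewrite inE]. Qed.

Lemma bounded_linear_submod : submod_closed bounded_linear.
Proof.
split.
  apply/bounded_linearP; split; first by move=> a u v /=; rewrite [(0 : V -> W) _]/(0 : W) /= [RHS]addr0 scaler0.
  by exists 0 => x; rewrite mul0r [X in `|X|]/(0 : W) normr0.
move=> a f g /bounded_linearP[lf [C fC]] /bounded_linearP[lg [D gD]].
apply/bounded_linearP; split.
  move=> b u v; rewrite !fctE lf lg !scalerDr !scalerA [b * a]mulrC.
  by rewrite addrACA.
exists (`|a| * C + D) => x; rewrite !fctE mulrDl -mulrA.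
rewrite (le_trans (ler_normD _ _))// lerD//.
by rewrite normrZ ler_wpM2l.
Qed.

HB.instance Definition _ := GRing.isSubmodClosed.Build R (V -> W)
  bounded_linear bounded_linear_submod.
HB.instance Definition _ := [SubChoice_isSubLmodule of bop by <:].

Lemma bop_linear (f : bop) : linear f.
Proof. by case: f => f /= /bounded_linearP[]. Qed.

HB.instance Definition _ (f : bop) :=
  GRing.isLinear.Build R V W *:%R (bop_fun f) (bop_linear f).

Definition opnorm (f : bop) : R := sup [set `|f x| | x in [set x | `|x| <= 1]].

Lemma opnorm_has_sup (f : bop) : has_sup [set `|f x| | x in [set x : V | `|x| <= 1]].
Proof.
split; first by exists `|f 0|, 0 => //=; rewrite normr0.
case: f => f /= /bounded_linearP[_ [C fC]].
exists `|C| => _ [x /= x1 <-]; rewrite (le_trans (fC x))//.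
rewrite (le_trans (ler_norm _))// normrM normr_id ler_piMr//.
Qed.

Lemma opnorm_ge0 (f : bop) : 0 <= opnorm f.
Proof.
apply: (@le_trans _ _ `|f 0|) => //; apply: sup_upper_bound.
  exact: opnorm_has_sup.
by exists 0 => //=; rewrite normr0.
Qed.

Lemma opnormP (f : bop) (x : V) : `|f x| <= opnorm f * `|x|.
Proof.
have [->|x0] := eqVneq x 0; first by rewrite linear0 !normr0 mulr0.
have nx0 : 0 < `|x| by rewrite normr_gt0.
rewrite -ler_pdivrMr// mulrC -[X in X * _]gtr0_norm ?invr_gt0// -normrZ -linearZ.
apply: sup_upper_bound; first exact: opnorm_has_sup.
by exists (`|x|^-1 *: x) => //=; rewrite normfZV.
Qed.

Lemma opnorm_le (f : bop) (C : R) : 0 <= C ->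
  (forall x, `|f x| <= C * `|x|) -> opnorm f <= C.
Proof.
move=> C0 fC; apply: ge_sup; first by case: (opnorm_has_sup f).
by move=> _ [x /= x1 <-]; rewrite (le_trans (fC x))// ler_piMr.
Qed.

Lemma opnormD (f g : bop) : opnorm (f + g) <= opnorm f + opnorm g.
Proof.
apply: opnorm_le; first by rewrite addr_ge0 ?opnorm_ge0.
move=> x; rewrite mulrDl; apply: (le_trans (ler_normD _ _)).
by rewrite lerD ?opnormP.
Qed.

Lemma opnormZ (a : R) (f : bop) : opnorm (a *: f) = `|a| * opnorm f.
Proof.
have le1 b (h : bop) : opnorm (b *: h) <= `|b| * opnorm h.
  apply: opnorm_le; first by rewrite mulr_ge0 ?opnorm_ge0.
  by move=> x; rewrite -mulrA normrZ ler_wpM2l ?opnormP.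
have [->|a0] := eqVneq a 0.
  apply/eqP; rewrite eq_le le1 normr0 mul0r.
  by rewrite opnorm_ge0.
apply/eqP; rewrite eq_le le1 /=.
rewrite -ler_pdivlMl ?normr_gt0// -normfV (le_trans _ (le1 _ _))//.
by rewrite scalerA mulVf// scale1r.
Qed.

Lemma opnorm_eq0 (f : bop) : opnorm f = 0 -> f = 0.
Proof.
move=> f0; apply/val_inj/funext => x; apply/eqP; rewrite -normr_le0.
by rewrite (le_trans (opnormP f x))// f0 mul0r.
Qed.

HB.instance Definition _ :=
  Lmodule_isNormed.Build R bop opnormD opnormZ opnorm_eq0.

Lemma bop_normP (f : bop) (x : V) : `|f x| <= `|f| * `|x|.
Proof. exact: opnormP. Qed.

End BoundedOperators.

Section BoundedOperatorsComplete.
Context {R : realType} (V : normedModType R) (W : completeNormedModType R).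

Lemma bop_complete (F : set_system (bop V W)) :
  ProperFilter F -> cauchy F -> cvg F.
Proof.
move=> FF /cauchy_ballP Fc.
have nearF (e : R) : 0 < e ->
    \forall f \near F & g \near F,
      forall x, `|bop_fun f x - bop_fun g x| <= e * `|x|.
  move=> e0; have := Fc e e0; apply: filterS => -[f g] /=.
  rewrite -ball_normE /= => fge x.
  by rewrite (le_trans (opnormP (f - g) x))// ler_wpM2r// ltW.
have cvgx x : cvg ((fun f : bop V W => f x) @ F).
  apply: cauchy_cvg; apply/cauchy_ballP => e e0.
  have e'0 : 0 < e / (`|x| + 1) by rewrite divr_gt0// ltr_wpDl.
  have [[A B] [/= FA FB] AB] := nearF _ e'0.
  exists ((fun f : bop V W => f x) @` A, (fun f : bop V W => f x) @` B).
    by split; [apply: filterS FA|apply: filterS FB] => f Af; exists f.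
  move=> -[_ _] [/= [f Af <-] [g Bg <-]].
  rewrite /= -ball_normE /=; apply: (le_lt_trans (AB (f, g) _ x)) => //.
  rewrite mulrAC ltr_pdivrMr ?ltr_wpDl// ltr_pM2l// ltrDl ltr01.
  by [].
pose l x := lim ((fun f : bop V W => f x) @ F).
have ll : linear l.
  move=> a u v; apply: cvg_lim => //.
  rewrite [X in X @ _](_ : _ = (fun f : bop V W => a *: f u + f v)).
    by apply: cvgD; [apply: cvgZr; exact: cvgx|exact: cvgx].
  by apply/funext => f; rewrite linearP.
have close (e : R) : 0 < e -> \forall f \near F, forall x, `|bop_fun f x - l x| <= e * `|x|.
  move=> e0; have := nearF e e0 => /nearP_dep; apply: filterS => f Ff x.
  have fl : (fun g : bop V W => `|f x - g x|) @ F --> `|f x - l x|.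
    by apply: cvg_norm; apply: cvgB; [exact: cvg_cst|exact: cvgx].
  rewrite -(cvg_lim _ fl)//; apply: limr_le; first by apply/cvg_ex; eexists; exact: fl.
  by apply: filterS Ff => g; exact.
have [f0 f0l] := filter_ex (close 1 ltr01).
have lb : l \in @bounded_linear R V W.
  apply/bounded_linearP; split => //; exists (1 + opnorm f0) => x.
  rewrite -[l x](subrK (f0 x)) mulrDl (le_trans (ler_normD _ _))//.
  by rewrite lerD ?opnormP// distrC.
apply/cvg_ex; exists (Bop lb); apply/cvgrPdist_le => /= e e0.
apply: filterS (close _ e0) => f fl.
apply: (@opnorm_le _ _ _ (Bop lb - f)); first exact: ltW.
by move=> x; rewrite /= distrC; exact: fl.
Qed.

HB.instance Definition _ := Uniform_isComplete.Build (bop V W) bop_complete.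

End BoundedOperatorsComplete.

(* [L_p(mu)] as a normed space: [LfunType] modulo a.e. equality.  The library's
   [LspaceType] is the same quotient but carries no vector-space structure. *)
Section LpSpace.
Context d (T : measurableType d) {R : realType}.
Variables (mu : {measure set T -> \bar R}) (p : \bar R) (p1 : (1 <= p)%E).

Local Notation Lf := (LfunType mu p1).

Definition Lnull : {pred Lf} := mem [set f : Lf | {ae mu, forall x, f x = 0}].

Lemma LnullP (f : Lf) : f \in Lnull <-> {ae mu, forall x, f x = 0}.
Proof. by split=> [|h]; rewrite inE. Qed.

Lemma Lnull_submod : submod_closed Lnull.
Proof.
split; first by apply/LnullP; apply: aeW.
move=> a f g /LnullP f0 /LnullP g0; apply/LnullP.
apply: filterS2 f0 g0 => x fx gx.
by transitivity (a * f x + g x); rewrite // fx gx mulr0 addr0.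
Qed.

HB.instance Definition _ := GRing.isSubmodClosed.Build R Lf Lnull Lnull_submod.

Definition Lp : Type := Quotient.quot Lnull.

HB.instance Definition _ := GRing.Zmodule.on Lp.

Definition Lclass (f : Lf) : Lp := \pi_(Quotient.quot Lnull)%qT f.
Definition Lrepr (f : Lp) : Lf := repr (f : Quotient.quot Lnull).

Lemma LreprK f : Lclass (Lrepr f) = f.
Proof. exact: reprK. Qed.

Lemma Lclass_eqN (f g : Lf) : Lclass f = Lclass g <-> f - g \in Lnull.
Proof.
rewrite /Lclass; split=> [fg|fg].
  by rewrite Quotient.idealrBE; apply/eqP.
by apply/eqP; rewrite -Quotient.idealrBE.
Qed.

Lemma Lclass_eq (f g : Lf) :
  Lclass f = Lclass g <-> {ae mu, forall x, f x = g x}.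
Proof.
rewrite Lclass_eqN; split=> [/LnullP|fg].
  by apply: filterS => x fg; apply/subr0_eq; exact: fg.
apply/LnullP; apply: filterS fg => x fg.
have -> : (f - g) x = f x - g x by [].
by rewrite fg subrr.
Qed.

Lemma LclassD (f g : Lf) : Lclass (f + g) = Lclass f + Lclass g.
Proof. exact: Quotient.pi_add. Qed.

Definition Lscale (a : R) (f : Lp) : Lp := Lclass (a *: Lrepr f).

Lemma LclassZ (a : R) (f : Lf) : Lclass (a *: f) = Lscale a (Lclass f).
Proof.
apply/Lclass_eqN; rewrite -scalerBr; apply: (rpredZ a).
by apply/Lclass_eqN; rewrite LreprK.
Qed.

Lemma LscaleA a b f : Lscale a (Lscale b f) = Lscale (a * b) f.
Proof. by rewrite -[f]LreprK -!LclassZ scalerA. Qed.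

Lemma Lscale1 : left_id 1 Lscale.
Proof. by move=> f; rewrite -[f in LHS]LreprK -LclassZ scale1r LreprK. Qed.

Lemma LscaleDr : right_distributive Lscale +%R.
Proof.
move=> a f g.
by rewrite -[f]LreprK -[g]LreprK -LclassD -!LclassZ -LclassD scalerDr.
Qed.

Lemma LscaleDl f : {morph Lscale^~ f : a b / a + b}.
Proof. by move=> a b; rewrite -[f]LreprK -!LclassZ -LclassD scalerDl. Qed.

HB.instance Definition _ :=
  GRing.Zmodule_isLmodule.Build R Lp LscaleA Lscale1 LscaleDr LscaleDl.

Definition Lpnorm (f : Lp) : R := fine ('N[mu]_p[EFin \o Lrepr f])%E.

Lemma ae0_Lnorm (f : Lf) : {ae mu, forall x, f x = 0} ->
  ('N[mu]_p[EFin \o f] = 0)%E.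
Proof.
move=> f0; have p0 : p != 0%E by rewrite gt_eqF// (lt_le_trans _ p1).
rewrite -(Lnorm0 mu p0) !unlock.
have mf : measurable_fun [set: T] (f : T -> R) by [].
move: (f : T -> R) mf f0 => h mh h0.
have p_ge0 : (0 <= p)%E by rewrite (le_trans _ p1).
case: (p) p_ge0 => [r r0| _|//]; last first.
  case: ifPn => // _; apply: eq_ess_sup.
  by apply: filterS h0 => x /= ->.
congr (_ `^ _)%E; apply: ae_eq_integral => //.
- apply/measurable_EFinP; apply: (measurableT_comp (measurable_powR r)).
  exact: measurableT_comp.
- by apply: filterS h0 => x /= -> _.
Qed.

Lemma LpnormE (f : Lf) : Lpnorm (Lclass f) = fine ('N[mu]_p[EFin \o f])%E.
Proof.
have le1 (g h : Lf) : Lclass g = Lclass h ->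
    fine ('N[mu]_p[EFin \o g])%E <= fine ('N[mu]_p[EFin \o h])%E.
  move=> /Lclass_eqN /LnullP /ae0_Lnorm gh0.
  have := ler_LnormD (g - h) h; rewrite subrK => /le_trans; apply.
  by rewrite gh0 /= add0r.
by apply/eqP; rewrite eq_le !le1// LreprK.
Qed.

Lemma LpnormD (f g : Lp) : Lpnorm (f + g) <= Lpnorm f + Lpnorm g.
Proof.
by rewrite -[f]LreprK -[g]LreprK -LclassD !LpnormE; exact: ler_LnormD.
Qed.

Lemma LpnormZ (a : R) (f : Lp) : Lpnorm (a *: f) = `|a| * Lpnorm f.
Proof.
rewrite -[f]LreprK; set g := Lrepr f.
have -> : a *: Lclass g = Lclass (a *: g) by rewrite LclassZ.
rewrite !LpnormE.
apply/EFin_inj; rewrite EFinM !finite_norm_fine.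
exact: (LnormZ g a).
Qed.

Lemma Lpnorm_eq0 (f : Lp) : Lpnorm f = 0 -> f = 0.
Proof.
rewrite -[f]LreprK LpnormE => /fine_Lnormr_eq0 f0.
have -> : Lclass (Lrepr f) = Lclass 0.
  by apply/Lclass_eq; apply: filterS f0 => x fx; exact: fx.
by apply: (@addrI _ (Lclass 0)); rewrite -LclassD !addr0.
Qed.

HB.instance Definition _ :=
  Lmodule_isNormed.Build R Lp LpnormD LpnormZ Lpnorm_eq0.

End LpSpace.

Definition dual {R : realType} (V : normedModType R) : completeNormedModType R :=
  bop V R^o.

Section Operators.
Context {R : realType}.
Implicit Types U V W : normedModType R.

Definition finite_rank V W (T : bop V W) : Prop :=
  exists (n : nat) (w : 'I_n -> W),
    forall v, exists c : 'I_n -> R, T v = \sum_(i < n) c i *: w i.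

Lemma comp_bounded_linear U V W (S : bop V W) (T : bop U V) :
  (S \o T : U -> W) \in @bounded_linear R U W.
Proof.
apply/bounded_linearP; split; first by move=> a u v; rewrite /= !linearP.
exists (`|S| * `|T|) => u; rewrite -mulrA (le_trans (bop_normP S _))//.
by rewrite ler_wpM2l// bop_normP.
Qed.

Definition bop_comp U V W (S : bop V W) (T : bop U V) : bop U W :=
  Bop (comp_bounded_linear S T).

Definition precomp V W (T : bop V W) (f : dual W) : dual V := bop_comp f T.

Lemma precomp_bounded_linear V W (T : bop V W) :
  precomp T \in @bounded_linear R (dual W) (dual V).
Proof.
apply/bounded_linearP; split; first by move=> a f g; apply/val_inj.
exists `|T| => f; apply: (@opnorm_le _ _ _ (precomp T f)).
  by rewrite mulr_ge0.
move=> v; rewrite [X in X * _]mulrC -mulrA (le_trans (bop_normP f _))//.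
by rewrite ler_wpM2l// bop_normP.
Qed.

(* For [T : l_2 -> Z] this is [T^*] with values in [(l_2)^*]; the Riesz
   identification of [(l_2)^*] with [l_2] is isometric and does not affect [pi1]. *)
Definition adjoint V W (T : bop V W) : bop (dual W) (dual V) :=
  Bop (precomp_bounded_linear T).

(* [weak_l1_norm x] is the supremum of [\sum_i |f (x i)|] over the unit ball of
   [V^*]; [pi1 u] is the least constant in the 1-summing inequality, [+oo] if
   there is none. *)
Definition weak_l1_norm V n (x : 'I_n -> V) : R :=
  sup [set \sum_(i < n) `|f (x i)| | f in [set f : dual V | `|f| <= 1]].

Definition pi1 V W (u : bop V W) : \bar R :=
  ereal_inf [set C%:E | C in [set C : R | 0 <= C /\
    forall n (x : 'I_n -> V), \sum_(i < n) `|u (x i)| <= C * weak_l1_norm x]].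

End Operators.

Section SequenceSpace.
Context {R : realType}.

Definition ell2 : normedModType R := Lp (@counting nat R) (lee1n 2).

Lemma indic1_Lfun (n : nat) :
  (\1_[set n] : nat -> R) \in Lfun (@counting nat R) 2%:R%:E.
Proof.
rewrite inE; apply/andP; split; rewrite inE//=.
rewrite /finite_norm Lnorm_counting//; apply: poweR_lty.
rewrite (nneseries_split 0 n.+1)//; last first.
  by move=> k _; exact: poweR_ge0.
rewrite add0n eseries0 ?adde0.
  apply: lte_sum_pinfty => k _.
  by rewrite poweR_lty// ltry.
move=> k nk _; rewrite /= indicE memNset ?normr0 ?powR0 ?pnatr_eq0//.
by move=> /= kn; move: nk; rewrite kn ltnn.
Qed.

Definition ell2_unit (n : nat) : ell2 := Lclass (Lfun_Sub (lee1n 2) (indic1_Lfun n)).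

End SequenceSpace.

Definition Linfty {R : realType} d (Y : measurableType d)
    (nu : {measure set Y -> \bar R}) : normedModType R :=
  Lp nu (leey 1%E).

(* [+oo] if there is no factorization; the infimum is over all measure spaces. *)
Definition gamma_infty {R : realType} (X : normedModType R)
    (T : bop (@ell2 R) X) : \bar R :=
  ereal_inf [set r : \bar R |
    exists (d : measure_display) (Y : measurableType d)
      (nu : {measure set Y -> \bar R})
      (A : bop (@ell2 R) (Linfty nu)) (B : bop (Linfty nu) X),
      T = bop_comp B A /\ r = (`|A| * `|B|)%:E].

Section VectorValued.
Context d (T : measurableType d) {R : realType}.
Variables (mu : {measure set T -> \bar R}) (Z : normedModType R).
Implicit Types f s : T -> Z.

Definition simple_function s : Prop :=
  finite_set (range s) /\ forall z, measurable (s @^-1` [set z]).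

(* Everywhere limits of simple functions: every a.e. class of strongly measurable
   functions has such a representative. *)
Definition strongly_measurable f : Prop :=
  exists s : nat -> T -> Z, (forall n, simple_function (s n)) /\
    forall t, s n t @[n --> \oo] --> f t.

Definition simple_integral s : Z :=
  \sum_(z \in range s) fine (mu (s @^-1` [set z])) *: z.

Definition is_bochner_integral f (y : Z) : Prop :=
  strongly_measurable f /\
  exists s : nat -> T -> Z,
    [/\ forall n, simple_function (s n),
        forall n, (\int[mu]_t `|s n t|%:E < +oo)%E,
        (\int[mu]_t `|s n t - f t|%:E)%E @[n --> \oo] --> 0%E
      & simple_integral (s n) @[n --> \oo] --> y].

(* The Bochner integral is unique; the value is 0 if [f] is not integrable. *)
Definition bochner_integral f : Z := xget 0 [set y | is_bochner_integral f y].

(* [(\int ||f||^2 dmu)^(1/2)] *)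
Definition L2norm f : \bar R := ('N[mu]_2%:E[EFin \o (Num.norm \o f)])%E.

Definition in_L2 f : Prop := strongly_measurable f /\ (L2norm f < +oo)%E.

End VectorValued.

Section Gaussian.
Context d (Omega : measurableType d) {R : realType} {P : probability Omega R}.
Variable g : nat -> {RV P >-> R}.

Definition standard_gaussian : Prop :=
  forall n (A : set R), measurable A -> distribution P (g n) A = normal_prob 0 1 A.

Definition independent : Prop :=
  forall (I : {fset nat}) (A : nat -> set R), (forall i, measurable (A i)) ->
    P (\bigcap_(i in [set` I]) (g i @^-1` A i)) =
      (\prod_(i <- I) P (g i @^-1` A i))%E.

(* The sum in [L_2(P, Z)] of the series [\sum_n g_n T e_n], determined up to a
   [P]-null set. *)
Definition gaussian_sum (Z : normedModType R) (T : bop (@ell2 R) Z) : Omega -> Z :=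
  xget (cst 0) [set F : Omega -> Z | in_L2 P F /\
    L2norm P (fun t => \sum_(n < N) g n t *: T (ell2_unit n) - F t)
      @[N --> \oo] --> 0%E].

Definition ell_norm (Z : normedModType R) (T : bop (@ell2 R) Z) : \bar R :=
  L2norm P (gaussian_sum T).

Definition GAP (Z : completeNormedModType R) : Prop :=
  exists K : R, forall T : bop (@ell2 R) Z, finite_rank T ->
    (ell_norm T <= K%:E * pi1 (adjoint T))%E.

Definition K_convex (X : completeNormedModType R) : Prop :=
  exists C : R, forall (n : nat) (f : Omega -> X), in_L2 P f ->
    (L2norm P (fun t => (\sum_(j < n) g j t *:
                 bochner_integral P (fun w => g j w *: f w))%R)
       <= C%:E * L2norm P f)%E.

End Gaussian.

Section Cotype.
Context {R : realType} (X : normedModType R).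

(* [(E ||\sum_i eps_i x_i||^2)^(1/2)] for independent uniform signs [eps_i]. *)
Definition rademacher_average n (x : 'I_n -> X) : R :=
  Num.sqrt ((2 ^+ n)^-1 * \sum_(eps : {ffun 'I_n -> bool})
                 `|\sum_(i < n) (-1) ^+ eps i *: x i| ^+ 2).

Definition has_cotype (q : R) : Prop :=
  exists C : R, forall n (x : 'I_n -> X),
    (\sum_(i < n) `|x i| `^ q) `^ q^-1 <= C * rademacher_average x.

Definition finite_cotype : Prop := exists q : R, 2 <= q /\ has_cotype q.

End Cotype.

(* Main.v *)
(** Everything is reduced to finite families. A matrix [a] with rows in the unit ball of l_2
    and a family [x] in [X] all of whose combinations with coefficients in [-1, 1] have norm
    at most [c] encode a factorization [t_j = \sum_i a_ij x_i] through a finite l_oo space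
    with constant [c]. Up to discretization gamma_infty is the gauge of these [t]; the dual
    norm of a family [phi] of functionals dominates pi_1 of the adjoint of [e_j |-> phi_j],
    by a Hahn-Banach extension from [X^n] to the families indexed by signs.

    (ii) => (i). Finite cotype makes operators on l_oo spaces (q,1)-summing, and Pisier's
    domination theorem bounds [|\sum_i h_i x_i|^q] by a measure applied to an exponential
    function of [h]; its Gaussian integral is bounded, so the l-norm is at most a constant
    times gamma_infty. GAP bounds the Gaussian norm of [phi] by the dual norm, and trace
    duality gives the converse estimate. Pairing Gaussian projections with simple functions
    in the same way gives K-convexity.

    (i) => (ii). For GAP, test a Gaussian sum in the dual against a simple function. By
    K-convexity the Gaussian coefficients of this function form an operator of bounded
    l-norm, hence of bounded gamma_infty, and pi_1 of the adjoint bounds the trace. For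
    cotype: if [X] has no finite cotype, it contains almost isometric copies of l_oo^(2^N);
    the operator whose rows are the sign vectors divided by [sqrt N] has gamma_infty at
    most 2, while its l-norm grows like [sqrt N]. *)
Require Import Defs.
From HB Require Import structures.
From mathcomp Require Import all_boot all_order all_algebra finmap.
From mathcomp Require Import all_classical all_reals all_analysis ess_sup_inf measurable_realfun.
From mathcomp Require Import ring lra.

Set Implicit Arguments.
Unset Strict Implicit.
Unset Printing Implicit Defensive.

Import Order.TTheory GRing.Theory Num.Theory.
Import numFieldNormedType.Exports.

Local Open Scope classical_set_scope.
Local Open Scope ring_scope.

(** * Hahn-Banach theorem *)

(** Two of the norms are not finitary as given: $\gamma_\infty$ ranges over all measure spaces and
    a.e. classes, and the 1-summing norm of the adjoint is tested on the bidual of [X]. For the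
    first, the cells on which finitely many functions $Ae_j$ are almost constant turn a
    factorization into a matrix and a family with almost the same constants. For the second, passing
    from the bidual to [X] would ordinarily call for local reflexivity; instead a family of
    functionals is written as $\phi_i=\sum_\varepsilon\varepsilon_i\psi_\varepsilon$ with
    $\sum\|\psi_\varepsilon\|$ under control, and elements of the bidual can be applied to such a
    sum directly. The dual of $L_2(X)$ is avoided too: Gaussian sums are normed by functions
    constant on cells of rounded Gaussian variables, so every Gaussian coefficient is a finite
    combination of vectors. Pisier's bound is put in exponential form because $E\exp(\sum_j s_jg_j)$
    depends only on $\sum_j s_j^2$. This makes the estimates independent of the sizes of the matrix
    and the family. *)

Section DualFacts.
Context {R : realType} (V : normedModType R).
Implicit Types (F G : dual V).

Lemma dualD F x y : F (x + y) = F x + F y. Proof. exact: linearD. Qed.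
Lemma dualN F x : F (- x) = - F x. Proof. exact: linearN. Qed.
Lemma dualB F x y : F (x - y) = F x - F y. Proof. exact: linearB. Qed.
Lemma dualZ F a x : F (a *: x) = a * F x. Proof. by rewrite linearZ. Qed.
Lemma dual0 F : F 0 = 0. Proof. exact: linear0. Qed.
Lemma dual_sum F (I : Type) (r : seq I) (P : pred I) (x : I -> V) :
  F (\sum_(i <- r | P i) x i) = \sum_(i <- r | P i) F (x i).
Proof. exact: linear_sum. Qed.
Lemma addfE F G x : (F + G) x = F x + G x. Proof. by []. Qed.
Lemma scalefE (a : R) F x : (a *: F) x = a * F x. Proof. by []. Qed.
Lemma oppfE F x : (- F) x = - F x. Proof. by []. Qed.
Lemma zerofE x : (0 : dual V) x = 0. Proof. by []. Qed.
Lemma sumfE (I : Type) (r : seq I) (P : pred I) (F : I -> dual V) x :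
  (\sum_(i <- r | P i) F i) x = \sum_(i <- r | P i) F i x.
Proof.
by elim: r => [|i r IH]; rewrite ?big_nil ?big_cons//; case: ifP => _; rewrite ?addfE IH.
Qed.
Lemma dual_le F x : `|F x| <= `|F| * `|x|. Proof. exact: bop_normP. Qed.

Lemma dual_le1 F x : `|F| <= 1 -> F x <= `|x|.
Proof.
move=> F1; apply: le_trans (ler_norm _) _; apply: le_trans (dual_le F x) _.
by rewrite ler_piMl.
Qed.

Lemma dual_norm_le F (C : R) : 0 <= C -> (forall x, F x <= C * `|x|) -> `|F| <= C.
Proof.
move=> C0 FC; apply: opnorm_le => // x; rewrite ler_norml FC andbT lerNl.
by rewrite -dualN -(normrN x).
Qed.

End DualFacts.

Section HahnBanach.
Context {R : realType}.

Definition sublinear (V : lmodType R) (p : V -> R) : Prop :=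
  (forall x y, p (x + y) <= p x + p y) /\
  (forall (a : R) x, 0 < a -> p (a *: x) <= a * p x).

Section Sublinear.
Variables (V : lmodType R) (p : V -> R).
Hypothesis sp : sublinear p.

Lemma sublinearD x y : p (x + y) <= p x + p y. Proof. exact: sp.1. Qed.

Lemma sublinearZ a x : 0 < a -> p (a *: x) = a * p x.
Proof.
move=> a0; apply/eqP; rewrite eq_le sp.2//=.
rewrite -ler_pdivlMl// (le_trans _ (sp.2 _ _ _))// ?invr_gt0//.
by rewrite scalerA mulVf ?scale1r// gt_eqF.
Qed.

Lemma sublinear0 : p 0 = 0.
Proof.
have := @sublinearZ 2 0 (ltr0Sn _ _); rewrite scaler0 => /eqP.
by rewrite -subr_eq0 -{1}[p 0]mul1r -mulrBl mulf_eq0 => /orP[|/eqP//]; lra.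
Qed.

Lemma sublinearN x : - p (- x) <= p x.
Proof. by rewrite lerNl -subr_ge0 opprK -sublinear0 -(subrr x) addrC sublinearD. Qed.

End Sublinear.

(** The infima taken below, over a chain, over a ray and over a subspace, all have this shape; the
    lower bound [- p (- x)] keeps them finite. *)
Lemma inf_sublinear (V : lmodType R) (p : V -> R) (I : Type) (D : set I)
    (F : I -> V -> R) (i0 : I) : D i0 -> sublinear p ->
  (forall i x, D i -> - p (- x) <= F i x) ->
  (forall i j x y, D i -> D j -> exists2 k, D k & F k (x + y) <= F i x + F j y) ->
  (forall i (a : R) x, D i -> 0 < a -> exists2 k, D k & F k (a *: x) <= a * F i x) ->
  sublinear (fun x => inf [set F i x | i in D]).
Proof.
move=> Di0 sp lb FD FZ.
have hl x : has_lbound [set F i x | i in D].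
  by exists (- p (- x)) => _ [i Di <-]; exact: lb.
split.
- move=> x y; apply/ler_addgt0Pr => e e0.
  have e20 : 0 < e / 2 by rewrite divr_gt0.
  have hi z : has_inf [set F i z | i in D] by split; [exists (F i0 z), i0|].
  have [_ [i Di <-] ix] := inf_adherent e20 (hi x).
  have [_ [j Dj <-] jy] := inf_adherent e20 (hi y).
  have [k Dk kxy] := FD i j x y Di Dj.
  apply: (@le_trans _ _ (F k (x + y))); first by apply: ge_inf => //; exists k.
  apply: (le_trans kxy); lra.
- move=> a x a0; rewrite -ler_pdivrMl//; apply: lb_le_inf.
    by exists (F i0 x), i0.
  move=> _ [i Di <-]; rewrite ler_pdivrMl//.
  have [k Dk kx] := FZ i a x Di a0.
  by apply: le_trans kx; apply: ge_inf => //; exists k.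
Qed.

Lemma minimal_sublinear (V : lmodType R) (p : V -> R) : sublinear p ->
  exists q, [/\ sublinear q, (forall x, q x <= p x) &
    forall q', sublinear q' -> (forall x, q' x <= q x) -> q' = q].
Proof.
move=> sp.
pose T := {q : V -> R | sublinear q /\ forall x, q x <= p x}.
pose rT (q q' : T) := `[< forall x, sval q' x <= sval q x >].
have [||||[q [sq qp]] qmin] := @Zorn T rT.
- by move=> q; apply/asboolP.
- by move=> q r s /asboolP qr /asboolP rs; apply/asboolP => x; exact: le_trans (rs x) (qr x).
- move=> [q hq] [r hr] /asboolP qr /asboolP rq; apply/eq_exist => //=.
  by apply/funext => x; apply/eqP; rewrite eq_le rq qr.
- move=> A totA; have [->|/set0P[q0 Aq0]] := eqVneq A set0.
    by exists (exist _ p (conj sp (fun=> lexx _))).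
  have lb (q : T) x : - p (- x) <= sval q x.
    by case: q => q [sq qp] /=; rewrite (le_trans _ (sublinearN sq x))// lerN2.
  have hl x : has_lbound [set sval q x | q in A].
    by exists (- p (- x)) => _ [i Di <-]; exact: lb.
  have sr : sublinear (fun x => inf [set sval q x | q in A]).
    apply: (@inf_sublinear V p T A (fun q => sval q) q0) => //.
    - move=> q r x y Aq Ar; case: (totA q r Aq Ar) => /asboolP qr.
        exists r => //; rewrite (le_trans (sublinearD (svalP r).1 _ _))//.
        by rewrite lerD2r.
      exists q => //; rewrite (le_trans (sublinearD (svalP q).1 _ _))//.
      by rewrite lerD2l.
    - by move=> q a x Aq a0; exists q => //; rewrite (sublinearZ (svalP q).1).
  have rp x : inf [set sval q x | q in A] <= p x.
    apply: (le_trans _ ((svalP q0).2 x)); apply: ge_inf => //; by exists q0.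
  exists (exist _ (fun x => inf [set sval q x | q in A]) (conj sr rp)) => q Aq; apply/asboolP => x /=.
  by apply: ge_inf => //; exists q.
exists q; split=> // q' sq' q'q.
have q'p x : q' x <= p x by exact: le_trans (q'q x) (qp x).
have := qmin (exist _ q' (conj sq' q'p)).
by move=> /(_ (asboolT q'q)) [].
Qed.

(** A minimal sublinear [q] is linear. For each [x] the infimum over $t\ge0$ of $q(z+tx)-tq(x)$ is
    again sublinear and below [q], hence equal to [q]; its term with $t=1$ gives superadditivity. *)
Theorem Hahn_Banach_sublinear (V : lmodType R) (p : V -> R) : sublinear p ->
  exists f : V -> R, scalar f /\ forall x, f x <= p x.
Proof.
move=> sp; have [q [sq qp qmin]] := minimal_sublinear sp.
have super x y : q y + q x <= q (y + x).
  have lb t z : 0 <= t -> - q (- z) <= q (z + t *: x) - t * q x.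
    rewrite le_eqVlt => /predU1P[<-|t0].
      by rewrite scale0r mul0r addr0 subr0 sublinearN.
    rewrite -(sublinearZ sq)//.
    have := sublinearD sq (z + t *: x) (- z).
    by rewrite [in q (_ - z)]addrAC subrr add0r; lra.
  have sr : sublinear (fun z => inf [set q (z + t *: x) - t * q x | t in [set t | 0 <= t]]).
    apply: (@inf_sublinear V q R [set t | 0 <= t] (fun t z => q (z + t *: x) - t * q x) 0) => //=.
    - move=> s t z w s0 t0; exists (s + t); first exact: addr_ge0.
      rewrite scalerDl addrACA mulrDl.
      have := sublinearD sq (z + s *: x) (w + t *: x); lra.
    - move=> t a z t0 a0; exists (a * t); first by rewrite mulr_ge0// ltW.
      by rewrite -scalerA -scalerDr (sublinearZ sq)// mulrBr mulrA.
  have rq z : inf [set q (z + t *: x) - t * q x | t in [set t | 0 <= t]] <= q z.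
    apply: ge_inf; first by exists (- q (- z)) => _ [t /= t0 <-]; exact: lb.
    by exists 0 => //=; rewrite scale0r addr0 mul0r subr0.
  have {1}<- := qmin _ sr rq.
  rewrite -lerBrDr; apply: ge_inf.
    by exists (- q (- y)) => _ [t /= t0 <-]; exact: lb.
  by exists 1 => //=; rewrite scale1r mul1r.
have qD x y : q (x + y) = q x + q y.
  by apply/eqP; rewrite eq_le (sublinearD sq) super.
have qN x : q (- x) = - q x.
  by apply/eqP; rewrite -subr_eq0 opprK -qD addrC subrr (sublinear0 sq).
have qZ a x : q (a *: x) = a * q x.
  have [a0|a0|->] := ltgtP a 0; last by rewrite scale0r mul0r (sublinear0 sq).
    rewrite -[a]opprK scaleNr qN (sublinearZ sq) ?oppr_gt0//.
    by rewrite !mulNr.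
  by rewrite (sublinearZ sq).
by exists q; split => // a x y; rewrite qD qZ.
Qed.

(* The linear functional is found below the sublinear functional
   [v |-> inf_w (p (v + J w) - phi w)]. *)
Theorem Hahn_Banach (V W : lmodType R) (J : {linear W -> V}) (p : V -> R)
    (phi : W -> R) : sublinear p -> scalar phi -> (forall w, phi w <= p (J w)) ->
  exists f : V -> R,
    [/\ scalar f, forall v, f v <= p v & forall w, f (J w) = phi w].
Proof.
move=> sp lphi phip.
have phiD x y : phi (x + y) = phi x + phi y by have := lphi 1 x y; rewrite scale1r mul1r.
have phi0 : phi 0 = 0 by have := phiD 0 0; rewrite addr0; lra.
have phiZ a x : phi (a *: x) = a * phi x by have := lphi a x 0; rewrite !addr0 phi0 addr0.
have phiN x : phi (- x) = - phi x by rewrite -scaleN1r phiZ mulN1r.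
have lb w v : - p (- v) <= p (v + J w) - phi w.
  have := sublinearD sp (v + J w) (- v); rewrite addrAC subrr add0r.
  have := phip w; lra.
pose r v := inf [set p (v + J w) - phi w | w in [set: W]].
have rle v w : r v <= p (v + J w) - phi w.
  by apply: ge_inf; [exists (- p (- v)) => _ [u _ <-]|exists w].
have sr : sublinear r.
  apply: (@inf_sublinear V p W setT (fun w v => p (v + J w) - phi w) 0) => //=.
  - move=> s t z w _ _; exists (s + t) => //; rewrite linearD addrACA phiD.
    have := sublinearD sp (z + J s) (w + J t); lra.
  - move=> t a z _ a0; exists (a *: t) => //.
    by rewrite linearZ -scalerDr (sublinearZ sp)// phiZ mulrBr.
have [f [lf fr]] := Hahn_Banach_sublinear sr.
have fD x y : f (x + y) = f x + f y by have := lf 1 x y; rewrite scale1r mul1r.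
have f0 : f 0 = 0 by have := fD 0 0; rewrite addr0; lra.
have fN x : f (- x) = - f x by have := fD x (- x); rewrite subrr f0; lra.
have fJ w : f (J w) <= phi w.
  apply: (le_trans (fr _)); apply: (le_trans (rle _ (- w))).
  by rewrite linearN subrr (sublinear0 sp) phiN; lra.
exists f; split => // [v|w].
  by apply: (le_trans (fr _)); apply: (le_trans (rle _ 0)); rewrite linear0 phi0 addr0 subr0.
apply/eqP; rewrite eq_le fJ /=.
by have := fJ (- w); rewrite linearN fN phiN lerN2.
Qed.

Lemma sublinear_support (V : lmodType R) (p : V -> R) (x : V) : sublinear p ->
  exists f : V -> R, [/\ scalar f, forall v, f v <= p v & f x = p x].
Proof.
move=> sp; have lJ : linear (fun t : R^o => t *: x).
  by move=> a y z /=; rewrite scalerDl -scalerA.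
pose Jm := GRing.isLinear.Build R R^o V *:%R (fun t : R^o => t *: x) lJ.
pose J : {linear R^o -> V} := HB.pack (fun t : R^o => t *: x) Jm.
have [||f [lf fp fJ]] := @Hahn_Banach V R^o J p (fun t => t * p x) sp.
- by move=> a y z /=; rewrite mulrDl -mulrA.
- move=> t /=; have [t0|t0|<-] := ltgtP 0 t.
  + by rewrite sublinearZ.
  + apply: le_trans (sublinearN sp _).
    by rewrite -scaleNr sublinearZ ?oppr_gt0// mulNr opprK.
  + by rewrite mul0r scale0r sublinear0.
by exists f; split=> //; have := fJ 1; rewrite /= scale1r mul1r.
Qed.

Lemma dual_of_bound (V : normedModType R) (f : V -> R) (C : R) : 0 <= C ->
  scalar f -> (forall x, f x <= C * `|x|) ->
  exists F : dual V, (forall x, F x = f x) /\ `|F| <= C.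
Proof.
move=> C0 lf fC.
have fD x y : f (x + y) = f x + f y by have := lf 1 x y; rewrite scale1r mul1r.
have f0 : f 0 = 0 by have := fD 0 0; rewrite addr0; lra.
have fN x : f (- x) = - f x by have := fD x (- x); rewrite subrr f0; lra.
have fC' x : `|f x| <= C * `|x|.
  by rewrite ler_norml fC andbT lerNl -fN -(normrN x).
have bf : (f : V -> R^o) \in @bounded_linear R V R^o.
  by apply/bounded_linearP; split => //; exists C.
exists (Bop bf); split=> //.
exact: (@opnorm_le _ _ _ (Bop bf)).
Qed.

Lemma norm_sublinear (V : normedModType R) (C : R) : 0 <= C ->
  sublinear (fun x : V => C * `|x|).
Proof.
move=> C0; split=> [x y|a x a0].
  by rewrite -mulrDr ler_wpM2l// ler_normD.
by rewrite normrZ gtr0_norm// mulrCA.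
Qed.

Lemma norming_functional (V : normedModType R) (v : V) :
  exists f : dual V, `|f| <= 1 /\ f v = `|v|.
Proof.
have [f [lf fp fv]] := sublinear_support v (norm_sublinear V ler01).
have [F [Ff F1]] := dual_of_bound ler01 lf fp.
by exists F; rewrite Ff fv mul1r.
Qed.

End HahnBanach.

(** * The space l_2 and finite rank operators *)

Section CauchySchwarz.
Context {R : realType}.

(** The inequality $2ab\le ka^2+k^{-1}b^2$ with $k=B/A$. Both bounds are first enlarged by [e], so
    that $k$ makes sense when [A] or [B] vanishes. *)
Lemma sum_mul_le (I : Type) (r : seq I) (P : pred I) (a b : I -> R) (A B : R) :
  0 <= A -> 0 <= B ->
  \sum_(i <- r | P i) a i ^+ 2 <= A ^+ 2 ->
  \sum_(i <- r | P i) b i ^+ 2 <= B ^+ 2 ->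
  \sum_(i <- r | P i) a i * b i <= A * B.
Proof.
move=> A0 B0 aA bB.
have main (e : R) : 0 < e -> \sum_(i <- r | P i) a i * b i <= (A + e) * (B + e).
  move=> e0; have Ae : 0 < A + e by lra.
  have Be : 0 < B + e by lra.
  have k0 : 0 < (B + e) / (A + e) by rewrite divr_gt0.
  have : \sum_(i <- r | P i) a i * b i <=
      ((B + e) / (A + e) * (\sum_(i <- r | P i) a i ^+ 2)
        + ((B + e) / (A + e))^-1 * (\sum_(i <- r | P i) b i ^+ 2)) / 2.
    rewrite mulr_sumr mulr_sumr -big_split /= mulr_suml; apply: ler_sum => i _.
    move: ((B + e) / (A + e)) k0 => k k0.
    have kE : k * k^-1 = 1 by rewrite divff// gt_eqF.
    have : 0 <= k^-1 * (k * a i - b i) ^+ 2 by rewrite mulr_ge0 ?sqr_ge0// invr_ge0 ltW.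
    have -> : k^-1 * (k * a i - b i) ^+ 2 =
       (k * k^-1) * k * a i ^+ 2 - 2 * (k * k^-1) * (a i * b i) + k^-1 * b i ^+ 2 by ring.
    by rewrite kE; lra.
  move=> /le_trans; apply.
  have h1 : (B + e) / (A + e) * (\sum_(i <- r | P i) a i ^+ 2) <= (B + e) * (A + e).
    rewrite -mulrA ler_pM2l// ler_pdivrMl// (le_trans aA)//.
    by rewrite -expr2 ler_pXn2r// ?nnegrE ?lerDl ltW.
  have h2 : ((B + e) / (A + e))^-1 * (\sum_(i <- r | P i) b i ^+ 2) <= (B + e) * (A + e).
    rewrite invf_div -mulrA [leRHS]mulrC ler_pM2l// ler_pdivrMl// (le_trans bB)//.
    by rewrite -expr2 ler_pXn2r// ?nnegrE ?lerDl ltW.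
  by lra.
apply/ler_addgt0Pr => e e0.
(* From $d\le1$ and $dD\le e$ follows $(A+d)(B+d)\le AB+d(A+B+1)\le AB+e$. *)
pose D := A + B + 1.
have D0 : 0 < D by rewrite /D; lra.
pose d := Num.min 1 (e / D).
have d0 : 0 < d by rewrite lt_min ltr01 divr_gt0.
have d1 : d <= 1 by rewrite ge_min lexx.
have dD : d * D <= e by rewrite -ler_pdivlMr// ge_min lexx orbT.
apply: (le_trans (main d d0)).
have : d * d <= d by rewrite ler_piMr// ltW.
rewrite /D in dD; nra.
Qed.

Lemma ler_norm_sum_mul (I : Type) (r : seq I) (P : pred I) (a b : I -> R) (A B : R) :
  0 <= A -> 0 <= B ->
  \sum_(i <- r | P i) a i ^+ 2 <= A ^+ 2 ->
  \sum_(i <- r | P i) b i ^+ 2 <= B ^+ 2 ->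
  `|\sum_(i <- r | P i) a i * b i| <= A * B.
Proof.
move=> A0 B0 aA bB; rewrite ler_norml sum_mul_le// andbT lerNl -sumrN.
under eq_bigr do rewrite -mulNr.
by apply: sum_mul_le => //; under eq_bigr do rewrite sqrrN.
Qed.

End CauchySchwarz.

Section Ell2.
Context {R : realType}.
Local Notation l2 := (@ell2 R).
Local Notation e := (@ell2_unit R).
Implicit Types (h : l2) (a : nat -> R).

Definition coord (j : nat) (h : l2) : R := Lrepr h j.

(** Singletons have counting measure 1, so null sets are empty. This makes [coord] independent of
    the chosen representative. *)
Lemma ae_counting (P : nat -> Prop) : {ae @counting nat R, forall x, P x} -> forall x, P x.
Proof.
move=> H x; have [A [mA A0 PA]] : (@counting nat R).-negligible (~` [set x | P x]) := H.
apply: contrapT => Px.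
have Ax : A x by exact: PA.
have : (@counting nat R [set x] <= @counting nat R A)%E.
  by apply: le_measure; rewrite ?inE// => y ->.
by rewrite A0 /counting asboolT// fset_set1 cardfs1 lee_fin ler10.
Qed.

Lemma coordE j f : coord j (Lclass f) = f j.
Proof.
have : Lclass (Lrepr (Lclass f)) = Lclass f by rewrite LreprK.
by move=> /Lclass_eq /ae_counting /(_ j).
Qed.

Lemma coordP j : scalar (coord j).
Proof.
move=> a f g; rewrite -[f in LHS]LreprK -[g in LHS]LreprK.
have -> : a *: Lclass (Lrepr f) = Lclass (a *: Lrepr f) by rewrite LclassZ.
by rewrite -LclassD coordE.
Qed.

Lemma coordZ j (a : R) h : coord j (a *: h) = a * coord j h.
Proof.
have := coordP j a h 0; rewrite addr0 => ->.
suff -> : coord j 0 = 0 by rewrite addr0.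
by have := coordP j 1 0 0; rewrite addr0 scale1r; lra.
Qed.

Lemma coordD j h h' : coord j (h + h') = coord j h + coord j h'.
Proof. by have := coordP j 1 h h'; rewrite scale1r mul1r. Qed.

Lemma coordB j h h' : coord j (h - h') = coord j h - coord j h'.
Proof. by rewrite coordD -scaleN1r coordZ mulN1r. Qed.

Lemma coord_sum j (I : Type) (r : seq I) (P : pred I) (F : I -> l2) :
  coord j (\sum_(i <- r | P i) F i) = \sum_(i <- r | P i) coord j (F i).
Proof.
elim/big_rec2 : _ => [|i x y _ <-]; last exact: coordD.
by rewrite -(scale0r (0 : l2)) coordZ mul0r.
Qed.

Lemma coord_unit j n : coord j (e n) = (j == n)%:R.
Proof.
rewrite /ell2_unit coordE.
rewrite [LHS](_ : _ = (\1_[set n] : nat -> R) j)// indicE.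
by congr (nat_of_bool _)%:R; apply/idP/eqP; rewrite inE.
Qed.

Lemma ell2_normE h : (`|h| ^+ 2)%:E = (\sum_(k <oo) (coord k h ^+ 2)%:E)%E.
Proof.
have -> : `|h| = fine ('N[@counting nat R]_2%:E[EFin \o Lrepr h])%E by [].
have : ((fine ('N[@counting nat R]_2%:E[EFin \o Lrepr h]))%:E
   = 'N[@counting nat R]_2%:E[EFin \o Lrepr h])%E by rewrite finite_norm_fine.
set x := fine _ => xE.
have x0 : 0 <= x by rewrite /x fine_ge0// Lnorm_ge0.
have : ('N[@counting nat R]_2%:E[EFin \o Lrepr h] `^ 2 = (x ^+ 2)%:E)%E.
  by rewrite -xE poweR_EFin -powR_mulrn.
rewrite poweR_Lnorm// => <-.
rewrite ge0_integral_count; last by move=> k; exact: poweR_ge0.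
apply: eq_eseriesr => k _.
by rewrite /= powR_mulrn// real_normK// num_real.
Qed.

Lemma sum_coord_le h N : \sum_(j < N) coord j h ^+ 2 <= `|h| ^+ 2.
Proof.
rewrite -lee_fin ell2_normE -sumEFin -(big_mkord xpredT (fun k => (coord k h ^+ 2)%:E)).
apply: nneseries_lim_ge => k _ _; first by rewrite lee_fin sqr_ge0.
Qed.

Lemma ell2_norm_le h (C : R) : 0 <= C ->
  (forall N, \sum_(j < N) coord j h ^+ 2 <= C ^+ 2) -> `|h| <= C.
Proof.
move=> C0 hC; rewrite -(@ler_pXn2r _ 2) ?nnegrE//.
rewrite -lee_fin ell2_normE.
apply: lime_le.
  by apply: is_cvg_nneseries => k _ _; rewrite lee_fin sqr_ge0.
by apply: nearW => N; rewrite big_mkord sumEFin lee_fin.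
Qed.

Definition proj N h : l2 := \sum_(j < N) coord j h *: e j.

Lemma coord_comb N a j : coord j (\sum_(i < N) a i *: e i) = if (j < N)%N then a j else 0.
Proof.
rewrite coord_sum; under eq_bigr do rewrite coordZ coord_unit.
case: ltnP => jN.
  rewrite (bigD1 (Ordinal jN))//= eqxx mulr1 big1 ?addr0// => i.
  rewrite -val_eqE /= eq_sym => /negbTE ->; by rewrite mulr0.
rewrite big1// => i _; rewrite gtn_eqF ?mulr0//.
exact: leq_trans (ltn_ord i) jN.
Qed.

Lemma sum_trunc N M (a : nat -> R) (F : R -> R) : F 0 = 0 -> (forall x, 0 <= F x) ->
  \sum_(j < M) F (if (j < N)%N then a j else 0) <= \sum_(j < N) F (a j).
Proof.
move=> F0 Fp.
have [MN|NM] := leqP M N.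
  rewrite -[leRHS](big_mkord xpredT (fun j => F (a j))) (@big_cat_nat _ _ _ M)//=.
  rewrite big_mkord -[leLHS]addr0 lerD//; last exact: sumr_ge0.
  by apply: ler_sum => i _; rewrite (leq_trans (ltn_ord i) MN).
rewrite -(big_mkord xpredT (fun j => F (if (j < N)%N then a j else 0))).
rewrite (@big_cat_nat _ _ _ N)//=; last exact: ltnW.
rewrite big_mkord [X in _ + X]big1_seq ?addr0.
  by apply: ler_sum => i _; rewrite ltn_ord.
by move=> i /andP[_]; rewrite mem_index_iota => /andP[Ni _]; rewrite ltnNge Ni.
Qed.

Lemma comb_norm_le N a (C : R) : 0 <= C ->
  \sum_(i < N) a i ^+ 2 <= C ^+ 2 -> `|\sum_(i < N) a i *: e i| <= C.
Proof.
move=> C0 aC; apply: ell2_norm_le => // M; apply: le_trans aC.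
under eq_bigr do rewrite coord_comb.
apply: (@sum_trunc N M a (fun x => x ^+ 2)); first by rewrite expr0n.
by move=> x; rewrite sqr_ge0.
Qed.

Lemma unit_norm_le n : `|e n| <= 1.
Proof.
apply: ell2_norm_le => // N; under eq_bigr do rewrite coord_unit.
rewrite expr1n; elim: N => [|N IH]; first by rewrite big_ord0.
rewrite big_ord_recr/=; have [->|] := eqVneq N n; last by rewrite expr0n addr0.
by rewrite big1 ?add0r ?expr1n// => i _; rewrite ltn_eqF ?expr0n// ltn_ord.
Qed.

Lemma coord_tail h (eta : R) : 0 < eta -> exists N0, forall N, (N0 <= N)%N -> `|h - proj N h| <= eta.
Proof.
move=> eta0.
have bnd N : \sum_(j < N) coord j h ^+ 2 <= `|h| ^+ 2 by exact: sum_coord_le.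
pose S := [set \sum_(j < N) coord j h ^+ 2 | N in [set: nat]].
have hS : has_sup S by split; [exists (\sum_(j < 0) coord j h ^+ 2), 0|exists (`|h| ^+ 2) => _ [N _ <-]].
have e2 : 0 < eta ^+ 2 by rewrite exprn_gt0.
have [_ [N0 _ <-] N0S] := sup_adherent e2 hS.
exists N0 => N NN; apply: ell2_norm_le; first exact: ltW.
move=> M.
have cE j : coord j (h - proj N h) = if (j < N)%N then 0 else coord j h.
  by rewrite coordB /proj (coord_comb N (fun j => coord j h)); case: ifP; rewrite (subrr,subr0).
under eq_bigr do rewrite cE.
have [MN|NM] := leqP M N.
  rewrite big1 ?ltW// => i _; by rewrite (leq_trans (ltn_ord i) MN) expr0n.
have supM : \sum_(j < M) coord j h ^+ 2 <= sup S.
  by apply: sup_upper_bound => //; exists M.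
rewrite -(big_mkord xpredT (fun j => coord j h ^+ 2)) in supM.
rewrite (@big_cat_nat _ _ _ N0)//= in supM; last exact: leq_trans NN (ltnW NM).
rewrite big_mkord in supM.
rewrite -(big_mkord xpredT (fun j => (if (j < N)%N then 0 else coord j h) ^+ 2)).
rewrite (@big_cat_nat _ _ _ N0)//=; last exact: leq_trans NN (ltnW NM).
rewrite big1_seq ?add0r; last first.
  by move=> i /andP[_]; rewrite mem_index_iota => /andP[_ iN]; rewrite (leq_trans iN NN) expr0n.
have : \sum_(N0 <= i < M) (if (i < N)%N then 0 else coord i h) ^+ 2
    <= \sum_(N0 <= i < M) coord i h ^+ 2.
  by apply: ler_sum => i _; case: ifP => // _; rewrite expr0n sqr_ge0.
by lra.
Qed.

Lemma fun_of_comb_bounded N a (C : R) : 0 <= C -> \sum_(j < N) a j ^+ 2 <= C ^+ 2 ->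
  exists F : dual l2, (forall h, F h = \sum_(j < N) a j * coord j h) /\ `|F| <= C.
Proof.
move=> C0 aC.
apply: (@dual_of_bound _ _ (fun h => \sum_(j < N) a j * coord j h)) => //.
- move=> t h h' /=; rewrite mulr_sumr -big_split/=; apply: eq_bigr => i _.
  by rewrite coordD coordZ mulrDr mulrCA.
- by move=> h; apply: sum_mul_le => //; exact: sum_coord_le.
Qed.

Lemma proj_apply (V : normedModType R) (T : bop l2 V) N h :
  T (proj N h) = \sum_(j < N) coord j h *: T (e j).
Proof. by rewrite /proj linear_sum; apply: eq_bigr => j _; rewrite linearZ. Qed.

Lemma dual_proj (F : dual l2) N h :
  F (proj N h) = \sum_(j < N) coord j h * F (e j).
Proof. by rewrite dual_sum; apply: eq_bigr => j _; rewrite dualZ. Qed.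

(** Test [F] on $v=\sum_jF(e_j)e_j$: if [s] is the sum, then $s=F(v)\le\|F\|\sqrt s$. *)
Lemma dual_unit_le (F : dual l2) N : \sum_(j < N) F (e j) ^+ 2 <= `|F| ^+ 2.
Proof.
set s := \sum_(j < N) _.
have s0 : 0 <= s by apply: sumr_ge0 => i _; rewrite sqr_ge0.
have [->|sN0] := eqVneq s 0; first by rewrite sqr_ge0.
have hs : `|\sum_(i < N) F (e i) *: e i| <= Num.sqrt s.
  by apply: (@comb_norm_le N (fun i => F (e i))); rewrite ?sqrtr_ge0// sqr_sqrtr.
have := bop_normP F (\sum_(i < N) F (e i) *: e i).
rewrite linear_sum.
under eq_bigr do rewrite linearZ.
have -> : \sum_(i < N) F (e i) *: F (e i) = s by apply: eq_bigr => i _; rewrite expr2.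
rewrite ger0_norm// => /le_trans/(_ (ler_wpM2l (normr_ge0 F) hs)) sF.
have q0 : 0 < Num.sqrt s by rewrite sqrtr_gt0 lt_neqAle eq_sym sN0.
have sE : s = Num.sqrt s ^+ 2 by rewrite sqr_sqrtr.
have : Num.sqrt s <= `|F| by rewrite -(ler_pM2r q0) -expr2 -sE.
by rewrite {2}sE ler_pXn2r ?nnegrE// ltW.
Qed.

(** The estimate is uniform in [h], because between [N] and [M] Cauchy-Schwarz uses the tail of
    $\sum_jF(e_j)^2$ only. The second cut-off [M] depends on [h], but its error [d] is sent to 0.
    This takes the place of the Riesz representation of [F]. *)
Lemma dual_tail (F : dual l2) (eta : R) : 0 < eta -> exists N0, forall N, (N0 <= N)%N ->
  forall h, `|F (h - proj N h)| <= eta * `|h|.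
Proof.
move=> eta0.
pose S := [set \sum_(j < N) F (e j) ^+ 2 | N in [set: nat]].
have hS : has_sup S.
  by split; [exists (\sum_(j < 0) F (e j) ^+ 2), 0
            |exists (`|F| ^+ 2) => _ [N _ <-]; exact: dual_unit_le].
have e2 : 0 < eta ^+ 2 by rewrite exprn_gt0.
have [_ [N0 _ <-] N0S] := sup_adherent e2 hS.
exists N0 => N NN h.
apply/ler_addgt0Pr => d d0.
have F1 : 0 < `|F| + 1 by rewrite ltr_wpDl.
have [M0 hM0] := coord_tail h (divr_gt0 d0 F1).
pose M := maxn M0 N.
have -> : h - proj N h = (proj M h - proj N h) + (h - proj M h).
  by rewrite [RHS]addrC addrA subrK.
rewrite dualD (le_trans (ler_normD _ _))// lerD//; last first.
  rewrite (le_trans (bop_normP _ _))//.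
  rewrite (@le_trans _ _ (`|F| * (d / (`|F| + 1))))// ?ler_wpM2l ?hM0 ?leq_maxl//.
  rewrite mulrCA ler_piMr ?ltW// ltr_pdivrMr// mul1r; lra.
rewrite dualB !dual_proj.
rewrite -(big_mkord xpredT (fun j => coord j h * F (e j))).
rewrite -(big_mkord xpredT (fun j => coord j h * F (e j))).
have NM : (N <= M)%N by exact: leq_maxr.
rewrite (@big_cat_nat _ _ _ N)//= addrAC subrr add0r.
rewrite mulrC; apply: ler_norm_sum_mul => //; first exact: ltW.
  rewrite (le_trans _ (sum_coord_le h M))//.
  rewrite -(big_mkord xpredT (fun j => coord j h ^+ 2)) (@big_cat_nat _ _ _ N 0 M)//=.
  by rewrite lerDr sumr_ge0// => i _; rewrite sqr_ge0.
have supM : \sum_(j < M) F (e j) ^+ 2 <= sup S.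
  by apply: sup_upper_bound => //; exists M.
have le0 : \sum_(j < N0) F (e j) ^+ 2 <= \sum_(j < N) F (e j) ^+ 2.
  rewrite -(big_mkord xpredT (fun j => F (e j) ^+ 2)).
  rewrite -(big_mkord xpredT (fun j => F (e j) ^+ 2)) (@big_cat_nat _ _ _ N0 0 N)//=.
  by rewrite lerDl sumr_ge0// => i _; rewrite sqr_ge0.
move: supM; rewrite -(big_mkord xpredT (fun j => F (e j) ^+ 2)) (@big_cat_nat _ _ _ N)//=.
rewrite big_mkord; lra.
Qed.

End Ell2.

(* Gaussian elimination with norming functionals replaces the choice of a basis:
   no independence of the spanning family is needed. *)
Lemma finite_dim_expansion {R : realType} (V : normedModType R) n (w : 'I_n -> V) :
  exists (psi : 'I_n -> dual V) (u : 'I_n -> V), forall c : 'I_n -> R,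
    let v := \sum_(i < n) c i *: w i in v = \sum_(i < n) psi i v *: u i.
Proof.
elim: n w => [|n IH] w.
  by exists (fun=> 0), w => c /=; rewrite !big_ord0.
have [w0|w0] := eqVneq (w ord0) 0.
  have [psi [u hu]] := IH (fun i => w (lift ord0 i)).
  exists (fun i => if unlift ord0 i is Some j then psi j else 0).
  exists (fun i => if unlift ord0 i is Some j then u j else 0) => c /=.
  rewrite !big_ord_recl !w0 !scaler0 !add0r unlift_none scaler0 add0r.
  under [RHS]eq_bigr do rewrite liftK.
  exact: (hu (fun i => c (lift ord0 i))).
have [f [f1 fw]] := norming_functional (w ord0).
pose F : dual V := `|w ord0|^-1 *: f.
have Fw : F (w ord0) = 1.
  rewrite /F [LHS](_ : _ = `|w ord0|^-1 * f (w ord0))// fw mulVf// normr_eq0//.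
have [psi [u hu]] := IH (fun i => w (lift ord0 i) - F (w (lift ord0 i)) *: w ord0).
exists (fun i => if unlift ord0 i is Some j then psi j - psi j (w ord0) *: F else F).
exists (fun i => if unlift ord0 i is Some j then u j else w ord0) => c /=.
set v := (X in X = _).
rewrite big_ord_recl unlift_none.
have -> : \sum_(i < n) (if unlift ord0 (lift ord0 i) is Some j
      then psi j - psi j (w ord0) *: F else F) v *:
    (if unlift ord0 (lift ord0 i) is Some j then u j else w ord0) =
   \sum_(i < n) psi i (v - F v *: w ord0) *: u i.
  apply: eq_bigr => i _; rewrite liftK; congr (_ *: _).
  by rewrite dualB dualZ addfE oppfE scalefE [F v * _]mulrC.
have vE : v - F v *: w ord0 =
   \sum_(i < n) c (lift ord0 i) *: (w (lift ord0 i) - F (w (lift ord0 i)) *: w ord0).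
  rewrite /v big_ord_recl dualD dualZ Fw dual_sum.
  rewrite mulr1 scalerDl opprD addrACA subrr add0r.
  under [RHS]eq_bigr do rewrite scalerBr scalerA.
  rewrite sumrB -scaler_suml; congr (_ - _ *: _).
  by apply: eq_bigr => i _; rewrite dualZ.
by rewrite vE -(hu (fun i => c (lift ord0 i))) -vE addrC subrK.
Qed.

Lemma finite_rank_expansion {R : realType} (V W : normedModType R) (T : bop V W) :
  finite_rank T -> exists n (psi : 'I_n -> dual V) (u : 'I_n -> W),
    forall v, T v = \sum_(i < n) psi i v *: u i.
Proof.
move=> [n [w Tw]]; have [psi [u hu]] := finite_dim_expansion w.
exists n, (fun i => bop_comp (psi i) T), u => v /=.
by have [c Tv] := Tw v; rewrite {1}Tv (hu c) -Tv.
Qed.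

(** * Factorizations through L_oo *)

Section BoundedFamilies.
Context {R : realType} (V : normedModType R) (I : finType).
Implicit Types (x : I -> V) (c : R).

(* The operator [l_infty^I -> V] mapping the unit vectors to [x] has norm at most [c]. *)
Definition bounded_family x c : Prop :=
  forall a : I -> R, (forall i, `|a i| <= 1) -> `|\sum_i a i *: x i| <= c.

Lemma bounded_family_ge0 x c : bounded_family x c -> 0 <= c.
Proof. by move=> xc; apply: le_trans (xc (fun=> 0) _) => // i; rewrite normr0. Qed.

Lemma bounded_family_functional x c (F : dual V) :
  bounded_family x c -> \sum_i `|F (x i)| <= `|F| * c.
Proof.
move=> xc.
have -> : \sum_i `|F (x i)| = F (\sum_i Num.sg (F (x i)) *: x i).
  rewrite dual_sum; apply: eq_bigr => i _; rewrite dualZ.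
  by rewrite normrEsg mulrC.
rewrite (le_trans (ler_norm _))// (le_trans (dual_le _ _))// ler_wpM2l// xc// => i.
by rewrite normr_sg lern1 leq_b1.
Qed.

Lemma bounded_family_signs x c :
  (forall eps : {ffun I -> bool}, `|\sum_i (-1) ^+ eps i *: x i| <= c) ->
  bounded_family x c.
Proof.
move=> xc a a1; have [F [F1 <-]] := norming_functional (\sum_i a i *: x i).
pose eps := [ffun i => F (x i) < 0].
apply: (@le_trans _ _ (F (\sum_i (-1) ^+ eps i *: x i))); last first.
  rewrite (le_trans (ler_norm _))// (le_trans (dual_le _ _))//.
  by rewrite (le_trans _ (xc eps))// ler_piMl.
rewrite !dual_sum; apply: ler_sum => i _; rewrite !dualZ ffunE.
have := a1 i; rewrite ler_norml => /andP[h1 h2].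
by case: ltrP => h; rewrite ?expr1 ?expr0; nra.
Qed.

Lemma bounded_family_scale x c (t : R) (a : I -> R) : 0 <= t ->
  bounded_family x c -> (forall i, `|a i| <= t) -> `|\sum_i a i *: x i| <= t * c.
Proof.
rewrite le_eqVlt => /predU1P[<-|t0] xc at1.
  rewrite mul0r big1 ?normr0// => i _.
  by have := at1 i; rewrite normr_le0 => /eqP->; rewrite scale0r.
have -> : \sum_i a i *: x i = t *: \sum_i (t^-1 * a i) *: x i.
  rewrite scaler_sumr; apply: eq_bigr => i _; rewrite scalerA mulrA divff ?mul1r//.
  by rewrite gt_eqF.
rewrite normrZ gtr0_norm// ler_pM2l//; apply: xc => i.
by rewrite normrM gtr0_norm ?invr_gt0// ler_pdivrMl// mulr1.
Qed.

End BoundedFamilies.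

Lemma bounded_familyZ {R : realType} (V : normedModType R) (I : finType)
    (x : I -> V) (c t : R) : 0 <= t ->
  bounded_family x c -> bounded_family (fun i => t *: x i) (t * c).
Proof.
move=> t0 xc a a1.
have -> : \sum_i a i *: (t *: x i) = t *: \sum_i a i *: x i.
  by rewrite scaler_sumr; apply: eq_bigr => i _; rewrite !scalerA mulrC.
by rewrite normrZ ger0_norm// ler_wpM2l// xc.
Qed.

Section LinftyFacts.
Context {R : realType} d (Y : measurableType d) (nu : {measure set Y -> \bar R}).
Local Notation Lf := (LfunType nu (leey 1%E)).

Lemma Lclass_norm_le (f : Lf) (C : R) : 0 <= C ->
  {ae nu, forall y, `|f y| <= C} -> `|Lclass f : Linfty nu| <= C.
Proof.
move=> C0 fC; rewrite [X in X <= _]LpnormE.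
suff : ('N[nu]_+oo%E[EFin \o f] <= C%:E)%E.
  by move=> h; rewrite -lee_fin finite_norm_fine.
rewrite unlock; case: ifPn => // _; apply/ess_supP.
by apply: filterS fC => y; rewrite /= lee_fin.
Qed.

Lemma Lrepr_norm_ae (F : Linfty nu) : {ae nu, forall y, `|Lrepr F y| <= `|F|}.
Proof.
have -> : `|F| = fine ('N[nu]_+oo%E[EFin \o Lrepr F])%E by [].
have := finite_norm_fine (Lrepr F); set x := fine _.
rewrite unlock; case: ifPn => nu0 xE.
  have /ess_supP : (ess_sup nu (abse \o (EFin \o Lrepr F)) <= x%:E)%E by rewrite -xE.
  by apply: filterS => y /=; rewrite lee_fin.
have nuT : nu setT = 0%E by apply/eqP; rewrite eq_le measure_ge0 andbT leNgt.
by apply: (@negligibleS _ _ _ nu setT) => //; exists setT; split.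
Qed.

Lemma Lclass_sum_ae (I : Type) (r : seq I) (c : I -> R) (F : I -> Linfty nu) :
  {ae nu, forall y, Lrepr (\sum_(i <- r) c i *: F i) y = \sum_(i <- r) c i * Lrepr (F i) y}.
Proof.
suff [f [fF fE]] : exists f : Lf, Lclass f = \sum_(i <- r) c i *: F i :> Linfty nu /\
    forall y, f y = \sum_(i <- r) c i * Lrepr (F i) y.
  have /Lclass_eq : Lclass (Lrepr (\sum_(i <- r) c i *: F i)) = Lclass f.
    by rewrite LreprK fF.
  by apply: filterS => y ->.
elim: r => [|i r [f [fF fE]]].
  exists 0; split=> [|y]; rewrite big_nil//.
  by rewrite -[RHS](scale0r (Lclass 0 : Linfty nu)) -[RHS]LclassZ scale0r.
exists (c i *: Lrepr (F i) + f); split=> [|y]; rewrite big_cons; last by rewrite -fE.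
by rewrite LclassD fF LclassZ LreprK.
Qed.

Lemma indic_Lfun (D : set Y) : measurable D -> (\1_D : Y -> R) \in Lfun nu +oo%E.
Proof.
move=> mD; rewrite inE; apply/andP; split; rewrite inE/=; first exact: measurable_indic.
rewrite /finite_norm unlock; case: ifPn => // _.
apply: (@le_lt_trans _ _ 1%:E); last by rewrite ltry.
apply/ess_supP; apply: nearW => y /=; rewrite lee_fin indicE ger0_norm//.
by case: (_ \in _).
Qed.

Definition Lindic (D : set Y) (mD : measurable D) : Linfty nu :=
  Lclass (Lfun_Sub (leey 1%E) (indic_Lfun mD)).

Lemma Lindic_comb_repr (I : Type) (r : seq I) (c : I -> R) (D : I -> set Y)
   (mD : forall i, measurable (D i)) :
  {ae nu, forall y, Lrepr (\sum_(i <- r) c i *: Lindic (mD i)) y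
     = \sum_(i <- r) c i * (y \in D i)%:R}.
Proof.
have h i : {ae nu, forall y, Lrepr (Lindic (mD i)) y = (y \in D i)%:R}.
  have /Lclass_eq : Lclass (Lrepr (Lindic (mD i))) = Lclass (Lfun_Sub (leey 1%E) (indic_Lfun (mD i))).
    by rewrite LreprK.
  by apply: filterS => y ->; rewrite [LHS](_ : _ = (\1_(D i) y)) ?indicE.
have main : {ae nu, forall y, \sum_(i <- r) c i * Lrepr (Lindic (mD i)) y
     = \sum_(i <- r) c i * (y \in D i)%:R}.
  elim: r => [|i r IH]; first by apply: aeW => y; rewrite !big_nil.
  by apply: filterS2 (h i) IH => y; rewrite !big_cons => -> ->.
by apply: filterS2 (Lclass_sum_ae r c (fun i => Lindic (mD i))) main => y -> ->.
Qed.

End LinftyFacts.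

(** Values are rounded down to a grid of mesh [delta] on $[-L,L]$. Rounding is monotone, so its
    level sets are intervals and the cells are measurable. It is applied to functions in L_oo and to
    Gaussian variables. *)
Lemma quantization {R : realType} d (Y : measurableType d) (f : nat -> Y -> R)
    (N : nat) (L delta : R) : (forall j, measurable_fun setT (f j)) ->
  0 < L -> 0 < delta ->
  exists (I : finType) (kappa : Y -> I) (a : I -> nat -> R),
    (forall k, measurable (kappa @^-1` [set k])) /\
    forall y, (forall j, (j < N)%N -> `|f j y| <= L) ->
      forall j, (j < N)%N -> `|f j y - a (kappa y) j| <= delta.
Proof.
move=> mf L0 d0.
pose K := Num.truncn (2 * L / delta).
(* [minn K] keeps the range finite also at points where the bound by [L] fails. *)
pose q (v : R) : nat := minn K (Num.truncn ((v + L) / delta)).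
have qK v : (q v < K.+1)%N by rewrite ltnS geq_minl.
pose kappa y := [ffun j : 'I_N => Ordinal (qK (f j y))].
exists {ffun 'I_N -> 'I_K.+1}, kappa.
exists (fun (k : {ffun 'I_N -> 'I_K.+1}) j =>
  if insub j is Some j' then (k j' : nat)%:R * delta - L else 0).
split.
- move=> k.
  have -> : kappa @^-1` [set k] =
     \bigcap_(j in [set: 'I_N]) (f j @^-1` [set v | q v = k j]).
    apply/seteqP; split=> [y /= <- j _ /=|y h /=]; first by rewrite ffunE.
    by apply/ffunP => j; apply/val_inj; rewrite ffunE /= (h j).
  apply: fin_bigcap_measurable; first exact: finite_finset.
  move=> j _; rewrite -[X in measurable X]setTI.
  apply: (mf j) => //; apply: is_interval_measurable => u v /= qu qv w /andP[uw wv].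
  have qm : {homo q : x y / x <= y >-> (x <= y)%N}.
    move=> s t st; rewrite /q leq_min geq_minl/= geq_min; apply/orP; right.
    by apply: le_truncn; rewrite ler_pM2r ?invr_gt0// lerD2r.
  by apply/eqP; rewrite eqn_leq -{1}qv -qu !qm.
- move=> y fL j jN; rewrite insubT/= ffunE/=.
  have := fL _ jN; rewrite ler_norml => /andP[h1 h2].
  have le2 : (f j y + L) / delta <= 2 * L / delta.
    by rewrite ler_pM2r ?invr_gt0//; lra.
  have ge0 : 0 <= (f j y + L) / delta by apply: divr_ge0; [lra|exact: ltW].
  have -> : q (f j y) = Num.truncn ((f j y + L) / delta).
    by apply/minn_idPr; exact: le_truncn.
  have /andP[t1 t2] := truncn_itv ge0.
  rewrite ler_pdivlMr// in t1; rewrite ltr_pdivrMr// -natr1 mulrDl mul1r in t2.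
  by rewrite ler_norml; apply/andP; split; lra.
Qed.

Section Factorization.
Context {R : realType} (X : normedModType R).
Local Notation l2 := (@ell2 R).
Local Notation e := (@ell2_unit R).

Lemma gamma_infty_le (I : finType) (alpha : I -> dual l2) (x : I -> X) (c : R)
    (T : bop l2 X) : (forall i, `|alpha i| <= 1) -> bounded_family x c ->
  (forall h, T h = \sum_i alpha i h *: x i) -> (gamma_infty T <= c%:E)%E.
Proof.
move=> a1 xc TE; have c0 := bounded_family_ge0 xc.
(* Any measure space may carry the factorization. With counting measure a.e. statements hold
   everywhere; [I] sits in the integers through [enum_rank], and the functions vanish elsewhere. *)
pose nu : {measure set nat -> \bar R} := @counting nat R.
have mD (i : I) : measurable [set (enum_rank i : nat)] by [].
pose A0 (h : l2) : Linfty nu := \sum_i alpha i h *: Lindic nu (mD i).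
have A0E h y : Lrepr (A0 h) y = \sum_i alpha i h * (y == enum_rank i :> nat)%:R.
  rewrite (ae_counting (Lindic_comb_repr nu (index_enum I) (fun i => alpha i h) mD) y).
  by apply: eq_bigr => i _; congr (_ * (nat_of_bool _)%:R); apply/idP/eqP; rewrite inE.
have A0_le h : `|A0 h| <= 1 * `|h|.
  rewrite mul1r -[A0 h]LreprK; apply: Lclass_norm_le => //.
  apply: aeW => y; rewrite A0E.
  have [[i ->]|ny] := pselect (exists i : I, y = enum_rank i).
    rewrite (bigD1 i)//= eqxx mulr1 big1 ?addr0.
      by rewrite (le_trans (dual_le _ _))// ler_piMl.
    move=> k ki; rewrite (_ : (_ == _) = false) ?mulr0//; apply/negbTE.
    by apply: contra ki => /eqP/val_inj/enum_rank_inj->.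
  rewrite big1 ?normr0// => i _; rewrite (_ : (_ == _) = false) ?mulr0//.
  by apply/negbTE/negP => /eqP yi; apply: ny; exists i.
have bA : (A0 : l2 -> Linfty nu) \in @bounded_linear R l2 (Linfty nu).
  apply/bounded_linearP; split.
    move=> t h h'; rewrite /A0 scaler_sumr -big_split/=; apply: eq_bigr => i _.
    by rewrite dualD dualZ scalerDl scalerA.
  by exists 1.
pose B0 (F : Linfty nu) : X := \sum_i Lrepr F (enum_rank i) *: x i.
have B0_le F : `|B0 F| <= c * `|F|.
  rewrite mulrC; apply: bounded_family_scale => // i.
  exact: (ae_counting (Lrepr_norm_ae F)).
have bB : (B0 : Linfty nu -> X) \in @bounded_linear R (Linfty nu) X.
  apply/bounded_linearP; split.
    move=> t f f'; rewrite /B0 scaler_sumr -big_split/=; apply: eq_bigr => i _.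
    rewrite scalerA -scalerDl; congr (_ *: _).
    have := ae_counting (Lclass_sum_ae [:: true; false]
      (fun b => if b then t else 1) (fun b : bool => if b then f else f')) (enum_rank i).
    by rewrite !big_cons !big_nil !addr0 scale1r mul1r.
  by exists c.
have A1 : `|Bop bA : bop l2 (Linfty nu)| <= 1 by exact: opnorm_le.
have B1 : `|Bop bB : bop (Linfty nu) X| <= c by exact: opnorm_le.
apply: (@le_trans _ _ (`|Bop bA : bop l2 (Linfty nu)| * `|Bop bB : bop (Linfty nu) X|)%:E).
  apply: ereal_inf_lbound; exists _, nat, nu, (Bop bA), (Bop bB); split=> //.
  apply/val_inj/funext => h /=; rewrite TE /B0; apply: eq_bigr => i _; congr (_ *: _).
  rewrite A0E (bigD1 i)//= eqxx mulr1 big1 ?addr0// => k ki.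
  rewrite (_ : (_ == _) = false) ?mulr0//; apply/negbTE.
  by apply: contra ki => /eqP/val_inj/enum_rank_inj->.
rewrite lee_fin -[leRHS]mul1r ler_pM//.
Qed.

(** A row lists the rounded values of the functions $Ae_j$ on a cell, and [x] is the image under [B]
    of the indicator of the cell. The row bound has a pointwise reason: for fixed [c] and almost
    every [y], $|\sum_jc_j(Ae_j)(y)|\le\|A\|\|c\|_2$, and [c] may be the row itself. *)
Lemma Linfty_discretization d (Y : measurableType d) (nu : {measure set Y -> \bar R})
    (A : bop l2 (Linfty nu)) (B : bop (Linfty nu) X) (N : nat) (delta : R) : 0 < delta ->
  exists (I : finType) (a : I -> nat -> R) (x : I -> X),
    [/\ forall i, \sum_(j < N) a i j ^+ 2 <= (`|A| + delta) ^+ 2,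
        bounded_family x `|B| &
        forall j, (j < N)%N -> `|B (A (e j)) - \sum_i a i j *: x i| <= delta].
Proof.
move=> delta0.
pose f j := Lrepr (A (e j)) : Y -> R.
have mf j : measurable_fun setT (f j) by exact: measurable_funPT.
pose L := `|A| + 1.
have L0 : 0 < L by rewrite /L ltr_wpDl.
(* $D\ge N+1$ makes the rounding error of a row at most [delta] in l_2; $D\ge\|B\|$ makes the error
   after applying [B] at most [delta]. *)
pose D := (N.+1%:R * (`|B| + 1)).
have D1 : N.+1%:R <= D by rewrite /D ler_peMr// lerDr.
have D2 : `|B| <= D.
  rewrite /D (@le_trans _ _ (`|B| + 1)) ?lerDl// ler_peMl// ?addr_ge0//.
  by rewrite ler1n.
have D0 : 0 < D by rewrite (lt_le_trans _ D1).
pose eta := delta / D.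
have eta0 : 0 < eta by rewrite divr_gt0.
have [I [kappa [a0 [mk ka]]]] := quantization N mf L0 eta0.
pose Dk k := kappa @^-1` [set k].
(* A null cell may contain no point at which the a.e. bounds hold, so its row is set to zero; L_oo
   does not see this cell. *)
pose a k j := if `[< nu (Dk k) = 0%E >] then 0 else a0 k j.
pose x k := B (Lindic nu (mk k)).
have fL : {ae nu, forall y, forall j, (j < N)%N -> `|f j y| <= L}.
  have : forall M, {ae nu, forall y, forall j, (j < M)%N -> `|f j y| <= L}.
    elim=> [|M IH]; first by apply: aeW.
    apply: filterS2 IH (Lrepr_norm_ae (A (e M))) => y h1 h2 j.
    rewrite ltnS leq_eqVlt => /predU1P[->|/h1//].
    rewrite (le_trans h2)// (le_trans (bop_normP A _))//.
    by rewrite (@le_trans _ _ `|A|) ?ler_piMr ?unit_norm_le// /L lerDl.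
  exact.
have nz : {ae nu, forall y, nu (Dk (kappa y)) <> 0%E}.
  have nz1 k : {ae nu, forall y, kappa y = k -> nu (Dk k) <> 0%E}.
    have [k0|k0] := pselect (nu (Dk k) = 0%E); last by apply: aeW.
    exists (Dk k); split; [exact: mk|exact: k0|move=> y /=].
    by move=> h; apply: contrapT => yk; apply: h.
  have nz2 (r : seq I) : {ae nu, forall y, forall k, k \in r -> kappa y = k -> nu (Dk k) <> 0%E}.
    elim: r => [|k r IH]; first exact: aeW.
    apply: filterS2 IH (nz1 k) => y h1 h2 l; rewrite inE => /predU1P[->//|]; exact: h1.
  by apply: filterS (nz2 (enum I)) => y; apply=> //; rewrite mem_enum.
exists I, a, x; split.
- move=> k; rewrite /a; case: asboolP => [k0|k0].
    by rewrite big1 ?sqr_ge0// => j _; rewrite expr0n.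
  set s := \sum_(j < N) _.
  have s0 : 0 <= s by apply: sumr_ge0 => i _; rewrite sqr_ge0.
  have hs : `|\sum_(j < N) a0 k j *: e j| <= Num.sqrt s.
    by apply: (@comb_norm_le _ N (a0 k)); rewrite ?sqrtr_ge0// sqr_sqrtr.
  have hA : {ae nu, forall y, `|\sum_(j < N) a0 k j * f j y| <= `|A| * Num.sqrt s}.
    have := Lrepr_norm_ae (A (\sum_(j < N) a0 k j *: e j)).
    have := Lclass_sum_ae (index_enum 'I_N) (a0 k) (fun j : 'I_N => A (e j)).
    apply: filterS2 => y h1 h2.
    rewrite -h1; rewrite (_ : \sum_(i <- _) _ = A (\sum_(j < N) a0 k j *: e j)).
      by rewrite (le_trans h2)// (le_trans (bop_normP A _))// ler_wpM2l.
    by rewrite linear_sum; apply: eq_bigr => j _; rewrite linearZ.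
  have [y [yk [yL yA]]] : exists y, kappa y = k /\
     (forall j, (j < N)%N -> `|f j y| <= L) /\ `|\sum_(j < N) a0 k j * f j y| <= `|A| * Num.sqrt s.
    apply: contrapT => ny; apply: k0.
    have : {ae nu, forall y, ~ Dk k y}.
      by apply: filterS2 fL hA => y h1 h2 yk; apply: ny; exists y.
    rewrite /almost_everywhere => -[E [mE E0 DE]].
    apply/eqP; rewrite eq_le measure_ge0 andbT -E0.
    apply: le_measure; rewrite ?inE; [exact: mk|exact: mE|].
    by move=> y yk; apply: DE => /=; apply.
  have fa j : (j < N)%N -> `|f j y - a0 k j| <= eta by rewrite -yk; exact: ka.
  have q0 := sqrtr_ge0 s.
  (* One factor of each square is split as $f_j(y)+(a_{kj}-f_j(y))$; the two parts give $\|A\|\sqrt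
     s$ and $\delta\sqrt s$. *)
  have sle : s <= (`|A| + delta) * Num.sqrt s.
    rewrite mulrDl.
    have sE2 : s = \sum_(j < N) a0 k j * f j y + \sum_(j < N) a0 k j * (a0 k j - f j y).
      by rewrite -big_split/=; apply: eq_bigr => j _; rewrite mulrBr addrCA subrr addr0 expr2.
    rewrite {1}sE2; apply: lerD; first exact: le_trans (ler_norm _) yA.
    rewrite mulrC; apply: sum_mul_le; [exact: q0|exact: ltW|by rewrite sqr_sqrtr|].
    apply: (@le_trans _ _ (\sum_(j < N) eta ^+ 2)).
      apply: ler_sum => j _; rewrite -(real_normK (num_real _)) ler_pXn2r ?nnegrE//; last exact: ltW.
      by rewrite distrC fa.
    rewrite sumr_const card_ord -mulr_natl /eta expr_div_n mulrCA ler_piMr ?sqr_ge0//.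
    rewrite ler_pdivrMr ?exprn_gt0// mul1r (@le_trans _ _ N.+1%:R) ?ler_nat// (le_trans D1)//.
    have D1' : 1 <= D by apply: le_trans D1; rewrite ler1n.
    by rewrite expr2 ler_peMl// ltW.
  have sE : s = Num.sqrt s ^+ 2 by rewrite sqr_sqrtr.
  rewrite sE ler_pXn2r ?nnegrE ?addr_ge0//; last exact: ltW.
  have [->|qN] := eqVneq (Num.sqrt s) 0; first by rewrite addr_ge0// ltW.
  by rewrite -(@ler_pM2r _ (Num.sqrt s)) ?lt_neqAle ?q0 1?eq_sym ?qN// -expr2 -sE.
- move=> c c1; rewrite /x.
  have -> : \sum_i c i *: B (Lindic nu (mk i)) = B (\sum_i c i *: Lindic nu (mk i)).
    by rewrite linear_sum; apply: eq_bigr => i _; rewrite linearZ.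
  rewrite (le_trans (bop_normP B _))// ler_piMr//.
  rewrite -[X in `|X|]LreprK; apply: Lclass_norm_le => //.
  have := Lindic_comb_repr nu (index_enum I) c mk; apply: filterS => y ->.
  rewrite (bigD1 (kappa y))//= mem_set// mulr1 big1 ?addr0// => k kk.
  by rewrite memNset ?mulr0// => /= kE; rewrite kE eqxx in kk.
- move=> j jN; rewrite /x.
  have -> : \sum_i a i j *: B (Lindic nu (mk i)) = B (\sum_i a i j *: Lindic nu (mk i)).
    by rewrite linear_sum; apply: eq_bigr => i _; rewrite linearZ.
  rewrite -linearB (le_trans (bop_normP B _))//.
  apply: (@le_trans _ _ (`|B| * eta)); last first.
    by rewrite /eta mulrCA ler_piMr ?(ltW delta0)// ler_pdivrMr// mul1r.
  rewrite ler_wpM2l//.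
  rewrite -[X in `|X|]LreprK; apply: Lclass_norm_le; first exact: ltW.
  have h1 := Lindic_comb_repr nu (index_enum I) (fun i => a i j) mk.
  have h2 := Lclass_sum_ae [:: true; false] (fun b => if b then 1 else -1)
      (fun b : bool => if b then A (e j) else (\sum_i a i j *: Lindic nu (mk i) : Linfty nu)).
  have h3 : {ae nu, forall y, `|Lrepr (A (e j)) y - a (kappa y) j| <= eta}.
    apply: filterS2 fL nz => y fy nzy; rewrite /a.
    by case: asboolP => // _; exact: ka y fy j jN.
  move: h1 h2 h3; apply: filterS3 => y h1.
  rewrite !big_cons !big_nil !addr0 scale1r scaleN1r mul1r mulN1r => -> h3.
  suff -> : Lrepr (\sum_i a i j *: Lindic nu (mk i)) y = a (kappa y) j by [].
  rewrite h1 (bigD1 (kappa y))//= mem_set// mulr1 big1 ?addr0// => k kk.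
  by rewrite memNset ?mulr0// => /= kE; rewrite kE eqxx in kk.
Qed.

End Factorization.

(** * Pisier domination *)

Section PowerInequalities.
Context {R : realType}.

(** By convexity $y^{q+1}$ lies above its tangent at [b], and $y-b\ge-u$. *)
Lemma expr_tangent_le (q : nat) (b u y : R) : 0 <= b -> 0 <= y -> b - u <= y ->
  b ^+ q.+1 - q.+1%:R * b ^+ q * u <= y ^+ q.+1.
Proof.
move=> b0 y0 buy.
suff main : b ^+ q.+1 + q.+1%:R * b ^+ q * (y - b) <= y ^+ q.+1.
  apply: le_trans main; rewrite lerD2l -mulrN ler_wpM2l//; last by lra.
  by rewrite mulr_ge0// exprn_ge0.
elim: q => [|q IH]; first by rewrite !expr1 expr0; lra.
rewrite (exprS y) (le_trans _ (ler_wpM2l y0 IH))//.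
have -> : y * (b ^+ q.+1 + q.+1%:R * b ^+ q * (y - b)) =
  b ^+ q.+2 + q.+2%:R * b ^+ q.+1 * (y - b) + q.+1%:R * b ^+ q * (y - b) ^+ 2.
  by rewrite !exprS -!natr1; ring.
by rewrite lerDl mulr_ge0 ?sqr_ge0// mulr_ge0// exprn_ge0.
Qed.

Lemma exprS_mul_le (q : nat) (a b : R) : 0 <= a -> 0 <= b ->
  a ^+ q * b <= a ^+ q.+1 + b ^+ q.+1.
Proof.
move=> a0 b0; have [ab|ba] := leP a b.
  rewrite (@le_trans _ _ (b ^+ q.+1)) ?lerDr ?exprn_ge0// exprSr ler_wpM2r//.
  by apply: lerXn2r; rewrite ?nnegrE.
rewrite (@le_trans _ _ (a ^+ q.+1)) ?lerDl ?exprn_ge0// exprSr ler_wpM2l//.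
  by rewrite exprn_ge0.
exact: ltW.
Qed.

Lemma exprD_le (q : nat) (a b : R) : 0 <= a -> 0 <= b ->
  (a + b) ^+ q <= 2 ^+ q * (a ^+ q + b ^+ q).
Proof.
move=> a0 b0.
have [ab|/ltW ba] := leP a b.
  rewrite (@le_trans _ _ ((2 * b) ^+ q)) ?exprMn ?ler_wpM2l ?lerDr ?exprn_ge0//.
  by rewrite -exprMn; apply: lerXn2r; rewrite ?nnegrE ?addr_ge0 ?mulr_ge0//; lra.
rewrite (@le_trans _ _ ((2 * a) ^+ q)) ?exprMn ?ler_wpM2l ?lerDl ?exprn_ge0//.
by rewrite -exprMn; apply: lerXn2r; rewrite ?nnegrE ?addr_ge0 ?mulr_ge0//; lra.
Qed.

(** Splitting off one summand at a time costs a factor $2^{q+1}$ each. This exponential growth in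
    [k] is harmless, since the exponential weights of [Pisier_exponential] absorb it. *)
Lemma expr_sum_le (q K : nat) (y : nat -> R) : (forall k, 0 <= y k) ->
  (\sum_(k < K) y k) ^+ q.+1 <= \sum_(k < K) (2 ^+ q.+1) ^+ k.+1 * y k ^+ q.+1.
Proof.
elim: K y => [|K IH] y y0; first by rewrite !big_ord0 expr0n.
rewrite !big_ord_recl/= (le_trans (exprD_le _ _ _))// ?sumr_ge0//.
rewrite expr1 mulrDr lerD2l.
have h2 : 0 <= 2 ^+ q.+1 :> R by rewrite exprn_ge0.
rewrite (le_trans (ler_wpM2l h2 (IH (fun k => y k.+1) _)))// mulr_sumr.
by apply: ler_sum => k _; rewrite mulrA -exprS.
Qed.

End PowerInequalities.

(* Pisier: an [(q,1)]-summing operator on [l_infty^I] satisfies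
   [|B h|^q <= eps + nu(|h|)] on the unit ball. Adding [h] to an almost extremal
   family [f_k (1 - |h|)] of the summing inequality gives the functional [nu]. *)
Section PisierDomination.
Context {R : realType} (V : normedModType R) (I : finType) (x : I -> V).
Variables (q : nat) (C : R).
Let B (h : I -> R) : V := \sum_i h i *: x i.

Hypothesis summing : forall n (f : 'I_n -> I -> R),
  (forall i, \sum_k `|f k i| <= 1) -> \sum_k `|B (f k)| ^+ q.+1 <= C.

Lemma Pisier_domination (eps : R) : 0 < eps -> exists nu : I -> R,
  [/\ forall i, 0 <= nu i, \sum_i nu i <= q.+1%:R * (2 * C) &
    forall h, (forall i, `|h i| <= 1) ->
      `|B h| ^+ q.+1 <= eps + \sum_i nu i * `|h i|].
Proof.
move=> eps0.
pose S := [set s | exists n (f : 'I_n -> I -> R),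
  (forall i, \sum_k `|f k i| <= 1) /\ s = \sum_k `|B (f k)| ^+ q.+1].
have hS : has_sup S.
  split; last by exists C => _ [n [f [f1 ->]]]; exact: summing.
  exists 0, 0, (fun _ _ => 0); split=> [i|]; by rewrite big_ord0.
have [_ [n [f [f1 ->]]] fS] := sup_adherent eps0 hS.
have /choice[F F_] : forall k, exists F : dual V, `|F| <= 1 /\ F (B (f k)) = `|B (f k)|.
  by move=> k; exact: norming_functional.
pose b k := `|B (f k)|.
(* Applied to [u], this is the first-order loss in $\sum_k\|Bf_k\|^{q+1}$ when every [f k] is
   multiplied by $1-u$, computed with functionals that norm the vectors [B (f k)]. *)
pose nu' i := q.+1%:R * \sum_k b k ^+ q * F k (f k i *: x i).
have nuE (u : I -> R) : \sum_i nu' i * u i =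
    q.+1%:R * \sum_k b k ^+ q * F k (B (fun i => f k i * u i)).
  rewrite /nu'; under eq_bigr do rewrite -mulrA mulr_suml.
  rewrite -mulr_sumr exchange_big/=; congr (_ * _); apply: eq_bigr => k _.
  rewrite dual_sum mulr_sumr; apply: eq_bigr => i _.
  by rewrite !dualZ -!mulrA; congr (_ * (_ * _)); rewrite mulrC.
exists (fun i => `|nu' i|); split=> [i||h h1]; first exact: normr_ge0.
- under eq_bigr do rewrite normrEsg mulrC.
  rewrite nuE ler_wpM2l//.
  (* The signs of [nu'] are moved into the family [f]. The old and the new family contribute at most
     [C] each, whence the factor 2. *)
  apply: (@le_trans _ _ (\sum_k (b k ^+ q.+1 +
     `|B (fun i => f k i * Num.sg (nu' i))| ^+ q.+1))).
    apply: ler_sum => k _; have bk : 0 <= b k by exact: normr_ge0.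
    rewrite (le_trans _ (exprS_mul_le _ _ _))//.
    by apply: ler_wpM2l; [exact: (exprn_ge0 _ (normr_ge0 _))|apply: dual_le1; exact: (F_ k).1].
  rewrite big_split/= mulr_natl mulr2n lerD// ?summing//.
  move=> i; apply: le_trans (f1 i); apply: ler_sum => k _.
  by rewrite normrM ler_piMr// normr_sg lern1 leq_b1.
- pose f' (k : 'I_n.+1) i := if unlift ord0 k is Some k' then f k' i * (1 - `|h i|) else h i.
  have f'1 i : \sum_k `|f' k i| <= 1.
    rewrite big_ord_recl /f' unlift_none.
    under eq_bigr do rewrite liftK normrM.
    rewrite -mulr_suml ger0_norm ?subr_ge0 ?h1//.
    have := h1 i; have := f1 i; have := normr_ge0 (h i); nra.
  have : \sum_k `|B (f' k)| ^+ q.+1 <= sup S.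
    by apply: sup_upper_bound => //; exists n.+1, f'.
  rewrite big_ord_recl.
  have -> : B (f' ord0) = B h by congr B; apply/funext => i; rewrite /f' unlift_none.
  have low : \sum_(k < n) (b k ^+ q.+1 - q.+1%:R * b k ^+ q * F k (B (fun i => f k i * `|h i|)))
      <= \sum_(k < n) `|B (f' (lift ord0 k))| ^+ q.+1.
    apply: ler_sum => k _; apply: expr_tangent_le; [exact: normr_ge0|exact: normr_ge0|].
    have -> : B (f' (lift ord0 k)) = B (f k) - B (fun i => f k i * `|h i|).
      rewrite /B -sumrB; apply: eq_bigr => i _; rewrite -scalerBl; congr (_ *: _).
      by rewrite /f' liftK mulrBr mulr1.
    by rewrite /b -(F_ k).2 -dualB; apply: dual_le1; exact: (F_ k).1.
  move: low; rewrite sumrB.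
  have -> : \sum_(k < n) q.+1%:R * b k ^+ q * F k (B (fun i => f k i * `|h i|)) =
      \sum_i nu' i * `|h i|.
    by rewrite nuE mulr_sumr; apply: eq_bigr => k _; rewrite mulrA.
  have : \sum_i nu' i * `|h i| <= \sum_i `|nu' i| * `|h i|.
    by apply: ler_sum => i _; rewrite ler_wpM2r// ler_norm.
  by move: fS; rewrite /b; lra.
Qed.

(** Domination is confined to the unit ball. A general [h] is cut into the pieces where
    $k\le|h|<k+1$, each scaled by $(k+1)^{-1}$. The factor $2^{(q+1)(k+1)}$ from adding the pieces
    and the factor $(k+1)^{q+1}$ from scaling are together at most $e^{2(q+1)(k+1)}$, which is
    bounded by the exponential of $|h|$ on the piece. *)
Lemma Pisier_exponential : exists nu : I -> R,
  [/\ forall i, 0 <= nu i, \sum_i nu i <= q.+1%:R * (2 * C) + 1 &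
    forall h, `|B h| ^+ q.+1 <= \sum_i nu i * (expR (2 * q.+1%:R) *
        (expR (2 * q.+1%:R * h i) + expR (- (2 * q.+1%:R) * h i)))].
Proof.
(* Summed over [I] the added weights stay below 1. A nonempty level carries at least one [eps], so
   the additive error of the domination is charged to the weights. *)
pose eps : R := #|I|.+1%:R^-1.
have eps0 : 0 < eps by rewrite invr_gt0.
have [nu [nu0 nuC nuB]] := Pisier_domination eps0.
exists (fun i => eps + nu i); split.
- by move=> i; rewrite addr_ge0// ltW.
- rewrite big_split/= addrC lerD// sumr_const -mulr_natl ler_pdivrMr// mul1r ler_nat.
  exact: leqnSn.
move=> h.
pose lev i := Num.truncn `|h i|.
pose hk k i := if lev i == k then h i else 0.
pose K := (\max_i lev i).+1.
have levK i : (lev i < K)%N by rewrite ltnS leq_bigmax.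
have hE : B h = \sum_(k < K) B (hk k).
  rewrite /B exchange_big/=; apply: eq_bigr => i _; rewrite -scaler_suml; congr (_ *: _).
  rewrite (bigD1 (Ordinal (levK i)))//= /hk eqxx big1 ?addr0// => k kl.
  by case: eqP => // lk; move: kl; rewrite -val_eqE/= lk eqxx.
apply: (@le_trans _ _ ((\sum_(k < K) `|B (hk k)|) ^+ q.+1)).
  by rewrite lerXn2r ?nnegrE ?sumr_ge0// hE ler_norm_sum.
rewrite (le_trans (@expr_sum_le _ _ _ (fun k => `|B (hk k)|) _))//.
have one k : `|B (hk k)| ^+ q.+1 <= k.+1%:R ^+ q.+1 * \sum_(i | lev i == k) (eps + nu i).
  have [/existsP[i0 li0]|nok] := boolP [exists i, lev i == k]; last first.
    have -> : B (hk k) = 0.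
      rewrite /B big1// => i _; rewrite /hk; case: ifPn => lik; last by rewrite scale0r.
      by move/existsPn: nok => /(_ i); rewrite lik.
    rewrite normr0 expr0n/= mulr_ge0 ?exprn_ge0// sumr_ge0// => i _.
    by rewrite addr_ge0// ltW.
  have k1 : 0 < k.+1%:R :> R by [].
  have -> : B (hk k) = k.+1%:R *: B (fun i => k.+1%:R^-1 * hk k i).
    rewrite /B scaler_sumr; apply: eq_bigr => i _; rewrite scalerA mulrA divff ?mul1r//.
  rewrite normrZ exprMn normr_nat ler_wpM2l ?exprn_ge0//.
  have hk1 i : `|k.+1%:R^-1 * hk k i| <= 1.
    rewrite normrM ger0_norm ?invr_ge0// ler_pdivrMl// mulr1 /hk.
    by case: eqP => [<-|_]; rewrite ?normr0// ltW// truncnS_gt.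
  apply: (le_trans (nuB _ hk1)); rewrite big_split/= lerD//.
    by rewrite (bigD1 i0)//= lerDl sumr_ge0// => i _; rewrite ltW.
  rewrite big_mkcond [leRHS]big_mkcond; apply: ler_sum => i _ /=.
  have := hk1 i; rewrite /hk; case: eqP => _; last by rewrite mulr0 normr0 mulr0.
  by move=> h1; rewrite ler_piMr.
apply: (@le_trans _ _ (\sum_(k < K) \sum_(i | lev i == k) (eps + nu i) *
   ((2 ^+ q.+1) ^+ k.+1 * k.+1%:R ^+ q.+1))).
  apply: ler_sum => k _; rewrite -mulr_suml [leRHS]mulrC -mulrA ler_wpM2l//.
rewrite (exchange_big_dep xpredT)//=; apply: ler_sum => i _.
rewrite (big_pred1 (Ordinal (levK i))); last first.
  by move=> k /=; apply/eqP/eqP => [E|->//]; apply/val_inj.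
rewrite ler_wpM2l ?addr_ge0//; first exact: ltW.
rewrite /=; set k := lev i.
have e2 : 2 <= expR 1 :> R by have := expR_ge1Dx (1 : R); lra.
have two m : 2 ^+ m <= expR m%:R :> R.
  by rewrite -[m%:R]mulr1 expRM_natl lerXn2r ?nnegrE ?expR_ge0//; lra.
have k2 : k.+1%:R <= 2 ^+ k.+1 :> R by rewrite -natrX ler_nat ltnW// ltn_expl.
apply: (@le_trans _ _ (expR (2 * q.+1%:R) * expR (2 * q.+1%:R * `|h i|))).
  have -> : expR (2 * q.+1%:R) * expR (2 * q.+1%:R * `|h i|) =
     expR (2 * q.+1%:R * (1 + `|h i|)) by rewrite -expRD mulrDr mulr1.
  apply: (@le_trans _ _ (expR ((2 * q.+1 * k.+1)%N%:R))).
    rewrite -exprM (@le_trans _ _ (2 ^+ (2 * q.+1 * k.+1)))//.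
    have -> : (2 * q.+1 * k.+1 = q.+1 * k.+1 + k.+1 * q.+1)%N.
      by rewrite mul2n -addnn mulnDl [(k.+1 * _)%N]mulnC.
    rewrite exprD ler_wpM2l ?exprn_ge0// [leRHS]exprM.
    by rewrite lerXn2r ?nnegrE ?exprn_ge0.
  rewrite ler_expR !natrM -!mulrA !ler_wpM2l// -natr1 addrC lerD2l.
  by rewrite truncn_le.
rewrite ler_wpM2l ?expR_ge0//.
have [h0|h0] := leP 0 (h i).
  by rewrite ger0_norm// lerDl expR_ge0.
by rewrite (ltr0_norm h0) mulrN mulNr lerDr expR_ge0.
Qed.

End PisierDomination.

(** * Cotype with an integer exponent *)

Section CotypeSumming.
Context {R : realType} (X : normedModType R).

Lemma rademacher_average_le n (x : 'I_n -> X) (c : R) : 0 <= c ->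
  (forall eps : {ffun 'I_n -> bool}, `|\sum_(i < n) (-1) ^+ eps i *: x i| <= c) ->
  rademacher_average x <= c.
Proof.
move=> c0 xc; rewrite /rademacher_average -(ger0_norm c0) -sqrtr_sqr.
rewrite ler_wsqrtr// ler_pdivrMl ?exprn_gt0//.
apply: (@le_trans _ _ (\sum_(eps : {ffun 'I_n -> bool}) c ^+ 2)).
  by apply: ler_sum => eps _; rewrite lerXn2r ?nnegrE.
by rewrite sumr_const card_ffun card_bool card_ord -[leLHS]mulr_natl natrX.
Qed.

(** All norms $\|x_i\|$ are at most $\rho$, the right-hand side of the cotype inequality, so
    $\|x_i\|^{q+1}\le\|x_i\|^r\rho^{q+1-r}$. An integer exponent suits the tangent inequality behind
    the domination theorem. *)
Lemma finite_cotype_nat : finite_cotype X -> exists (q : nat) (C : R),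
  [/\ (2 <= q.+1)%N, 0 <= C & forall n (x : 'I_n -> X),
    \sum_(i < n) `|x i| ^+ q.+1 <= C * rademacher_average x ^+ q.+1].
Proof.
move=> [r [r2 [C hC]]].
have r0 : 0 < r by lra.
pose q := Num.truncn r.
have rq : r <= q.+1%:R by rewrite ltW// truncnS_gt.
exists q, (`|C| ^+ q.+1); split; [|by rewrite exprn_ge0|].
  by rewrite ltnS /q truncn_gt0; lra.
move=> n x; pose rho := `|C| * rademacher_average x.
have rho0 : 0 <= rho by rewrite mulr_ge0// sqrtr_ge0.
have s0 : 0 <= \sum_(i < n) `|x i| `^ r by apply: sumr_ge0 => i _; rewrite powR_ge0.
have hr : \sum_(i < n) `|x i| `^ r <= rho `^ r.
  have : (\sum_(i < n) `|x i| `^ r) `^ r^-1 <= rho.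
    by rewrite (le_trans (hC n x))// ler_wpM2r ?sqrtr_ge0// ler_norm.
  move=> /(@ge0_ler_powR _ r (ltW r0) _ _); rewrite ?nnegrE ?powR_ge0// => /(_ isT rho0).
  by rewrite -powRrM mulVf ?gt_eqF// powRr1.
have xr i : `|x i| <= rho.
  have : `|x i| `^ r <= rho `^ r.
    apply: le_trans hr; rewrite (bigD1 i)//= lerDl sumr_ge0// => j _; exact: powR_ge0.
  move=> /(@ge0_ler_powR _ r^-1 (ltac:(by rewrite invr_ge0 ltW)) _ _).
  rewrite ?nnegrE ?powR_ge0// => /(_ isT isT).
  by rewrite -!powRrM divff ?gt_eqF// !powRr1.
rewrite -exprMn -/rho.
have [rhoE|rhoN] := eqVneq rho 0.
  rewrite rhoE expr0n/= big1// => i _; have := xr i.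
  by rewrite rhoE normr_le0 => /eqP->; rewrite normr0 expr0n.
have rhop : 0 < rho by rewrite lt_neqAle eq_sym rhoN.
have split_pow t : 0 <= t -> t != 0 -> t ^+ q.+1 = t `^ r * t `^ (q.+1%:R - r).
  move=> t0 tN; rewrite -powR_mulrn// -powRD; last by apply/implyP.
  by congr (_ `^ _); rewrite addrC subrK.
apply: (@le_trans _ _ (\sum_(i < n) `|x i| `^ r * rho `^ (q.+1%:R - r))).
  apply: ler_sum => i _; have [->|xN] := eqVneq (`|x i|) 0.
    by rewrite expr0n mulr_ge0 ?powR_ge0.
  by rewrite split_pow// ler_wpM2l ?powR_ge0// ge0_ler_powR ?nnegrE ?subr_ge0.
by rewrite -mulr_suml split_pow// ler_wpM2r ?powR_ge0.
Qed.

End CotypeSumming.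

(** * Rademacher averages and cotype *)

Section RademacherAverages.
Context {R : realType} (V : normedModType R).

Definition sign_sum (I : finType) (eps : {ffun I -> bool}) (x : I -> V) : V :=
  \sum_i (-1) ^+ eps i *: x i.

Definition rad2 (I : finType) (x : I -> V) : R :=
  (2 ^+ #|I|)^-1 * \sum_eps `|sign_sum eps x| ^+ 2.

(** Signs form a group, and averages over it are invariant under translation; this stands in for the
    independence of random signs. *)
Definition xorf (I : finType) (delta eps : {ffun I -> bool}) : {ffun I -> bool} :=
  [ffun i => delta i (+) eps i].

Lemma xorfK (I : finType) (delta : {ffun I -> bool}) : involutive (xorf delta).
Proof. by move=> eps; apply/ffunP => i; rewrite !ffunE addKb. Qed.

Lemma sum_xorf (I : finType) (delta : {ffun I -> bool}) (F : {ffun I -> bool} -> R) :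
  \sum_eps F (xorf delta eps) = \sum_eps F eps.
Proof. by rewrite [RHS](reindex_inj (inv_inj (xorfK delta))). Qed.

Lemma card_signs (I : finType) : #|{ffun I -> bool}|%:R = 2 ^+ #|I| :> R.
Proof. by rewrite card_ffun card_bool natrX. Qed.

Lemma sum_signs_const (I : finType) (a : R) :
  \sum_(eps : {ffun I -> bool}) a = 2 ^+ #|I| * a.
Proof. by rewrite sumr_const -card_signs mulr_natl. Qed.

Lemma sum_const_card (J : finType) (a : R) : \sum_(j : J) a = #|J|%:R * a.
Proof. by rewrite sumr_const mulr_natl. Qed.

Lemma rad2_ge0 (I : finType) (x : I -> V) : 0 <= rad2 x.
Proof.
rewrite mulr_ge0 ?invr_ge0 ?exprn_ge0//; apply: sumr_ge0 => eps _; exact: exprn_ge0.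
Qed.

(** Both sides equal the double average of [F] at the signs [xorf (ext delta) eps] restricted along
    [s]: invariance removes [delta] when [eps] is summed first, and [eps] when [delta] is. *)
Lemma average_restrict (I J : finType) (s : J -> I) (F : {ffun J -> bool} -> R) :
  injective s ->
  (2 ^+ #|I|)^-1 * \sum_(eps : {ffun I -> bool}) F [ffun j => eps (s j)] =
  (2 ^+ #|J|)^-1 * \sum_delta F delta.
Proof.
move=> s_inj.
pose ext (delta : {ffun J -> bool}) : {ffun I -> bool} :=
  [ffun i => if [pick j | s j == i] is Some j then delta j else false].
have extE delta j : ext delta (s j) = delta j.
  rewrite ffunE; case: pickP => [k /eqP/s_inj->//|/(_ j)]; by rewrite eqxx.
have h : 2 ^+ #|J| * \sum_(eps : {ffun I -> bool}) F [ffun j => eps (s j)] =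
    2 ^+ #|I| * \sum_delta F delta.
  pose D := \sum_(delta : {ffun J -> bool}) \sum_(eps : {ffun I -> bool})
      F [ffun j => xorf (ext delta) eps (s j)].
  transitivity D.
    rewrite -sum_signs_const; apply: eq_bigr => delta _.
    by rewrite (sum_xorf (ext delta) (fun e => F [ffun j => e (s j)])).
  rewrite /D exchange_big/= -sum_signs_const; apply: eq_bigr => eps _.
  rewrite -(sum_xorf [ffun j => eps (s j)] F); apply: eq_bigr => delta _; congr F.
  by apply/ffunP => j; rewrite !ffunE; have := extE delta j; rewrite ffunE => ->; rewrite addbC.
apply: (@mulfI _ (2 ^+ #|J| * 2 ^+ #|I|)); first by rewrite mulf_neq0 ?expf_neq0.
rewrite [LHS]mulrA mulfK ?expf_neq0// [in RHS](mulrC (2 ^+ #|J|)) [RHS]mulrA mulfK ?expf_neq0//.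
Qed.

Lemma sqr_norm_mid (u v : V) : `|u| ^+ 2 <= (`|u + v| ^+ 2 + `|u - v| ^+ 2) / 2.
Proof.
have : 2 * `|u| <= `|u + v| + `|u - v|.
  rewrite -[2 * _]ger0_norm ?mulr_ge0// -[X in X * _]ger0_norm// -normrZ normr_id.
  by rewrite (le_trans _ (ler_normD _ _))// addrCA addrK scaler_nat mulr2n lexx.
have := normr_ge0 u; have := normr_ge0 (u + v); have := normr_ge0 (u - v).
move: `|u| `|u + v| `|u - v| => a b c c0 b0 a0 h.
have : (2 * a) ^+ 2 <= (b + c) ^+ 2 by rewrite lerXn2r ?nnegrE ?mulr_ge0 ?addr_ge0.
have := sqr_ge0 (b - c); nra.
Qed.

Lemma half_double (a : R) : (a + a) / 2 = a.
Proof. by rewrite -mulr2n -[X in X / 2]mulr_natr mulfK. Qed.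

(** Flipping the signs outside the range of [s] turns $u+v$ into $u-v$, and $\|u\|^2$ is at most the
    mean of $\|u+v\|^2$ and $\|u-v\|^2$. *)
Lemma rad2_subfamily (I J : finType) (s : J -> I) (x : I -> V) : injective s ->
  rad2 (x \o s) <= rad2 x.
Proof.
move=> s_inj; rewrite /rad2 -(average_restrict _ s_inj) ler_wpM2l ?invr_ge0 ?exprn_ge0//.
pose delta : {ffun I -> bool} := [ffun i => i \notin codom s].
have avg : \sum_eps `|sign_sum eps x| ^+ 2 =
   \sum_eps (`|sign_sum eps x| ^+ 2 + `|sign_sum (xorf delta eps) x| ^+ 2) / 2.
  rewrite -mulr_suml big_split/= (sum_xorf delta (fun e => `|sign_sum e x| ^+ 2)).
  by rewrite half_double.
rewrite avg; apply: ler_sum => eps _.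
pose u := \sum_(i in codom s) (-1) ^+ eps i *: x i.
pose v := \sum_(i | i \notin codom s) (-1) ^+ eps i *: x i.
have -> : sign_sum [ffun j => eps (s j)] (x \o s) = u.
  rewrite /u /sign_sum; under eq_bigr do rewrite ffunE /=.
  by rewrite -(big_image _ _ s _ (fun i => (-1) ^+ eps i *: x i)) /= big_uniq //= map_inj_uniq// enum_uniq.
have -> : sign_sum eps x = u + v by rewrite /sign_sum (bigID (mem (codom s))).
have -> : sign_sum (xorf delta eps) x = u - v.
  rewrite /sign_sum (bigID (mem (codom s)))/= -sumrN; congr (_ + _).
    by apply: eq_bigr => i is_; rewrite !ffunE is_.
  by apply: eq_bigr => i /negPf is_; rewrite !ffunE is_/= signrN scaleNr.
exact: sqr_norm_mid.
Qed.

Lemma rad2_single (I : finType) (x : I -> V) i : `|x i| ^+ 2 <= rad2 x.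
Proof.
have inj : injective (fun _ : unit => i) by move=> [] [].
apply: le_trans (rad2_subfamily x inj).
rewrite /rad2 card_unit expr1 ler_pdivlMl//.
apply: (@le_trans _ _ (\sum_(eps : {ffun unit -> bool}) `|x i| ^+ 2)).
  by rewrite sum_signs_const card_unit expr1.
apply: ler_sum => eps _; rewrite /sign_sum (big_pred1 tt)/=; last by case.
by rewrite normrZ normrX normrN normr1 expr1n mul1r.
Qed.

(** For [theta] equal to 1 this always holds, by [rad2_single]. A value below 1 is a gain, which is
    multiplied when [I] is replaced by its powers. *)
Definition average_domination (I : finType) (theta : R) : Prop :=
  forall x : I -> V, \sum_i `|x i| ^+ 2 <= #|I|%:R * theta * rad2 x.

(** The inequality for [J] is used in every row, the one for [I] on the row sums [Y eps]. The two
    layers of signs collapse, because $\delta_i\varepsilon_{ij}$ runs through the signs on $I\times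
    J$ just as $\varepsilon_{ij}$ does. *)
Lemma average_domination_prod (I J : finType) (theta eta : R) :
  0 <= theta -> 0 <= eta ->
  average_domination I theta -> average_domination J eta ->
  average_domination (I * J)%type (theta * eta).
Proof.
move=> t0 e0 aI aJ x.
pose Y (eps : {ffun I * J -> bool}) i := \sum_j (-1) ^+ eps (i, j) *: x (i, j).
have h1 i : rad2 (fun j => x (i, j)) = (2 ^+ #|{: I * J}|)^-1 * \sum_eps `|Y eps i| ^+ 2.
  have inj : injective (fun j : J => (i, j)) by move=> j k [].
  rewrite /rad2 -(average_restrict _ inj); congr (_ * _); apply: eq_bigr => eps _.
  by rewrite /sign_sum; under eq_bigr do rewrite ffunE.
have h2 : (2 ^+ #|{: I * J}|)^-1 * \sum_eps rad2 (Y eps) = rad2 x.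
  rewrite /rad2 -mulr_sumr exchange_big/=.
  rewrite (eq_bigr (fun=> \sum_(eps : {ffun I * J -> bool}) `|sign_sum eps x| ^+ 2)); last first.
    move=> del _.
    rewrite -[RHS](sum_xorf [ffun ij => del ij.1] (fun e => `|sign_sum e x| ^+ 2)).
    apply: eq_bigr => eps _.
    congr (`|_| ^+ 2); rewrite /sign_sum /Y.
    under eq_bigr do rewrite scaler_sumr.
    rewrite pair_big/=; apply: eq_bigr => -[i j] _ /=.
    by rewrite !ffunE/= scalerA signr_addb.
  rewrite sum_signs_const; congr (_ * _).
  by rewrite mulrA mulVf ?mul1r// expf_neq0.
have -> : \sum_ij `|x ij| ^+ 2 = \sum_i \sum_j `|x (i, j)| ^+ 2.
  by rewrite pair_big/=; apply: eq_bigr => -[].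
apply: (@le_trans _ _ (\sum_i #|J|%:R * eta * rad2 (fun j => x (i, j)))).
  by apply: ler_sum => i _; exact: aJ.
rewrite -mulr_sumr; under eq_bigr do rewrite h1.
rewrite -mulr_sumr exchange_big/=.
have -> : #|{: I * J}|%:R * (theta * eta) * rad2 x =
   #|J|%:R * eta * ((2 ^+ #|{: I * J}|)^-1 * \sum_eps (#|I|%:R * theta * rad2 (Y eps))).
  rewrite -h2 -mulr_sumr card_prod natrM; ring.
rewrite ler_wpM2l ?mulr_ge0// ler_wpM2l ?invr_ge0 ?exprn_ge0//.
by apply: ler_sum => eps _; exact: aI.
Qed.

Lemma average_domination_exp (I : finType) (theta : R) k : 0 <= theta ->
  average_domination I theta ->
  exists J : finType, #|J| = (#|I| ^ k)%N /\ average_domination J (theta ^+ k).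
Proof.
move=> t0 aI; elim: k => [|k [J [cJ aJ]]].
  exists unit; rewrite card_unit; split=> // x.
  rewrite expr0 card_unit !mul1r (big_pred1 tt) ?rad2_single//; by case.
exists (I * J)%type; split; first by rewrite card_prod cJ expnS.
rewrite exprS; apply: average_domination_prod => //; exact: exprn_ge0.
Qed.

(** Otherwise $|I|^k$ of these vectors, indexed by the [k]-th power of [I], violate the inequality
    with $\theta^k$, since passing to a subfamily does not increase [rad2]. *)
Lemma average_domination_count (I K : finType) (theta : R) (x : K -> V) k :
  0 <= theta -> average_domination I theta -> (0 < #|I|)%N ->
  (#|[set i | (theta ^+ k * rad2 x < `|x i| ^+ 2)%R]%SET| < #|I| ^ k)%N.
Proof.
move=> t0 aI I0; rewrite ltnNge; apply/negP => large.
have [J [cJ aJ]] := average_domination_exp k t0 aI.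
rewrite -cJ in large.
set D := [set i | _]%SET in large *.
pose s (j : J) := enum_val (widen_ord large (enum_rank j)).
have s_inj : injective s.
  by move=> i j /enum_val_inj /(congr1 val)/= /val_inj /enum_rank_inj.
have sD j : theta ^+ k * rad2 x < `|x (s j)| ^+ 2.
  by have := enum_valP (widen_ord large (enum_rank j)); rewrite inE.
have := aJ (x \o s); apply/negP; rewrite -ltNge.
apply: (@le_lt_trans _ _ (\sum_(j : J) theta ^+ k * rad2 x)).
  rewrite sum_const_card mulrA ler_wpM2l ?mulr_ge0 ?exprn_ge0//.
  exact: rad2_subfamily.
have J0 : (0 < #|J|)%N by rewrite cJ expn_gt0 I0.
have [j0 _] : exists j0 : J, j0 \in J by apply/card_gt0P.
apply: ltr_sum; first by apply/hasP; exists j0; rewrite ?mem_index_enum.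
by move=> j _; exact: sD.
Qed.

(** Sort the vectors by the levels $\theta^{k+1}\rho<\|x_i\|^2\le\theta^k\rho$. Level [k] has fewer
    than $n^{k+1}$ members, so its share of $\sum\|x_i\|^{2r}$ is at most $n(n\theta^r)^k\rho^r$.
    For $n\theta^r\le1/2$ these shares are dominated by a geometric series, and $2r$ is the cotype
    exponent. *)
Lemma average_domination_cotype (I : finType) (theta : R) :
  0 < theta -> theta < 1 -> (0 < #|I|)%N -> average_domination I theta ->
  finite_cotype V.
Proof.
move=> t0 t1 I0 aI; have t0' := ltW t0.
pose n := #|I|.
have n0 : 0 < n%:R :> R by rewrite ltr0n.
have [r [r1 hr]] : exists r : nat, (0 < r)%N /\ n%:R * theta ^+ r <= 2^-1.
  have /cvgrPdist_lt/(_ (2 * n%:R)^-1) : theta ^+ m @[m --> \oo] --> (0 : R).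
    by apply: cvg_expr; rewrite ger0_norm.
  rewrite invr_gt0 mulr_gt0// => /(_ isT) [m0 _ hm].
  exists m0.+1; split=> //.
  have := hm m0.+1 (leqnSn _); rewrite /= sub0r normrN ger0_norm ?exprn_ge0//.
  by rewrite invfM ltr_pdivlMr// mulrC => /ltW.
have pow : forall M (x : 'I_M -> V),
    \sum_(i < M) `|x i| ^+ (2 * r) <= (2 * n%:R) * rademacher_average x ^+ (2 * r).
  move=> M x.
  have -> : rademacher_average x = Num.sqrt (rad2 x).
    by rewrite /rademacher_average /rad2 card_ord.
  rewrite exprM sqr_sqrtr ?rad2_ge0//; set rho := rad2 x.
  have rho0 : 0 <= rho := rad2_ge0 x.
  have xrho i : `|x i| ^+ 2 <= rho := rad2_single x i.
  have lev i : exists k, x i != 0 -> theta ^+ k.+1 * rho < `|x i| ^+ 2 <= theta ^+ k * rho.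
    have [xi0|xi0] := eqVneq (x i) 0; first by exists 0.
    have ex : exists k, theta ^+ k * rho < `|x i| ^+ 2.
      have [rho00|rhoN] := eqVneq rho 0.
        by exists 0; rewrite rho00 mulr0 exprn_gt0// normr_gt0.
      have rhop : 0 < rho by rewrite lt_neqAle eq_sym rhoN.
      have /cvgrPdist_lt/(_ (`|x i| ^+ 2 / rho)) : theta ^+ m @[m --> \oo] --> (0 : R).
        by apply: cvg_expr; rewrite ger0_norm.
      rewrite divr_gt0 ?exprn_gt0 ?normr_gt0// => /(_ isT) [m0 _ hm].
      exists m0; have := hm m0 (leqnn _); rewrite /= sub0r normrN ger0_norm ?exprn_ge0//.
      by rewrite ltr_pdivlMr.
    have := ex_minnP ex => -[[|k] hk kmin].
      by move: hk; rewrite expr0 mul1r ltNge xrho.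
    exists k => _; rewrite hk leNgt /=; apply/negP => /kmin; by rewrite ltnn.
  have {lev}[l hl] := choice lev.
  pose K := (\max_i l i).+1.
  have lK i : (l i < K)%N by rewrite ltnS leq_bigmax.
  apply: (@le_trans _ _ (\sum_(k < K) \sum_(i | (l i == k) && (x i != 0)) (theta ^+ k * rho) ^+ r)).
    rewrite (exchange_big_dep (fun i => x i != 0))/=; last by move=> k i _ /andP[].
    rewrite [leLHS](bigID (fun i => x i == 0))/= big1 ?add0r; last first.
      by move=> i /eqP->; rewrite normr0 expr0n muln_eq0/= gtn_eqF.
    apply: ler_sum => i xi0; rewrite (big_pred1 (Ordinal (lK i))); last first.
      by move=> k /=; rewrite xi0 andbT; apply/eqP/eqP => [E|->//]; apply/val_inj.
    rewrite exprM; apply: lerXn2r; rewrite ?nnegrE; [exact: exprn_ge0| |].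
      exact: mulr_ge0 (exprn_ge0 _ t0') rho0.
    by have /andP[] := hl i xi0.
  apply: (@le_trans _ _ (\sum_(k < K) n%:R * 2^-1 ^+ k * rho ^+ r)).
    apply: ler_sum => k _; rewrite sumr_const -[leLHS]mulr_natl exprMn mulrA ler_wpM2r ?exprn_ge0//.
    apply: (@le_trans _ _ ((n ^ k.+1)%:R * (theta ^+ k) ^+ r)).
      rewrite ler_wpM2r ?exprn_ge0// ler_nat ltnW//.
      apply: leq_ltn_trans (average_domination_count x k.+1 t0' aI I0).
      apply: subset_leq_card; apply/fintype.subsetP => i; rewrite !inE => /andP[/eqP lik xi0].
      by rewrite -lik; have /andP[] := hl i xi0.
    rewrite natrX exprS -mulrA ler_wpM2l// -exprM mulnC exprM -exprMn.
    by rewrite lerXn2r ?nnegrE ?mulr_ge0 ?exprn_ge0// invr_ge0.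
  rewrite -mulr_suml ler_wpM2r ?exprn_ge0// -mulr_sumr mulrC ler_wpM2r//.
  have : \sum_(k < K) 2^-1 ^+ k = 2 - 2 * 2^-1 ^+ K :> R.
    elim: (K) => [|m IH]; first by rewrite big_ord0 expr0; lra.
    by rewrite big_ord_recr/= IH exprS; lra.
  have : 0 <= 2^-1 ^+ K :> R by rewrite exprn_ge0 ?invr_ge0.
  lra.
exists (2 * r)%:R; split.
  by rewrite ler_nat leq_pmulr.
exists ((2 * n%:R) `^ (2 * r)%:R^-1) => M x.
have r0 : (2 * r)%:R != 0 :> R by rewrite pnatr_eq0 muln_eq0/= -lt0n.
have s0 : 0 <= \sum_(i < M) `|x i| ^+ (2 * r) by apply: sumr_ge0 => i _; exact: exprn_ge0.
under eq_bigr do rewrite powR_mulrn//.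
apply: (@le_trans _ _ ((2 * n%:R * rademacher_average x ^+ (2 * r)) `^ (2 * r)%:R^-1)).
  by rewrite ge0_ler_powR ?invr_ge0 ?nnegrE ?mulr_ge0 ?exprn_ge0 ?sqrtr_ge0.
rewrite powRM ?mulr_ge0 ?exprn_ge0 ?sqrtr_ge0// ler_wpM2l ?powR_ge0//.
by rewrite -powR_mulrn ?sqrtr_ge0// -powRrM mulfV// powRr1 ?sqrtr_ge0.
Qed.

(* If the average domination fails for every [theta < 1], a family with norms close
   to its Rademacher average spans almost isometrically [l_infty^I]. *)
Lemma average_domination_dichotomy (I : finType) : (0 < #|I|)%N ->
  (exists theta, [/\ 0 < theta, theta < 1 & average_domination I theta]) \/
  (exists x : I -> V, bounded_family x 2 /\
     forall (c : I -> R) j, `|c j| <= 2 * `|\sum_i c i *: x i|).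
Proof.
(* A single choice of signs has weight $2^{-|I|}$ in the average, so a variance of $|I|\delta$
   controls each sign sum only up to the factor $2^{|I|}$. [D] makes $2^{|I|}|I|\delta$ equal to
   1/100. *)
move=> I0; pose nI : R := #|I|%:R; pose D : R := 100 * (2 ^+ #|I| * nI).
have nI1 : 1 <= nI by rewrite /nI ler1n.
have P1 : 1 <= 2 ^+ #|I| :> R by rewrite exprn_ege1// ler1n.
have D0 : 100 <= D by rewrite /D; nra.
pose delta := D^-1.
have d0 : 0 < delta by rewrite invr_gt0; lra.
have dD : delta * D = 1 by rewrite mulVf//; lra.
have [aI|] := pselect (average_domination I (1 - delta)).
  left; exists (1 - delta); split=> //; last by lra.
  by rewrite subr_gt0 invf_lt1; lra.
move=> /existsNP[y /negP]; rewrite -ltNge => hy; right.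
have r0 : 0 < rad2 y.
  rewrite lt_neqAle rad2_ge0 andbT eq_sym; apply/negP => /eqP r0.
  move: hy; rewrite r0 mulr0 big1 ?ltxx// => i _.
  by apply/eqP; rewrite eq_le sqr_ge0 andbT -r0 rad2_single.
pose t := (Num.sqrt (rad2 y))^-1.
have t0 : 0 < t by rewrite invr_gt0 sqrtr_gt0.
have t2 : t ^+ 2 * rad2 y = 1 by rewrite /t exprVn sqr_sqrtr ?ltW// mulVf// gt_eqF.
pose x i := t *: y i.
have sxE eps : sign_sum eps x = t *: sign_sum eps y.
  by rewrite /sign_sum scaler_sumr; apply: eq_bigr => i _; rewrite !scalerA mulrC.
have rx : rad2 x = 1.
  rewrite -t2 /rad2 mulrCA; congr (_ * _); rewrite mulr_sumr; apply: eq_bigr => eps _.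
  by rewrite sxE normrZ exprMn gtr0_norm.
have hx : nI * (1 - delta) < \sum_i `|x i| ^+ 2.
  have -> : \sum_i `|x i| ^+ 2 = t ^+ 2 * \sum_i `|y i| ^+ 2.
    by rewrite mulr_sumr; apply: eq_bigr => i _; rewrite normrZ exprMn gtr0_norm.
  have -> : nI * (1 - delta) = t ^+ 2 * (nI * (1 - delta) * rad2 y).
    by rewrite [RHS]mulrCA t2 mulr1.
  by rewrite ltr_pM2l ?exprn_gt0.
have x1 i : `|x i| ^+ 2 <= 1 by rewrite -rx rad2_single.
have xlow j : 1 - nI * delta <= `|x j| ^+ 2.
  move: hx; rewrite (bigD1 j)//=.
  have : \sum_(i | i != j) `|x i| ^+ 2 <= nI - 1.
    apply: (@le_trans _ _ (\sum_(i | i != j) 1)); first by apply: ler_sum.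
    rewrite sumr_const /nI (_ : #|I| = #|[pred i | i != j]|.+1) -?natr1 ?addrK//.
    by rewrite (cardD1 j) inE add1n; congr _.+1; apply: eq_card => i; rewrite !inE andbT.
  lra.
have pd : 2 ^+ #|I| * (nI * delta) <= 1 / 100 by move: dD; rewrite /D; lra.
have nd : nI * delta <= 1 / 100.
  apply: le_trans pd; rewrite ler_peMl// mulr_ge0 ?ltW//.
  by apply: lt_le_trans nI1.
have xlow' j : 9 / 10 <= `|x j|.
  rewrite -(@ler_pXn2r _ 2) ?nnegrE//; by have := xlow j; lra.
pose a := (2 ^+ #|I|)^-1 * \sum_eps `|sign_sum eps x|.
have [j0 _] : exists j0 : I, j0 \in I by apply/card_gt0P.
(* Flipping every sign except the one at [j0] and adding leaves only $\pm2x_{j0}$. *)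
have a_low : `|x j0| <= a.
  pose del : {ffun I -> bool} := [ffun i => i != j0].
  have -> : a = (2 ^+ #|I|)^-1 * \sum_eps (`|sign_sum eps x| + `|sign_sum (xorf del eps) x|) / 2.
    rewrite /a -mulr_suml big_split/= (sum_xorf del (fun e => `|sign_sum e x|)).
    by rewrite half_double.
  rewrite ler_pdivlMl ?exprn_gt0// -sum_signs_const.
  apply: ler_sum => eps _; rewrite ler_pdivlMr//.
  apply: (le_trans _ (ler_normD _ _)).
  have -> : sign_sum eps x + sign_sum (xorf del eps) x = 2 *: ((-1) ^+ eps j0 *: x j0).
    rewrite /sign_sum -big_split/= (bigD1 j0)//= big1 ?addr0.
      by rewrite !ffunE eqxx/= scaler_nat mulr2n.
    by move=> i ij; rewrite !ffunE ij/= signrN scaleNr subrr.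
  by rewrite [leRHS]normrZ normr_nat [X in _ <= _ * X]normrZ normr_sign mul1r mulrC.
have a2 : 1 - nI * delta <= a ^+ 2.
  by rewrite (le_trans (xlow j0))// lerXn2r ?nnegrE// (le_trans _ a_low).
(* The norms of the sign sums have mean [a] and variance $1-a^2\le|I|\delta$, so each of them is
   within 1/10 of [a]. *)
have var : (2 ^+ #|I|)^-1 * \sum_eps (`|sign_sum eps x| - a) ^+ 2 = 1 - a ^+ 2.
  have -> : \sum_eps (`|sign_sum eps x| - a) ^+ 2 = \sum_eps `|sign_sum eps x| ^+ 2
      - 2 * a * \sum_eps `|sign_sum eps x| + 2 ^+ #|I| * a ^+ 2.
    rewrite -sum_signs_const mulr_sumr -sumrB -big_split/=.
    by apply: eq_bigr => eps _; ring.
  rewrite mulrDr mulrBr -/(rad2 x) rx mulrA mulVf ?mul1r ?expf_neq0//.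
  rewrite [X in 1 - X](_ : _ = 2 * a * a); last by rewrite /a; ring.
  by ring.
have s_up eps : `|sign_sum eps x| <= 11 / 10.
  have h : (`|sign_sum eps x| - a) ^+ 2 <= 1 / 100.
    apply: le_trans pd.
    rewrite -ler_pdivrMl ?exprn_gt0//.
    apply: (@le_trans _ _ (1 - a ^+ 2)); last by lra.
    rewrite -var ler_wpM2l ?invr_ge0 ?exprn_ge0// (bigD1 eps)//= lerDl.
    by apply: sumr_ge0 => e _; rewrite sqr_ge0.
  have a1 : a <= 1.
    have : a ^+ 2 <= 1.
      rewrite -subr_ge0 -var mulr_ge0 ?invr_ge0 ?exprn_ge0//.
      by apply: sumr_ge0 => e _; rewrite sqr_ge0.
    have := le_trans (normr_ge0 _) a_low; nra.
  nra.
have bx : bounded_family x (11 / 10).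
  by apply: bounded_family_signs => eps; exact: s_up.
exists x; split.
  by move=> c c1; rewrite (le_trans (bx c c1))//; lra.
move=> c j1.
have [j jmax] : exists j, forall i, `|c i| <= `|c j|.
  by case: (@arg_maxP _ R I j0 xpredT (fun i => `|c i|)) => // j _ hj; exists j => i; exact: hj.
apply: (le_trans (jmax j1)).
(* Reversing all coefficients but the largest isolates it: $2|c_j|\|x_j\|$ is at most the sum of the
   two norms. As the norm for [c'] is at most $\frac{11}{10}|c_j|$ and $\|x_j\|\ge\frac9{10}$, the
   original norm is at least $\frac7{10}|c_j|$. *)
pose c' i := if i == j then c i else - c i.
have := bounded_family_scale (normr_ge0 (c j)) bx (_ : forall i, `|c' i| <= `|c j|).
move=> /(_ (ltac:(by move=> i; rewrite /c'; case: ifP => _; rewrite ?normrN))) h1.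
have h2 : 2 * `|c j| * `|x j| <= `|\sum_i c i *: x i| + `|\sum_i c' i *: x i|.
  rewrite (le_trans _ (ler_normD _ _))// -big_split/= (bigD1 j)//= big1 ?addr0.
    rewrite /c' eqxx -scalerDl (_ : c j + c j = 2 * c j) ?[leRHS]normrZ; last first.
      by rewrite mulr_natl mulr2n.
    by rewrite normrM normr_nat.
  by move=> i /negPf ij; rewrite /c' ij scaleNr subrr.
have := xlow' j; have := normr_ge0 (c j); nra.
Qed.

End RademacherAverages.

(** * Gaussian moments *)

Import HBNNSimple.

Section DensityTransfer.
Context d1 d2 (T1 : measurableType d1) (T2 : measurableType d2) (R : realType).
Variables (mu : {measure set T1 -> \bar R}) (rho : {measure set T2 -> \bar R}).

(** The hypothesis says that [Y] maps the measure with density [U] to [c] times [rho]. It is used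
    with [Y] the identity and [U] the normal density, and with [Y] one Gaussian variable and [U] a
    product of functions of the others. *)
Lemma integral_transfer (U : T1 -> R) (Y : T1 -> T2) (c : R) : 0 <= c ->
  measurable_fun setT U -> (forall x, 0 <= U x) -> measurable_fun setT Y ->
  (forall A, measurable A -> (\int[mu]_x (U x * \1_A (Y x))%:E = c%:E * rho A)%E) ->
  forall h : T2 -> R, measurable_fun setT h -> (forall y, 0 <= h y) ->
  (\int[mu]_x (U x * h (Y x))%:E = c%:E * \int[rho]_y (h y)%:E)%E.
Proof.
move=> c0 mU U0 mY UY h mh h0.
have mIY A : measurable A -> measurable_fun setT (fun x => \1_A (Y x) : R).
  by move=> mA; apply: measurableT_comp => //; exact: measurable_indic.
have simple (s : {nnsfun T2 >-> R}) :
    (\int[mu]_x (U x * s (Y x))%:E = c%:E * \int[rho]_y (s y)%:E)%E.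
  have r0 r y : 0 <= r * \1_(s @^-1` [set r]) y.
    by rewrite -lee_fin EFinM nnfun_muleindic_ge0.
  have ms r : measurable (s @^-1` [set r]) by exact: measurable_sfunP.
  transitivity (\int[mu]_x (\sum_(r \in range s) (U x * (r * \1_(s @^-1` [set r]) (Y x)))%:E))%E.
    apply: eq_integral => x _; rewrite fsumEFin//; congr EFin.
    by rewrite {1}(fimfunE s) fsbig_distrr.
  rewrite ge0_integral_fsum//=; last 2 first.
  - move=> r; apply/measurable_EFinP; apply: measurable_funM => //.
    by apply: measurable_funM => //; exact: mIY.
  - by move=> r x _; rewrite lee_fin mulr_ge0.
  transitivity (\sum_(r \in range s) c%:E * \int[rho]_y (r * \1_(s @^-1` [set r]) y)%:E)%E.
    apply: eq_fsbigr => r; rewrite inE => -[y _ <-].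
    under eq_integral do rewrite mulrCA EFinM.
    rewrite ge0_integralZl_EFin//.
    - under [in RHS]eq_integral do rewrite EFinM.
      rewrite [in RHS]ge0_integralZl_EFin//; last by apply/measurable_EFinP; exact: measurable_indic.
      by rewrite UY// integral_indic// setIT muleCA.
    - by move=> x _; rewrite lee_fin mulr_ge0// indicE.
    - by apply/measurable_EFinP; apply: measurable_funM => //; exact: mIY.
  rewrite -ge0_mule_fsumr; last by move=> r; apply: integral_ge0 => y _; rewrite lee_fin.
  congr (_ * _)%E; rewrite -ge0_integral_fsum//=; last 2 first.
  - by move=> r; apply/measurable_EFinP; apply: measurable_funM.
  - by move=> r x _; rewrite lee_fin.
  by apply: eq_integral => y _; rewrite fsumEFin// [in RHS](fimfunE s).
have mEh : measurable_fun setT (EFin \o h) by exact/measurable_EFinP.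
pose hn := nnsfun_approx measurableT mEh.
have hh y : (hn n y)%:E @[n --> \oo] --> (h y)%:E.
  by apply: (cvg_nnsfun_approx measurableT mEh) => // z _; rewrite lee_fin.
have ndh y : {homo (fun n => hn n y) : n m / (n <= m)%N >-> n <= m}.
  by move=> n m nm; have /lefP := nd_nnsfun_approx measurableT mEh nm; apply.
have h1 : (\int[mu]_x (U x * hn n (Y x))%:E)%E @[n --> \oo] --> (\int[mu]_x (U x * h (Y x))%:E)%E.
  have -> : (\int[mu]_x (U x * h (Y x))%:E = \int[mu]_x limn (fun n => (U x * hn n (Y x))%:E))%E.
    apply: eq_integral => x _; apply/esym/cvg_lim => //.
    rewrite EFinM; under eq_fun do rewrite EFinM.
    by apply: cvgeZl => //; exact: hh.
  apply: cvg_monotone_convergence => //.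
  - move=> n; apply/measurable_EFinP; apply: measurable_funM => //.
    exact: measurableT_comp.
  - by move=> n x _; rewrite lee_fin mulr_ge0.
  - by move=> x _ n m nm; rewrite lee_fin ler_wpM2l// ndh.
have h2 : (c%:E * \int[rho]_y (hn n y)%:E)%E @[n --> \oo] --> (c%:E * \int[rho]_y (h y)%:E)%E.
  apply: cvgeZl => //.
  have -> : (\int[rho]_y (h y)%:E = \int[rho]_y limn (fun n => (hn n y)%:E))%E.
    by apply: eq_integral => y _; apply/esym/cvg_lim => //; exact: hh.
  apply: cvg_monotone_convergence => //.
  - by move=> n; apply/measurable_EFinP.
  - by move=> n x _; rewrite lee_fin.
  - by move=> x _ n m nm; rewrite lee_fin ndh.
apply: (cvg_unique _ h1); rewrite // (_ : (fun n => _) = (fun n => c%:E * \int[rho]_y (hn n y)%:E)%E) //.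
by apply/funext => n; exact: simple.
Qed.

End DensityTransfer.

Section GaussianMoments.
Context d (Omega : measurableType d) {R : realType} {P : probability Omega R}.
Variable g : nat -> {RV P >-> R}.
Hypotheses (g_gauss : standard_gaussian g) (g_indep : independent g).

(** Completing the square: the exponential weight moves the mean from 0 to [s]. *)
Lemma normal_pdf_shift (s x : R) :
  normal_pdf 0 1 x * expR (s * x) = expR (s ^+ 2 / 2) * normal_pdf s 1 x.
Proof.
rewrite /normal_pdf oner_eq0 -!mulrA [RHS]mulrCA; congr (_ * _).
rewrite /normal_fun -!expRD; congr expR.
by rewrite expr1n subr0; field.
Qed.

Lemma gaussian_mgf (j : nat) (s : R) :
  (\int[P]_w (expR (s * g j w))%:E = (expR (s ^+ 2 / 2))%:E)%E.
Proof.
have me : measurable_fun setT (fun x : R => expR (s * x)).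
  by apply: measurableT_comp => //; exact: measurable_funM.
rewrite -(@ge0_integral_distribution _ _ _ _ _ P (g j) (fun x => (expR (s * x))%:E)); last 2 first.
- exact/measurable_EFinP.
- by move=> y; rewrite lee_fin expR_ge0.
have := @integral_transfer _ _ _ _ R (@lebesgue_measure R) (distribution P (g j))
  (normal_pdf 0 1) id 1 ler01 (measurable_normal_pdf 0 1) (normal_pdf_ge0 0 1).
move=> /(_ (@measurable_id _ _ _) _ _ me) /=; rewrite mul1e => <-; last 2 first.
- move=> A mA; rewrite mul1e g_gauss// /normal_prob [RHS]integral_mkcond/=.
  by apply: eq_integral => x _; rewrite patchE indicE; case: ifP => _; rewrite (mulr1,mulr0).
- by move=> y; rewrite expR_ge0.
under eq_integral do rewrite normal_pdf_shift EFinM.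
rewrite ge0_integralZl_EFin ?expR_ge0//.
- by rewrite integral_normal_pdf mule1.
- by move=> x _; rewrite lee_fin normal_pdf_ge0.
- by apply/measurable_EFinP; exact: measurable_normal_pdf.
Qed.

Lemma measurable_preimage_g j (A : set R) : measurable A -> measurable (g j @^-1` A).
Proof. by move=> mA; rewrite -[X in measurable X]setTI; exact: (measurable_funPT (g j)). Qed.

Lemma independent_prod_indic (N : nat) (A : nat -> set R) : (forall i, measurable (A i)) ->
  (\int[P]_w (\prod_(j < N) \1_(A j) (g j w))%:E = (\prod_(j < N) fine (P (g j @^-1` A j)))%:E)%E.
Proof.
move=> mA.
pose I : {fset nat} := [fset x in iota 0 N]%fset.
have II : perm_eq I (iota 0 N).
  by apply: uniq_perm; rewrite ?fset_uniq ?iota_uniq// => i; rewrite !inE.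
have -> : (\prod_(j < N) fine (P (g j @^-1` A j)))%:E = P (\bigcap_(i in [set` I]) (g i @^-1` A i)).
  rewrite g_indep// (perm_big _ II)/= -(big_mkord xpredT (fun j => fine (P (g j @^-1` A j)))).
  rewrite /index_iota subn0; elim: (iota 0 N) => [|i r IH]; first by rewrite !big_nil.
  rewrite !big_cons EFinM IH fineK// fin_num_measure//; exact: measurable_preimage_g.
have mB : measurable (\bigcap_(i in [set` I]) (g i @^-1` A i)).
  by apply: fin_bigcap_measurable => // i _; exact: measurable_preimage_g.
rewrite -[X in P X]setIT -integral_indic//; apply: eq_integral => w _; congr EFin.
have [h|h] := pselect ((\bigcap_(i in [set` I]) (g i @^-1` A i)) w).
  rewrite [RHS]indicE mem_set// big1// => j _; rewrite indicE mem_set//.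
  by apply: h; rewrite /= !inE /= mem_iota add0n ltn_ord.
rewrite [RHS]indicE memNset//.
have [j jN jA] : exists2 j, (j < N)%N & ~ A j (g j w).
  apply: contrapT => nj; apply: h => j /=; rewrite !inE /= mem_iota add0n => jN.
  by apply: contrapT => jA; apply: nj; exists j.
by rewrite (bigD1 (Ordinal jN))//= indicE memNset// mul0r.
Qed.

(** Induction on the number of factors that need not be indicators. Products of indicators are the
    definition of independence, and the factor in place [k] is made general by [integral_transfer],
    with the product of the other factors as density. *)
Lemma independent_prod (N : nat) (f : nat -> R -> R) (m : nat -> R) :
  (forall j, measurable_fun setT (f j)) -> (forall j x, 0 <= f j x) ->
  (forall j, \int[P]_w (f j (g j w))%:E = (m j)%:E)%E ->
  (\int[P]_w (\prod_(j < N) f j (g j w))%:E = (\prod_(j < N) m j)%:E)%E.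
Proof.
suff main k : (k <= N)%N -> forall (f : nat -> R -> R) (m : nat -> R),
  (forall j, measurable_fun setT (f j)) -> (forall j x, 0 <= f j x) ->
  (forall j, \int[P]_w (f j (g j w))%:E = (m j)%:E)%E ->
  (forall j, (k <= j)%N -> exists2 A, measurable A & f j = \1_A) ->
  (\int[P]_w (\prod_(j < N) f j (g j w))%:E = (\prod_(j < N) m j)%:E)%E.
  move=> mf f0 fm.
  pose f' j := if (j < N)%N then f j else \1_setT.
  pose m' j := if (j < N)%N then m j else 1.
  have := main N (leqnn N) f' m'.
  have -> : \prod_(j < N) m' j = \prod_(j < N) m j.
    by apply: eq_bigr => j _; rewrite /m' ltn_ord.
  move=> <-.
  - by apply: eq_integral => w _; congr EFin; apply: eq_bigr => j _; rewrite /f' ltn_ord.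
  - by move=> j; rewrite /f'; case: ifP => // _; exact: measurable_indic.
  - by move=> j x; rewrite /f'; case: ifP => // _; rewrite indicE.
  - move=> j; rewrite /f' /m'; case: ifP => // _.
    have -> : (fun w => (\1_setT (g j w) : R)%:E) = (fun w => (\1_setT w : R)%:E).
      by apply/funext => w; rewrite !indicE !in_setT.
    by rewrite integral_indic// setIT; exact: probability_setT.
  - by move=> j; rewrite leqNgt => /negPf jN; exists setT => //; rewrite /f' jN.
elim: k => [_|k IH kN] {}f {}m mf f0 fm fA.
  have /choice[A hA] : forall j, exists A, measurable A /\ f j = \1_A.
    by move=> j; have [//|A mA fE] := fA j _; exists A.
  have := @independent_prod_indic N A (fun j => (hA j).1).
  have -> : (\prod_(j < N) fine (P (g j @^-1` A j)))%R = \prod_(j < N) m j.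
    apply: eq_bigr => j _; apply: EFin_inj; rewrite -fm (hA j).2 fineK; last first.
      by rewrite fin_num_measure//; apply: measurable_preimage_g; case: (hA j).
    rewrite -[X in P X]setIT -integral_indic//.
    by apply: measurable_preimage_g; case: (hA j).
  by move=> <-; apply: eq_integral => w _; congr EFin; apply: eq_bigr => j _; rewrite (hA j).2.
have m0 j : 0 <= m j.
  by rewrite -lee_fin -fm; apply: integral_ge0 => w _; rewrite lee_fin.
pose U w := \prod_(j < N | j != Ordinal kN) f j (g j w).
pose c := \prod_(j < N | j != Ordinal kN) m j.
have c0 : 0 <= c by apply: prodr_ge0.
have mU : measurable_fun setT U.
  have -> : U = fun w => \prod_(j < N) (if j != Ordinal kN then f j (g j w) else 1).
    by apply/funext => w; rewrite /U big_mkcond.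
  by apply: measurable_prod => j _; case: (j != Ordinal kN) => //; apply: measurableT_comp.
have U0 w : 0 <= U w by apply: prodr_ge0.
have UA A : measurable A ->
    (\int[P]_w (U w * \1_A (g k w))%:E = c%:E * distribution P (g k) A)%E.
  move=> mA.
  pose f' j := if j == k then \1_A else f j.
  pose m' j := if j == k then fine (P (g k @^-1` A)) else m j.
  have PA : P (g k @^-1` A) \is a fin_num.
    by rewrite fin_num_measure//; exact: measurable_preimage_g.
  have := IH (ltnW kN) f' m'.
  have -> : \prod_(j < N) m' j = c * fine (P (g k @^-1` A)).
    rewrite (bigD1 (Ordinal kN))//= {1}/m' eqxx mulrC; congr (_ * _).
    by apply: eq_bigr => j; rewrite -val_eqE /m' /= => /negPf->.
  rewrite EFinM fineK// => <-.
  - apply: eq_integral => w _; congr EFin.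
    rewrite [RHS](bigD1 (Ordinal kN))//= {1}/f' eqxx mulrC; congr (_ * _).
    by apply: eq_bigr => j; rewrite -val_eqE /f' /= => /negPf->.
  - by move=> j; rewrite /f'; case: ifP => // _; exact: measurable_indic.
  - by move=> j x; rewrite /f'; case: ifP => // _; rewrite indicE.
  - move=> j; rewrite /f' /m'; case: ifP => // /eqP->.
    rewrite fineK// -[X in P X]setIT -integral_indic//.
    exact: measurable_preimage_g.
  - move=> j kj; rewrite /f'; case: eqP => [_|/eqP jk]; first by exists A.
    by apply: fA; rewrite ltn_neqAle eq_sym jk.
have := integral_transfer c0 mU U0 (measurable_funPT (g k)) UA (mf k) (f0 k).
rewrite ge0_integral_distribution//; last 2 first.
- exact/measurable_EFinP.
- by move=> y; rewrite lee_fin.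
rewrite (_ : (\int[P]_x _)%E = (m k)%:E); last by rewrite -fm.
rewrite -EFinM => h.
rewrite (bigD1 (Ordinal kN))//= mulrC -/c -h.
by apply: eq_integral => w _; congr EFin; rewrite (bigD1 (Ordinal kN))//= mulrC.
Qed.

Lemma gaussian_comb_mgf (N : nat) (s : nat -> R) :
  (\int[P]_w (expR (\sum_(j < N) s j * g j w))%:E = (expR (\sum_(j < N) s j ^+ 2 / 2))%:E)%E.
Proof.
have := @independent_prod N (fun j x => expR (s j * x)) (fun j => expR (s j ^+ 2 / 2)).
rewrite -expR_sum => <-.
- by apply: eq_integral => w _; rewrite expR_sum.
- by move=> j; apply: measurableT_comp => //; exact: measurable_funM.
- by move=> j x; exact: expR_ge0.
- by move=> j; exact: gaussian_mgf.
Qed.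

(** Gives square integrability of the Gaussian variables from their exponential moments. *)
Lemma sqr_le_expR (x : R) : x ^+ 2 <= 4 * (expR x + expR (- x)).
Proof.
wlog x0 : x / 0 <= x => [hw|].
  have [/hw//|/ltW x0] := leP 0 x.
  by have := hw (- x); rewrite sqrrN opprK [expR _ + _]addrC; apply; rewrite oppr_ge0.
have h : 1 + x / 2 <= expR (x / 2) by exact: expR_ge1Dx.
have e0 := expR_ge0 (- x).
have : expR x = expR (x / 2) ^+ 2 by rewrite expr2 -expRD; congr expR; field.
have e1 := expR_ge0 (x / 2); nra.
Qed.

Lemma gaussian_sqr_lty j : (\int[P]_w (g j w ^+ 2)%:E < +oo)%E.
Proof.
apply: (@le_lt_trans _ _ (\int[P]_w (4 * (expR (1 * g j w) + expR (- 1 * g j w)))%:E)%E).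
  apply: ge0_le_integral => //.
  - by move=> w _; rewrite lee_fin sqr_ge0.
  - by apply/measurable_EFinP; apply: measurable_funX; exact: measurable_funPT.
  - apply/measurable_EFinP; apply: measurable_funM => //.
    apply: measurable_funD; apply: measurableT_comp => //; apply: measurable_funM => //.
  - by move=> w _; rewrite lee_fin mul1r mulN1r sqr_le_expR.
have me s : measurable_fun setT (fun w => (expR (s * g j w))%:E).
  by apply/measurable_EFinP; apply: measurableT_comp => //; apply: measurable_funM.
under eq_integral do rewrite EFinM.
rewrite ge0_integralZl_EFin//; last first.
  apply/measurable_EFinP; apply: measurable_funD; apply/measurable_EFinP; exact: me.
under eq_integral do rewrite EFinD.
rewrite ge0_integralD//.
by rewrite !gaussian_mgf -EFinD -EFinM ltry.
Qed.

Lemma Lfun2P (f : Omega -> R) : measurable_fun setT f ->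
  (\int[P]_w (f w ^+ 2)%:E < +oo)%E -> f \in Lfun P 2%:E.
Proof.
move=> mf f2; rewrite inE; apply/andP; split; rewrite inE//=.
rewrite /finite_norm unlock; apply: poweR_lty.
rewrite (_ : (\int[P]_w _)%E = (\int[P]_w (f w ^+ 2)%:E)%E)//.
by apply: eq_integral => w _ /=; rewrite powR_mulrn// real_normK// num_real.
Qed.

Lemma gaussian_Lfun2 j : (g j : Omega -> R) \in Lfun P 2%:E.
Proof. by apply: Lfun2P; [exact: measurable_funPT|exact: gaussian_sqr_lty]. Qed.

End GaussianMoments.

(** * Vector-valued square integrable functions *)

Import HBSimple HBNNSimple.

Section SquareIntegrable.
Context d (Omega : measurableType d) {R : realType} (P : probability Omega R).
Local Notation Ex f := (Rintegral P setT f).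
Local Notation integ f := (P.-integrable setT (EFin \o (f : Omega -> R))).
Local Notation L2 := (Lfun P 2%:E).
Implicit Types f h : Omega -> R.

Lemma Lfun_measurable f : f \in L2 -> measurable_fun setT f.
Proof. by rewrite inE => /andP[]; rewrite inE. Qed.

Lemma Lfun2D f h : f \in L2 -> h \in L2 -> (fun w => f w + h w) \in L2.
Proof. exact: (Lfun_addr_closed P (lee1n 2)).2. Qed.

Lemma Lfun2Z (a : R) f : f \in L2 -> (fun w => a * f w) \in L2.
Proof.
move=> f2; have -> : (fun w => a * f w) = a \o* f by apply/funext => w /=; rewrite mulrC.
by apply: Lfun_scale => //; rewrite ler1n.
Qed.

Lemma Lfun2_comb (I : Type) (r : seq I) (a : I -> R) (F : I -> Omega -> R) :
  (forall i, F i \in L2) -> (fun w => \sum_(i <- r) a i * F i w) \in L2.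
Proof.
move=> hF; elim: r => [|i r IH].
  rewrite (_ : (fun w => _) = cst 0); first exact: Lfun_cst.
  by apply/funext => w; rewrite big_nil.
rewrite (_ : (fun w => _) = (fun w => a i * F i w + \sum_(i <- r) a i * F i w)).
  by apply: Lfun2D => //; exact: Lfun2Z.
by apply/funext => w; rewrite big_cons.
Qed.

Lemma Lfun2_integ f h : f \in L2 -> h \in L2 -> integ (fun w => f w * h w).
Proof. by move=> f2 h2; apply/Lfun1_integrable; exact: Lfun2_mul_Lfun1. Qed.

Lemma Lfun2_integ1 f : f \in L2 -> integ f.
Proof.
move=> f2; have := Lfun2_integ f2 (Lfun_cst P 1 2).
by congr (integrable _ _ _); apply/funext => w /=; rewrite mulr1.
Qed.

Lemma integ_sum (I : Type) (r : seq I) (F : I -> Omega -> R) :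
  (forall i, integ (F i)) -> integ (fun w => \sum_(i <- r) F i w).
Proof.
move=> hF; elim: r => [|i r IH].
  rewrite (_ : _ \o _ = cst 0%E); first exact: integrable0.
  by apply/funext => w; rewrite /= big_nil.
rewrite (_ : _ \o _ = (EFin \o F i) \+ (EFin \o (fun w => \sum_(i <- r) F i w))).
  exact: integrableD.
by apply/funext => w; rewrite /= big_cons.
Qed.

Lemma Ex_sum (I : Type) (r : seq I) (F : I -> Omega -> R) :
  (forall i, integ (F i)) -> Ex (fun w => \sum_(i <- r) F i w) = \sum_(i <- r) Ex (F i).
Proof.
move=> hF; elim: r => [|i r IH].
  rewrite big_nil -[RHS](mul0r (fine (P setT))) -Rintegral_cst//.
  by congr Rintegral; apply/funext => w; rewrite big_nil.
rewrite big_cons -IH -RintegralD//; last exact: integ_sum.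
by congr Rintegral; apply/funext => w; rewrite big_cons.
Qed.

Lemma ExZ (a : R) f : integ f -> Ex (fun w => a * f w) = a * Ex f.
Proof. by move=> hf; rewrite RintegralZl. Qed.

Lemma integZ (a : R) f : integ f -> integ (fun w => a * f w).
Proof.
move=> hf; rewrite (_ : _ \o _ = (fun w => a%:E * (EFin \o f) w)%E); first exact: integrableZl.
by apply/funext.
Qed.

Lemma integD f h : integ f -> integ h -> integ (fun w => f w + h w).
Proof.
move=> hf hh; rewrite (_ : _ \o _ = (EFin \o f) \+ (EFin \o h)); first exact: integrableD.
by apply/funext.
Qed.

Lemma integB f h : integ f -> integ h -> integ (fun w => f w - h w).
Proof.
move=> hf hh; have := integD hf (integZ (-1) hh).
by congr (integrable _ _ _); apply/funext => w /=; rewrite mulN1r.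
Qed.

Lemma integ_norm f : integ f -> integ (fun w => `|f w|).
Proof. exact: integrable_norm. Qed.

Lemma le_Ex f h : integ f -> integ h -> (forall w, f w <= h w) -> Ex f <= Ex h.
Proof. by move=> mf mh fh; apply: le_Rintegral. Qed.

Lemma ExE f : integ f -> (\int[P]_w (f w)%:E = (Ex f)%:E)%E.
Proof. by move=> hf; rewrite /Rintegral fineK// integrable_fin_num. Qed.

Lemma integP f : measurable_fun setT f -> (\int[P]_w `|f w|%:E < +oo)%E -> integ f.
Proof. by move=> mf hf; apply/integrableP; split => //; exact/measurable_EFinP. Qed.

Lemma integ_le f h : measurable_fun setT f -> integ h -> (forall w, `|f w| <= h w) -> integ f.
Proof.
move=> mf hh fh; apply: (le_integrable measurableT _ _ hh).
  exact/measurable_EFinP.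
by move=> w _ /=; rewrite lee_fin (le_trans (fh w))// ler_norm.
Qed.

End SquareIntegrable.

Section VectorL2.
Context d (Omega : measurableType d) {R : realType} (P : probability Omega R).
Local Notation Ex f := (Rintegral P setT f).
Local Notation integ f := (P.-integrable setT (EFin \o (f : Omega -> R))).

Definition norm_measurable (Z : normedModType R) (f : Omega -> Z) :=
  measurable_fun setT (fun w => `|f w|).

Section One.
Variable Z : normedModType R.
Implicit Types f h : Omega -> Z.

Lemma L2norm_ge0 f : (0 <= L2norm P f)%E.
Proof. exact: Lnorm_ge0. Qed.

Lemma L2norm_sqr f : (L2norm P f `^ 2 = \int[P]_w (`|f w| ^+ 2)%:E)%E.
Proof.
rewrite /L2norm poweR_Lnorm//; apply: eq_integral => w _ /=.
by rewrite powR_mulrn// normr_id.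
Qed.

Lemma L2normE f : (L2norm P f = (\int[P]_w (`|f w| ^+ 2)%:E) `^ (2^-1))%E.
Proof. by rewrite -L2norm_sqr -poweRrM mulfV// poweRe1// L2norm_ge0. Qed.

Lemma L2norm_leP f (C : R) : 0 <= C ->
  (L2norm P f <= C%:E)%E <-> (\int[P]_w (`|f w| ^+ 2)%:E <= (C ^+ 2)%:E)%E.
Proof.
move=> C0; have i0 : (0 <= \int[P]_w (`|f w| ^+ 2)%:E)%E.
  by apply: integral_ge0 => w _; rewrite lee_fin exprn_ge0.
split=> h.
  rewrite -L2norm_sqr -[(C ^+ 2)%:E](_ : (C%:E `^ 2)%E = _); last first.
    by rewrite poweR_EFin powR_mulrn.
  by rewrite gt0_ler_poweR// in_itv/= leey ?L2norm_ge0// lee_fin C0.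
rewrite L2normE -[C%:E](_ : ((C ^+ 2)%:E `^ 2^-1)%E = _); last first.
  by rewrite poweR_EFin -powR_mulrn// -powRrM mulfV// powRr1.
by rewrite gt0_ler_poweR ?invr_gt0// in_itv/= leey ?i0// lee_fin exprn_ge0.
Qed.

Lemma L2norm_sqr_fin f : (L2norm P f < +oo)%E ->
  (\int[P]_w (`|f w| ^+ 2)%:E = (fine (L2norm P f) ^+ 2)%:E)%E.
Proof.
move=> hf; rewrite -L2norm_sqr -[in LHS](@fineK _ (L2norm P f)).
  by rewrite poweR_EFin powR_mulrn// fine_ge0// L2norm_ge0.
by rewrite ge0_fin_numE// L2norm_ge0.
Qed.

Lemma norm_Lfun2 f : norm_measurable f -> (L2norm P f < +oo)%E ->
  (fun w => `|f w|) \in Lfun P 2%:E.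
Proof.
move=> mf hf; apply: Lfun2P => //.
by rewrite L2norm_sqr_fin// ltry.
Qed.

Lemma L2norm_eq0 (a : Omega -> Z) : (forall w, a w = 0) -> L2norm P a = 0%E.
Proof.
move=> a0; apply/eqP; rewrite eq_le L2norm_ge0 andbT; apply/L2norm_leP => //.
under eq_integral do rewrite a0 normr0 expr0n.
by rewrite integral0 lee_fin expr0n.
Qed.

End One.

Lemma L2norm_mono (Z1 Z2 : normedModType R) (f : Omega -> Z1) (h : Omega -> Z2) :
  norm_measurable f -> norm_measurable h -> (forall w, `|f w| <= `|h w|) ->
  (L2norm P f <= L2norm P h)%E.
Proof.
move=> mf mh fh; rewrite !L2normE gt0_ler_poweR ?invr_gt0//.
- by rewrite in_itv/= leey andbT; apply: integral_ge0 => w _; rewrite lee_fin exprn_ge0.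
- by rewrite in_itv/= leey andbT; apply: integral_ge0 => w _; rewrite lee_fin exprn_ge0.
- apply: ge0_le_integral => //.
  + by apply/measurable_EFinP; exact: measurable_funX.
  + by apply/measurable_EFinP; exact: measurable_funX.
  + by move=> w _; rewrite lee_fin lerXn2r ?nnegrE.
Qed.

Lemma L2normD (Z : normedModType R) (f h : Omega -> Z) :
  norm_measurable f -> norm_measurable h -> norm_measurable (fun w => f w + h w) ->
  (L2norm P (fun w => f w + h w)%R <= L2norm P f + L2norm P h)%E.
Proof.
move=> mf mh mfh.
have m2 : (L2norm P (fun w => f w + h w)%R <= L2norm P (fun w => (`|f w| + `|h w|)%R : R))%E.
  apply: L2norm_mono => //.
    by rewrite /norm_measurable; apply: measurableT_comp => //; exact: measurable_funD.
  by move=> w; rewrite (le_trans (ler_normD _ _))// ler_norm.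
apply: (le_trans m2).
have -> : L2norm P (fun w => (`|f w| + `|h w|)%R : R) =
    ('N[P]_2%:E[EFin \o ((fun w => `|f w|%R) \+ (fun w => `|h w|%R))%R])%E.
  by apply: eq_Lnorm => w /=; rewrite ger0_norm// addr_ge0.
by apply: minkowski_EFin => //; rewrite ler1n.
Qed.

Lemma L2normZ (Z : normedModType R) (a : R) (f : Omega -> Z) :
  norm_measurable f ->
  (L2norm P (fun w => a *: f w) = `|a|%:E * L2norm P f)%E.
Proof.
move=> mf; rewrite !L2normE.
have -> : (\int[P]_w (`|a *: f w| ^+ 2)%:E = (`|a| ^+ 2)%:E * \int[P]_w (`|f w| ^+ 2)%:E)%E.
  under eq_integral do rewrite normrZ exprMn EFinM.
  rewrite ge0_integralZl_EFin ?exprn_ge0//; last first.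
    by apply/measurable_EFinP; exact: measurable_funX.
rewrite poweRM ?lee_fin ?exprn_ge0//; last first.
  by apply: integral_ge0 => w _; rewrite lee_fin exprn_ge0.
by rewrite poweR_EFin -powR_mulrn// -powRrM mulfV// powRr1.
Qed.

Lemma L2_holder (Z1 Z2 : normedModType R) (f : Omega -> Z1) (h : Omega -> Z2) :
  norm_measurable f -> norm_measurable h ->
  (\int[P]_w (`|f w| * `|h w|)%:E <= L2norm P f * L2norm P h)%E.
Proof.
move=> mf mh.
have h2 : (2^-1 + 2^-1 = 1 :> R)%R by lra.
have := @hoelder _ _ _ P (fun w => `|f w|) (fun w => `|h w|) 2 2 mf mh (ltr0Sn _ _) (ltr0Sn _ _) h2.
rewrite Lnorm1; congr (_ <= _)%E; apply: eq_integral => w _ /=.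
by rewrite ger0_norm// mulr_ge0.
Qed.

Lemma L2_pairing (Z1 Z2 : normedModType R) (f : Omega -> Z1) (h : Omega -> Z2) (k : Omega -> R) :
  norm_measurable f -> norm_measurable h ->
  (L2norm P f < +oo)%E -> (L2norm P h < +oo)%E ->
  measurable_fun setT k -> (forall w, `|k w| <= `|f w| * `|h w|) ->
  integ k /\ `|Ex k| <= fine (L2norm P f) * fine (L2norm P h).
Proof.
move=> mf mh f2 h2 mk kfh.
have f0 := L2norm_ge0 f; have h0 := L2norm_ge0 h.
have le2 : (\int[P]_w `|k w|%:E <= (fine (L2norm P f) * fine (L2norm P h))%:E)%E.
  rewrite EFinM !fineK ?ge0_fin_numE//; apply: le_trans (L2_holder mf mh).
  apply: ge0_le_integral => //.
  - by apply/measurable_EFinP; apply: measurableT_comp.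
  - by apply/measurable_EFinP; apply: measurable_funM.
  - by move=> w _; rewrite lee_fin.
have ik : integ k by apply: integP => //; apply: le_lt_trans le2 _; rewrite ltry.
split=> //; apply: (le_trans (le_normr_Rintegral _ _)) => //.
rewrite -lee_fin -ExE//.
by apply: integP => //; [apply: measurableT_comp|under eq_integral do rewrite normr_id; apply: le_lt_trans le2 _; rewrite ltry].
Qed.

End VectorL2.

(** * Strong measurability through finitely valued maps *)

Section StrongMeasurability.
Context d (Omega : measurableType d) {R : realType}.

(** [simple_function] for an arbitrary target type, so that pairs and maps into finite types are
    covered and sums and products of simple functions come from [finite_valued_pair]. *)
Definition finite_valued (T : Type) (s : Omega -> T) : Prop :=
  finite_set (range s) /\ forall z, measurable (s @^-1` [set z]).

Lemma finite_valued_preimage (T : Type) (s : Omega -> T) (A : set T) :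
  finite_valued s -> measurable (s @^-1` A).
Proof.
move=> [fs ms].
have -> : s @^-1` A = \bigcup_(z in range s `&` A) (s @^-1` [set z]).
  apply/seteqP; split=> [w Aw|w [z [_ Az] /= ->]//].
  by exists (s w).
apply: fin_bigcup_measurable => //.
by apply: sub_finite_set fs; exact: subIsetl.
Qed.

Lemma finite_valued_comp (T U : Type) (s : Omega -> T) (h : T -> U) :
  finite_valued s -> finite_valued (h \o s).
Proof.
move=> fs; split; last by move=> u; exact: (finite_valued_preimage (h @^-1` [set u]) fs).
rewrite (_ : range (h \o s) = h @` range s); first exact: finite_image fs.1.
by rewrite image_comp.
Qed.

Lemma finite_valued_pair (T U : Type) (s : Omega -> T) (r : Omega -> U) :
  finite_valued s -> finite_valued r -> finite_valued (fun w => (s w, r w)).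
Proof.
move=> [fs ms] [fr mr]; split.
  apply: (@sub_finite_set _ _ (range s `*` range r)); last exact: finite_setX.
  by move=> _ [w _ <-]; split; exists w.
move=> [z u]; rewrite (_ : _ @^-1` _ = (s @^-1` [set z]) `&` (r @^-1` [set u])).
  exact: measurableI.
by apply/seteqP; split=> [w [/= -> ->]//|w [/= -> ->]].
Qed.

Lemma finite_valued_fin (I : finType) (kappa : Omega -> I) :
  (forall k, measurable (kappa @^-1` [set k])) -> finite_valued kappa.
Proof. by move=> mk; split => //; exact: finite_finset. Qed.

Lemma finite_valued_sfun (f : {sfun Omega >-> R}) : finite_valued f.
Proof. by split=> [|z]; [exact: fimfunP|exact: measurable_sfunP]. Qed.

Section Banach.
Variable Z : normedModType R.
Implicit Types f h : Omega -> Z.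

Lemma strongly_measurable_cvg (s : nat -> Omega -> Z) f :
  (forall n, finite_valued (s n)) -> (forall w, s n w @[n --> \oo] --> f w) ->
  strongly_measurable f.
Proof. by move=> fs sf; exists s; split. Qed.

Lemma finite_valued_strongly_measurable f : finite_valued f -> strongly_measurable f.
Proof. by move=> ff; apply: (@strongly_measurable_cvg (fun=> f)) => // w; exact: cvg_cst. Qed.

Lemma strongly_measurable_continuous (k : Z -> R) f :
  continuous k -> strongly_measurable f -> measurable_fun setT (k \o f).
Proof.
move=> ck [s [fs sf]]; apply: (@measurable_fun_cvg _ _ _ _ (fun n => k \o s n)).
  by move=> n _ A mA; rewrite setTI; exact: (finite_valued_preimage (k @^-1` A) (fs n)).
move=> w _; apply: (continuous_cvg _ _ (sf w)); exact: ck.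
Qed.

Lemma strongly_measurable_norm f : strongly_measurable f -> norm_measurable f.
Proof. exact: (strongly_measurable_continuous (@norm_continuous _ Z)). Qed.

Lemma dual_continuous (F : dual Z) : continuous (F : Z -> R).
Proof.
move=> x; apply/cvgrPdist_le => /= e e0.
have F1 : 0 < `|F| + 1 by rewrite ltr_wpDl.
have : \forall y \near x, `|x - y| <= e / (`|F| + 1).
  by apply: cvgr_dist_le; rewrite ?divr_gt0.
apply: filterS => y xy; rewrite -dualB (le_trans (dual_le F _))//.
rewrite (le_trans (ler_wpM2l (normr_ge0 F) xy))// mulrCA ler_piMr ?ltW//.
by rewrite ltr_pdivrMr// mul1r ltrDl.
Qed.

Lemma strongly_measurable_dual (F : dual Z) f :
  strongly_measurable f -> measurable_fun setT (fun w => F (f w) : R).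
Proof. exact: (strongly_measurable_continuous (@dual_continuous F)). Qed.

Lemma strongly_measurableD f h : strongly_measurable f -> strongly_measurable h ->
  strongly_measurable (fun w => f w + h w).
Proof.
move=> [s [fs sf]] [r [fr rh]].
apply: (@strongly_measurable_cvg (fun n w => s n w + r n w)).
  move=> n; have := finite_valued_comp (fun p : Z * Z => p.1 + p.2)
    (finite_valued_pair (fs n) (fr n)); exact.
by move=> w; exact: cvgD.
Qed.

Lemma strongly_measurableZ (a : Omega -> R) f :
  measurable_fun setT a -> strongly_measurable f ->
  strongly_measurable (fun w => a w *: f w).
Proof.
move=> ma [s [fs sf]].
have mEa : measurable_fun setT (EFin \o a) by exact/measurable_EFinP.
have [b ba] := approximation_sfun measurableT mEa.
apply: (@strongly_measurable_cvg (fun n w => b n w *: s n w)).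
  move=> n; have := finite_valued_comp (fun p : R * Z => p.1 *: p.2)
    (finite_valued_pair (finite_valued_sfun (b n)) (fs n)); exact.
move=> w; apply: cvgZ => //.
by have /fine_cvg := ba w I.
Qed.

Lemma strongly_measurable_cst (z : Z) : strongly_measurable (fun _ : Omega => z).
Proof.
apply: finite_valued_strongly_measurable.
split=> [|y]; first by apply: (@sub_finite_set _ _ [set z]) => // _ [w _ <-].
by rewrite preimage_cst; case: ifP.
Qed.

Lemma strongly_measurable_sum (I : Type) (r : seq I) (f : I -> Omega -> Z) :
  (forall i, strongly_measurable (f i)) ->
  strongly_measurable (fun w => \sum_(i <- r) f i w).
Proof.
move=> mf; elim: r => [|i r IH].
  rewrite (_ : (fun w => _) = (fun=> 0)); first exact: strongly_measurable_cst.
  by apply/funext => w; rewrite big_nil.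
rewrite (_ : (fun w => _) = (fun w => f i w + \sum_(i <- r) f i w)).
  exact: strongly_measurableD.
by apply/funext => w; rewrite big_cons.
Qed.

Lemma strongly_measurableB f h : strongly_measurable f -> strongly_measurable h ->
  strongly_measurable (fun w => f w - h w).
Proof.
move=> mf mh.
have := strongly_measurableD mf (strongly_measurableZ (measurable_cst (-1 : R)) mh).
by congr strongly_measurable; apply/funext => w; rewrite scaleN1r.
Qed.

End Banach.
End StrongMeasurability.

Lemma cvg_sum_seq {R : realType} (Z : normedModType R) (I : Type) (r : seq I)
    (f : nat -> I -> Z) (l : I -> Z) : (forall i, f n i @[n --> \oo] --> l i) ->
  (\sum_(i <- r) f n i) @[n --> \oo] --> \sum_(i <- r) l i.
Proof.
move=> fl; elim: r => [|i r IH].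
  rewrite big_nil (_ : (fun n => _) = cst 0); first exact: cvg_cst.
  by apply/funext => n; rewrite big_nil.
rewrite big_cons (_ : (fun n => _) = (fun n => f n i + \sum_(j <- r) f n j)).
  by apply: cvgD.
by apply/funext => n; rewrite big_cons.
Qed.

Lemma dual_separates {R : realType} (Z : normedModType R) (x y : Z) :
  (forall F : dual Z, F x = F y) -> x = y.
Proof.
move=> h; apply/eqP; rewrite -subr_eq0 -normr_le0.
have [F [_ <-]] := norming_functional (x - y).
by rewrite dualB h subrr.
Qed.

(** * Bochner integrals tested by functionals *)

Section Bochner.
Context d (Omega : measurableType d) {R : realType} (P : probability Omega R).
Variable Z : normedModType R.
Local Notation Ex f := (Rintegral P setT f).
Local Notation integ f := (P.-integrable setT (EFin \o (f : Omega -> R))).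

Lemma dual_simple_integral (F : dual Z) (s : Omega -> Z) : simple_function s ->
  integ (fun w => F (s w)) /\ F (simple_integral P s) = Ex (fun w => F (s w)).
Proof.
move=> [fs ms].
have sE w : F (s w) = \sum_(z <- fset_set (range s)) F z * \1_(s @^-1` [set z]) w.
  rewrite (bigD1_seq (s w))/= ?fset_uniq//; last first.
    by rewrite in_fset_set// inE; exists w.
  rewrite indicE mem_set// mulr1 big1 ?addr0// => z zs.
  by rewrite indicE memNset ?mulr0// => /= /esym/eqP; rewrite (negPf zs).
have ii z : integ (fun w => F z * \1_(s @^-1` [set z]) w).
  by apply: integZ; exact: integrable_indic.
have -> : (fun w => F (s w) : R) = (fun w => \sum_(z <- fset_set (range s)) F z * \1_(s @^-1` [set z]) w).
  by apply/funext => w; exact: sE.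
split; first exact: integ_sum.
rewrite Ex_sum// /simple_integral fsbig_finite//= dual_sum; apply: eq_bigr => z _.
rewrite dualZ ExZ; last exact: integrable_indic.
by rewrite mulrC /Rintegral integral_indic// setIT.
Qed.

(** Functionals pass to the limit that defines the integral, because $|F(s_n-f)|\le\|F\|\|s_n-f\|$.
    Since they separate points, the integral is then unique. *)
Lemma is_bochner_dual (f : Omega -> Z) (y : Z) (F : dual Z) :
  is_bochner_integral P f y ->
  integ (fun w => F (f w)) /\ F y = Ex (fun w => F (f w)).
Proof.
move=> [mf [s [fs is_ sf sy]]].
have mFf := strongly_measurable_dual F mf.
have ms n : strongly_measurable (s n).
  exact: (finite_valued_strongly_measurable (fs n)).
have mN n : measurable_fun setT (fun w => `|s n w - f w|).
  by apply: strongly_measurable_norm; exact: strongly_measurableB.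
have inear : \forall n \near \oo, integ (fun w => `|s n w - f w|).
  have /fine_cvgP[h _] := sf; apply: filterS h => n hn.
  apply: integP => //; under eq_integral do rewrite normr_id.
  by rewrite -ge0_fin_numE//; apply: integral_ge0.
have [N0 _ hN0] := inear.
have iF : integ (fun w => F (f w)).
  have [iFs _] := dual_simple_integral F (fs N0).
  have iN := hN0 N0 (leqnn N0).
  apply: (@integ_le _ _ _ _ _ (fun w => `|F (s N0 w)| + `|F| * `|s N0 w - f w|)) => //.
    by apply: integD; [exact: integ_norm|exact: integZ].
  move=> w; rewrite -[f w](subKr (s N0 w)) dualB (le_trans (ler_normB _ _))//.
  by rewrite lerD2l subKr dual_le.
split=> //.
have c1 : F (simple_integral P (s n)) @[n --> \oo] --> F y.
  by apply: (continuous_cvg _ _ sy); exact: dual_continuous.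
have c2 : F (simple_integral P (s n)) @[n --> \oo] --> Ex (fun w => F (f w)).
  apply/cvgrPdist_le => /= e e0.
  have F1 : 0 < `|F| + 1 by rewrite ltr_wpDl.
  have /fine_cvgP[_ /cvgrPdist_le /(_ (e / (`|F| + 1)))] := sf.
  rewrite divr_gt0// => /(_ isT) hclose.
  near=> n.
  have iN : integ (fun w => `|s n w - f w|) by near: n.
  have [iFs ->] := dual_simple_integral F (fs n).
  rewrite -RintegralB//.
  have iB : integ (fun w => F (f w) - F (s n w)) by exact: integB.
  rewrite (le_trans (le_normr_Rintegral _ _))//.
  apply: (@le_trans _ _ (Ex (fun w => `|F| * `|s n w - f w|))).
    apply: le_Ex; [exact: integrable_norm|exact: integZ|].
    by move=> w; rewrite distrC -dualB dual_le.
  rewrite ExZ//.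
  apply: (@le_trans _ _ (`|F| * (e / (`|F| + 1)))).
    rewrite ler_wpM2l//.
    have : `|0 - fine (\int[P]_t `|s n t - f t|%:E)%E| <= e / (`|F| + 1) by near: n.
    by rewrite sub0r normrN => /(le_trans (ler_norm _)).
  by rewrite mulrCA ler_piMr ?ltW// ltr_pdivrMr// mul1r ltrDl.
exact: (cvg_unique _ c1 c2).
Unshelve. all: by end_near. Qed.

Lemma bochner_integralE (f : Omega -> Z) (y : Z) :
  is_bochner_integral P f y -> bochner_integral P f = y.
Proof.
move=> fy; rewrite /bochner_integral; apply: xget_unique => // z fz.
by apply: dual_separates => F; rewrite (is_bochner_dual F fz).2 (is_bochner_dual F fy).2.
Qed.

(** The second case contains the default value of [bochner_integral]. Keeping it as an alternative
    replaces an existence theorem: in the proof of K-convexity, indices with integral 0 are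
    dropped. *)
Lemma bochner_integral_dual (f : Omega -> Z) (F : dual Z) :
  (F (bochner_integral P f) = Ex (fun w => F (f w)) /\ integ (fun w => F (f w)))
  \/ bochner_integral P f = 0.
Proof.
rewrite /bochner_integral; case: xgetP => [y -> fy|_]; last by right.
by have [iF ->] := is_bochner_dual F fy; left.
Qed.

Lemma bochner_integral_finite (I : finType) (kappa : Omega -> I) (u : I -> Z) (a : Omega -> R) :
  (forall k, measurable (kappa @^-1` [set k])) -> integ a ->
  bochner_integral P (fun w => a w *: u (kappa w)) =
  \sum_k Ex (fun w => a w * \1_(kappa @^-1` [set k]) w) *: u k.
Proof.
move=> mk ia; apply: bochner_integralE.
have ma : measurable_fun setT a by apply/measurable_EFinP; exact: (measurable_int P).
have fvk := finite_valued_fin mk.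
split.
  apply: strongly_measurableZ => //; apply: finite_valued_strongly_measurable.
  exact: finite_valued_comp.
(* Only the scalar factor is approximated; the factor [u (kappa w)] already takes finitely many
   values. *)
have [b [ib _ bcv]] := approximation_sfun_integrable measurableT ia.
have fvs n : finite_valued (fun w => b n w *: u (kappa w)).
  have := finite_valued_comp (fun p : R * I => p.1 *: u p.2)
    (finite_valued_pair (finite_valued_sfun (b n)) fvk); exact.
exists (fun n w => b n w *: u (kappa w)).
pose M := \sum_k `|u k|.
have uM k : `|u k| <= M by rewrite /M (bigD1 k)//= lerDl sumr_ge0.
have M0 : 0 <= M by rewrite sumr_ge0.
have mb n : measurable_fun setT (b n) by exact: measurable_funPT.
split; first exact: fvs.
- move=> n; apply: (@le_lt_trans _ _ (\int[P]_t (M * `|b n t|)%:E)%E).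
    apply: ge0_le_integral => //.
    + by apply/measurable_EFinP; apply: strongly_measurable_norm; exact: finite_valued_strongly_measurable.
    + by apply/measurable_EFinP; apply: measurable_funM => //; apply: measurableT_comp.
    + by move=> w _; rewrite lee_fin normrZ mulrC ler_wpM2r.
  have : integ (fun t => M * `|b n t|) by apply: integZ; exact: integrable_norm.
  by move=> h; rewrite ExE// ltry.
- have bcv' : (M%:E * \int[P]_t `|a t - b n t|%:E)%E @[n --> \oo] --> 0%E.
    by rewrite -[X in _ --> X](mule0 M%:E); apply: cvgeZl.
  apply: (squeeze_cvge _ _ bcv'); last exact: cvg_cst.
  apply: nearW => n; apply/andP; split; first exact: integral_ge0.
  rewrite -ge0_integralZl_EFin//; last first.
    by apply/measurable_EFinP; apply: measurableT_comp => //; exact: measurable_funB.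
  apply: ge0_le_integral => //.
  + apply/measurable_EFinP; apply: strongly_measurable_norm; apply: strongly_measurableB.
      exact: finite_valued_strongly_measurable.
    apply: strongly_measurableZ => //; apply: finite_valued_strongly_measurable.
    exact: finite_valued_comp.
  + apply/measurable_EFinP; apply: measurable_funM => //; apply: measurableT_comp => //.
    exact: measurable_funB.
  + by move=> w _; rewrite -scalerBl normrZ lee_fin mulrC distrC ler_wpM2r.
- have iind (c : Omega -> R) k : integ c -> integ (fun w => c w * \1_(kappa @^-1` [set k]) w).
    move=> ic; apply: (@integ_le _ _ _ _ _ (fun w => `|c w|)).
    + apply: measurable_funM; last exact: measurable_indic.
      by apply/measurable_EFinP; exact: (measurable_int P).
    + exact: integrable_norm.
    + by move=> w; rewrite normrM ler_piMr// indicE ger0_norm// lern1 leq_b1.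
  have -> : (fun n => simple_integral P (fun w => b n w *: u (kappa w))) =
      (fun n => \sum_k Ex (fun w => b n w * \1_(kappa @^-1` [set k]) w) *: u k).
    apply/funext => n; apply: dual_separates => F.
    rewrite (dual_simple_integral F (fvs n)).2 dual_sum.
    transitivity (\sum_k Ex (fun w => F (u k) * (b n w * \1_(kappa @^-1` [set k]) w))); last first.
      by apply: eq_bigr => k _; rewrite dualZ mulrC ExZ//; exact: iind (ib n).
    rewrite -Ex_sum; last by move=> k; apply: integZ; exact: iind (ib n).
    congr Rintegral; apply/funext => w; rewrite dualZ (bigD1 (kappa w))//= indicE mem_set//.
    rewrite mulr1 mulrC big1 ?addr0// => k kk; rewrite indicE memNset ?mulr0//.
    by move=> /= kE; rewrite kE eqxx in kk.
  apply: cvg_sum_seq => k; apply: cvgZl.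
  apply/cvgrPdist_le => /= e e0.
  have /fine_cvgP[h1 /cvgrPdist_le /(_ e e0) h2] := bcv.
  near=> n.
  rewrite -RintegralB//; [|exact: iind ia|exact: iind (ib n)].
  have iab : integ (fun w => a w - b n w) by apply: integB => //; exact: ib.
  have iab' : integ (fun w => (a w - b n w) * \1_(kappa @^-1` [set k]) w) by exact: iind.
  have -> : (fun w => a w * \1_(kappa @^-1` [set k]) w - b n w * \1_(kappa @^-1` [set k]) w) =
      (fun w => (a w - b n w) * \1_(kappa @^-1` [set k]) w).
    by apply/funext => w; rewrite mulrBl.
  rewrite (le_trans (le_normr_Rintegral _ _))//.
  apply: (@le_trans _ _ (Ex (fun w => `|a w - b n w|))).
    apply: le_Ex; [exact: integrable_norm|exact: integrable_norm|].
    by move=> w; rewrite normrM ler_piMr// indicE ger0_norm// lern1 leq_b1.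
  have : `|0 - fine (\int[P]_z `|a z - b n z|%:E)%E| <= e by near: n.
  by rewrite sub0r normrN => /(le_trans (ler_norm _)).
Unshelve. all: by end_near. Qed.

End Bochner.

(** * Gaussian sums *)

Section GaussianScalars.
Context d (Omega : measurableType d) {R : realType} {P : probability Omega R}.
Variable g : nat -> {RV P >-> R}.
Hypotheses (g_gauss : standard_gaussian g) (g_indep : independent g).
Local Notation Ex f := (Rintegral P setT f).
Local Notation integ f := (P.-integrable setT (EFin \o (f : Omega -> R))).

Lemma gaussian_same_law j (h : R -> R) : measurable_fun setT h -> (forall x, 0 <= h x) ->
  (\int[P]_w (h (g j w))%:E = \int[P]_w (h (g 0 w))%:E)%E.
Proof.
move=> mh h0.
have e k : (\int[P]_w (h (g k w))%:E = \int[distribution P (g k)]_y (h y)%:E)%E.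
  by rewrite ge0_integral_distribution//; exact/measurable_EFinP.
rewrite !e; apply: eq_measure_integral => A mA _; by transitivity (normal_prob 0 1 A); [exact: g_gauss|symmetry; exact: g_gauss].
Qed.

Lemma integral_cst1 : (\int[P]_w (cst 1%E w) = 1)%E.
Proof. by rewrite integral_cst//= mul1e; exact: probability_setT. Qed.

Lemma Ex_cst1 : Ex (fun _ => 1) = 1.
Proof. by rewrite /Rintegral [X in fine X]integral_cst1. Qed.

Lemma gaussian_integ j : integ (g j).
Proof. exact: Lfun2_integ1 (gaussian_Lfun2 g_gauss j). Qed.

Lemma gaussian_measurable j : measurable_fun setT (g j).
Proof. exact: measurable_funPT. Qed.

Lemma gaussian_exp_integ j s : integ (fun w => expR (s * g j w)).
Proof.
apply: integP.
  by apply: measurableT_comp => //; apply: measurable_funM => //; exact: gaussian_measurable.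
under eq_integral do rewrite ger0_norm ?expR_ge0//.
by rewrite gaussian_mgf// ltry.
Qed.

Lemma expR_small (u : R) : 0 <= u -> u <= 1 / 2 -> expR u <= 1 + 2 * u.
Proof.
move=> u0 u2; have h : 1 - u <= expR (- u) by exact: expR_ge1Dx.
have eu : expR u * expR (- u) = 1 by rewrite -expRD subrr expR0.
have e0 := expR_gt0 u; nra.
Qed.

(** From $1+sg\le e^{sg}$ and the exponential moments, $sE(g)\le e^{s^2/2}-1\le s^2$ for $|s|\le1$;
    small [s] of either sign force the mean to vanish. *)
Lemma gaussian_mean j : Ex (g j) = 0.
Proof.
have main s : `|s| <= 1 -> s * Ex (g j) <= s ^+ 2.
  move=> s1.
  have ic1 : integ (fun _ : Omega => 1) by exact: Lfun2_integ1 (Lfun_cst P 1 2).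
  have h : Ex (fun w => 1 + s * g j w) <= Ex (fun w => expR (s * g j w)).
    apply: le_Ex; [|exact: gaussian_exp_integ|by move=> w; exact: expR_ge1Dx].
    by apply: integD => //; apply: integZ; exact: gaussian_integ.
  rewrite RintegralD// in h; last by apply: integZ; exact: gaussian_integ.
  rewrite ExZ in h; last exact: gaussian_integ.
  rewrite [X in X + _ <= _](_ : _ = 1) in h; last first.
    exact: Ex_cst1.
  rewrite [X in _ <= X](_ : _ = expR (s ^+ 2 / 2)) in h; last first.
    by rewrite /Rintegral gaussian_mgf.
  have s2 : s ^+ 2 <= 1 by rewrite -(real_normK (num_real s)) exprn_ile1.
  have s20 : 0 <= s ^+ 2 by exact: sqr_ge0.
  have h2 : expR (s ^+ 2 / 2) <= 1 + 2 * (s ^+ 2 / 2).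
    by apply: expR_small; lra.
  by move: h h2; lra.
apply/eqP; rewrite eq_le; apply/andP; split.
  rewrite leNgt; apply/negP => m0.
  have s0 : 0 < Num.min 1 (Ex (g j) / 2) by rewrite lt_min ltr01 divr_gt0.
  have := main (Num.min 1 (Ex (g j) / 2)); rewrite gtr0_norm// ge_min lexx => /(_ isT).
  rewrite expr2 ler_pM2l// le_min => /andP[_]; lra.
rewrite leNgt; apply/negP => m0.
have s0 : 0 < Num.min 1 (- Ex (g j) / 2) by rewrite lt_min ltr01 divr_gt0// oppr_gt0.
have := main (- Num.min 1 (- Ex (g j) / 2)); rewrite normrN gtr0_norm// ge_min lexx => /(_ isT).
rewrite sqrrN mulNr -mulrN expr2 ler_pM2l// le_min => /andP[_]; lra.
Qed.

(** The variance is kept as a symbol: the estimates use that it is positive and the same for all the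
    variables. *)
Definition sigma2 : R := Ex (fun w => g 0 w ^+ 2).

Lemma gaussian_sqr_integ j : integ (fun w => g j w ^+ 2).
Proof. exact: Lfun2_integrable_sqr (gaussian_Lfun2 g_gauss j). Qed.

Lemma gaussian_variance j : Ex (fun w => g j w ^+ 2) = sigma2.
Proof.
rewrite /sigma2 /Rintegral (@gaussian_same_law j (fun x => x ^+ 2))//.
by move=> x; rewrite sqr_ge0.
Qed.

Lemma gaussian_abs_mean j : Ex (fun w => `|g j w|) = Ex (fun w => `|g 0 w|).
Proof. by rewrite /Rintegral (@gaussian_same_law j (fun x => `|x|)). Qed.

(** If the mean were 0, then $g_0=0$ a.e. and $E(e^{g_0})=1$, against $e^{1/2}>1$. *)
Lemma gaussian_abs_mean_gt0 : 0 < Ex (fun w => `|g 0 w|).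
Proof.
have i0 : 0 <= Ex (fun w => `|g 0 w|) by apply: Rintegral_ge0.
rewrite lt_neqAle i0 andbT eq_sym; apply/negP => /eqP e0.
have : (\int[P]_w `|(EFin \o g 0) w| = 0)%E.
  transitivity (\int[P]_w (`|g 0 w|)%:E)%E; first by apply: eq_integral.
  by rewrite ExE ?e0//; apply: integ_norm; exact: gaussian_integ.
move/(ae_eq_integral_abs P measurableT) => /(_ _)[].
  by apply/measurable_EFinP; exact: gaussian_measurable.
move=> N [mN N0 hN].
have := gaussian_mgf g_gauss 0 1.
have -> : (\int[P]_w (expR (1 * g 0 w))%:E = \int[P]_w (cst 1%E w))%E.
  apply: ge0_ae_eq_integral => //.
  - by apply/measurable_EFinP; apply: measurableT_comp => //; apply: measurable_funM => //; exact: gaussian_measurable.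
  - exists N; split=> // w /= hw; apply: hN => /= h0; apply: hw => _.
    by have := h0 I => -[->]; rewrite mulr0 expR0.
rewrite integral_cst1 => -[].
have := expR_ge1Dx (1 ^+ 2 / 2 : R); rewrite expr1n => h1 h2; move: h1; rewrite -h2; lra.
Qed.

(** Integrate $c|g|-c^2/2\le g^2/2$, where [c] is the mean of $|g|$; the result is that the variance
    is at least $c^2$. *)
Lemma sigma2_gt0 : 0 < sigma2.
Proof.
have c0 := gaussian_abs_mean_gt0.
set c := Ex (fun w => `|g 0 w|) in c0.
have ic1 : integ (fun _ : Omega => 1) by exact: Lfun2_integ1 (Lfun_cst P 1 2).
have ig := integ_norm (gaussian_integ 0).
have h : Ex (fun w => c * `|g 0 w| + (- (c ^+ 2 / 2) * 1)) <= Ex (fun w => g 0 w ^+ 2 * (1 / 2)).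
  apply: le_Ex.
  - by apply: integD; [exact: integZ|exact: integZ].
  - have := integZ (1 / 2) (gaussian_sqr_integ 0).
    by congr (integrable _ _ _); apply/funext => w /=; rewrite mulrC.
  - move=> w; rewrite -(real_normK (num_real (g 0 w))).
    have := sqr_ge0 (`|g 0 w| - c); lra.
rewrite RintegralD// in h; [|exact: integZ|exact: integZ].
rewrite !ExZ// -/c RintegralZr// -/sigma2 in h; last exact: gaussian_sqr_integ.
rewrite [X in _ + _ * X <= _](_ : _ = 1) in h; last exact: Ex_cst1.
have : 0 < c ^+ 2 by rewrite exprn_gt0.
by move: h; rewrite expr2; lra.
Qed.

Lemma independent_two i j (h1 h2 : R -> R) (m1 m2 : R) : i != j ->
  measurable_fun setT h1 -> measurable_fun setT h2 ->
  (forall x, 0 <= h1 x) -> (forall x, 0 <= h2 x) ->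
  (\int[P]_w (h1 (g i w))%:E = m1%:E)%E -> (\int[P]_w (h2 (g j w))%:E = m2%:E)%E ->
  (\int[P]_w (h1 (g i w) * h2 (g j w))%:E = (m1 * m2)%:E)%E.
Proof.
move=> ij mh1 mh2 h10 h20 e1 e2.
pose f k := if k == i then h1 else if k == j then h2 else cst 1.
pose m k := if k == i then m1 else if k == j then m2 else 1.
pose N := (maxn i j).+1.
have iN : (i < N)%N by rewrite ltnS leq_maxl.
have jN : (j < N)%N by rewrite ltnS leq_maxr.
have prodE (F : nat -> R) : (forall k, k != i -> k != j -> F k = 1) ->
    \prod_(k < N) F k = F i * F j.
  move=> F1; rewrite (bigD1 (Ordinal iN))//= (bigD1 (Ordinal jN))/=; last first.
    by rewrite -val_eqE/= eq_sym.
  by rewrite big1 ?mulr1// => k /andP[ki kj]; apply: F1.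
have := @independent_prod _ _ _ _ g g_indep N f m.
rewrite [\prod_(k < N) m k]prodE; last first.
  by move=> k /negPf ki /negPf kj; rewrite /m ki kj.
rewrite /m eqxx (eq_sym j) (negPf ij) eqxx => <-.
- apply: eq_integral => w _; congr EFin.
  rewrite (prodE (fun k => f k (g k w))); last first.
    by move=> k /negPf ki /negPf kj; rewrite /f ki kj.
  by rewrite /f eqxx (eq_sym j) (negPf ij) eqxx.
- by move=> k; rewrite /f; case: ifP => // _; case: ifP.
- by move=> k x; rewrite /f; case: ifP => // _; case: ifP.
- move=> k; rewrite /f /m; case: ifP => [/eqP->//|_]; case: ifP => [/eqP->//|_].
  exact: integral_cst1.
Qed.

(** Products of independent variables are available for nonnegative functions only, so both
    variables are split into positive and negative parts. The two parts have equal means, and the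
    four products cancel. *)
Lemma gaussian_orthogonal i j : i != j -> Ex (fun w => g i w * g j w) = 0.
Proof.
move=> ij.
pose p (x : R) := Num.max x 0; pose n (x : R) := Num.max (- x) 0.
have mp : measurable_fun setT p by apply: measurable_maxr.
have mn : measurable_fun setT n by apply: measurable_maxr.
have p0 x : 0 <= p x by rewrite le_max lexx orbT.
have n0 x : 0 <= n x by rewrite le_max lexx orbT.
have pn x : x = p x - n x.
  rewrite /p /n; have [x0|x0] := leP 0 x.
    by rewrite max_r ?oppr_le0// subr0.
  by rewrite max_l ?oppr_ge0 ?ltW// sub0r opprK.
have px x : p x <= `|x| by rewrite ge_max ler_norm normr_ge0.
have nx x : n x <= `|x| by rewrite ge_max -normrN ler_norm normr_ge0.
have L2h (h : R -> R) k : measurable_fun setT h -> (forall x, 0 <= h x) ->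
    (forall x, h x <= `|x|) -> (fun w => h (g k w)) \in Lfun P 2%:E.
  move=> mh h0 hx; have mhg : measurable_fun setT (fun w => h (g k w)).
    by apply: measurableT_comp => //; exact: gaussian_measurable.
  apply: Lfun2P => //; apply: le_lt_trans (gaussian_sqr_lty g_gauss k).
  apply: ge0_le_integral => //.
  - by move=> w _; rewrite lee_fin sqr_ge0.
  - by apply/measurable_EFinP; exact: measurable_funX.
  - by apply/measurable_EFinP; apply: measurable_funX; exact: gaussian_measurable.
  - move=> w _; rewrite lee_fin -(real_normK (num_real (g k w))).
    by rewrite lerXn2r ?nnegrE.
have prodE (h1 h2 : R -> R) : measurable_fun setT h1 -> measurable_fun setT h2 ->
    (forall x, 0 <= h1 x) -> (forall x, 0 <= h2 x) ->
    (forall x, h1 x <= `|x|) -> (forall x, h2 x <= `|x|) ->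
    integ (fun w => h1 (g i w) * h2 (g j w)) /\
    Ex (fun w => h1 (g i w) * h2 (g j w)) = Ex (fun w => h1 (g i w)) * Ex (fun w => h2 (g j w)).
  move=> m1 m2 h10 h20 h1x h2x.
  have i1 := L2h h1 i m1 h10 h1x; have i2 := L2h h2 j m2 h20 h2x.
  split; first exact: Lfun2_integ.
  apply: EFin_inj; rewrite -ExE; last exact: Lfun2_integ.
  by apply: independent_two => //; rewrite ExE//; exact: Lfun2_integ1.
have mean0 k : Ex (fun w => p (g k w)) = Ex (fun w => n (g k w)).
  apply/eqP; rewrite -subr_eq0 -RintegralB//; last 2 first.
  - exact: Lfun2_integ1 (L2h p k mp p0 px).
  - exact: Lfun2_integ1 (L2h n k mn n0 nx).
  rewrite -[X in _ == X](gaussian_mean k); apply/eqP; congr Rintegral.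
  by apply/funext => w; rewrite [RHS]pn.
have [ipp Epp] := prodE p p mp mp p0 p0 px px.
have [ipn Epn] := prodE p n mp mn p0 n0 px nx.
have [inp Enp] := prodE n p mn mp n0 p0 nx px.
have [inn Enn] := prodE n n mn mn n0 n0 nx nx.
have -> : (fun w => g i w * g j w) = (fun w => (p (g i w) * p (g j w) - p (g i w) * n (g j w))
     - (n (g i w) * p (g j w) - n (g i w) * n (g j w))).
  apply/funext => w; rewrite {1}(pn (g i w)) {1}(pn (g j w)); ring.
rewrite RintegralB//; [|exact: integB|exact: integB].
by rewrite !RintegralB// Epp Epn Enp Enn !mean0 !subrr.
Qed.

Lemma gaussian_covariance i j : Ex (fun w => g i w * g j w) = (i == j)%:R * sigma2.
Proof.
have [<-|ij] := eqVneq i j; last by rewrite gaussian_orthogonal// mul0r.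
by rewrite mul1r -(gaussian_variance i); congr Rintegral; apply/funext => w; rewrite expr2.
Qed.

End GaussianScalars.

Section GaussianSums.
Context d (Omega : measurableType d) {R : realType} {P : probability Omega R}.
Variable g : nat -> {RV P >-> R}.
Hypotheses (g_gauss : standard_gaussian g) (g_indep : independent g).
Local Notation Ex f := (Rintegral P setT f).
Local Notation integ f := (P.-integrable setT (EFin \o (f : Omega -> R))).
Local Notation sigma2 := (sigma2 g).

Definition gsum (Z : normedModType R) (N : nat) (t : nat -> Z) (w : Omega) : Z :=
  \sum_(j < N) g j w *: t j.

(** The l-norm of the operator with $e_j\mapsto t_j$ for $j<N$; the entries from [N] on are
    ignored. *)
Definition gnorm (Z : normedModType R) (N : nat) (t : nat -> Z) : R :=
  fine (L2norm P (gsum N t)).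

Section OneSpace.
Variable Z : normedModType R.
Implicit Types (t u : nat -> Z).

Lemma gsum_strongly_measurable N t : strongly_measurable (gsum N t).
Proof.
apply: strongly_measurable_sum => j; apply: strongly_measurableZ.
  exact: gaussian_measurable.
exact: strongly_measurable_cst.
Qed.

Lemma gsum_norm_measurable N t : norm_measurable (gsum N t).
Proof. exact: strongly_measurable_norm (gsum_strongly_measurable N t). Qed.

Lemma gsum_le N t w : `|gsum N t w| <= \sum_(j < N) `|t j| * `|g j w|.
Proof.
rewrite (le_trans (ler_norm_sum _ _ _))//; apply: ler_sum => j _.
by rewrite normrZ mulrC.
Qed.

Lemma abs_gaussian_Lfun2 j : (fun w => `|g j w|) \in Lfun P 2%:E.
Proof.
apply: Lfun2P; first by apply: measurableT_comp => //; exact: gaussian_measurable.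
under eq_integral do rewrite real_normK ?num_real//.
exact: gaussian_sqr_lty.
Qed.

Lemma gsum_L2_lty N t : (L2norm P (gsum N t) < +oo)%E.
Proof.
have h2 : (fun w => \sum_(j < N) `|t j| * `|g j w|) \in Lfun P 2%:E.
  exact: (Lfun2_comb (index_enum 'I_N) (fun j : 'I_N => `|t j|)
    (fun j : 'I_N => abs_gaussian_Lfun2 j)).
have mh := Lfun_measurable h2.
apply: (@le_lt_trans _ _ (L2norm P (fun w => (\sum_(j < N) `|t j| * `|g j w| : R)))).
  apply: L2norm_mono => [||w]; first exact: gsum_norm_measurable.
    by apply: measurableT_comp.
  by rewrite (le_trans (gsum_le N t w))// ler_norm.
rewrite L2normE; apply: poweR_lty.
have /integrableP[_] := Lfun2_integrable_sqr h2.
apply: le_lt_trans; apply: ge0_le_integral => //.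
- by apply/measurable_EFinP; apply: measurable_funX; exact: measurableT_comp.
- by apply: measurableT_comp => //; apply/measurable_EFinP; exact: measurable_funX.
- by move=> w _ /=; rewrite real_normK ?num_real// lee_fin ler_norm.
Qed.

Lemma gnormE N t : (L2norm P (gsum N t) = (gnorm N t)%:E)%E.
Proof. by rewrite /gnorm fineK// ge0_fin_numE ?L2norm_ge0// gsum_L2_lty. Qed.

Lemma gnorm_ge0 N t : 0 <= gnorm N t.
Proof. by rewrite fine_ge0// L2norm_ge0. Qed.

Lemma gnormD N t u : gnorm N (fun j => t j + u j) <= gnorm N t + gnorm N u.
Proof.
rewrite -lee_fin EFinD -!gnormE.
have E : gsum N (fun j => t j + u j) = (fun w => gsum N t w + gsum N u w).
  apply/funext => w; rewrite /gsum -big_split/=; apply: eq_bigr => j _.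
  by rewrite scalerDr.
have m := gsum_norm_measurable N (fun j => t j + u j).
rewrite E in m *; by apply: L2normD => //; exact: gsum_norm_measurable.
Qed.

Lemma gnormZ N (a : R) t : gnorm N (fun j => a *: t j) = `|a| * gnorm N t.
Proof.
apply: EFin_inj; rewrite EFinM -!gnormE -L2normZ; last exact: gsum_norm_measurable.
congr (L2norm P _); apply/funext => w; rewrite /gsum scaler_sumr.
by apply: eq_bigr => j _; rewrite !scalerA mulrC.
Qed.

Lemma gnorm_le_sum N t (e : R) : 0 <= e -> (forall j, (j < N)%N -> `|t j| <= e) ->
  gnorm N t <= e * (N%:R * Num.sqrt sigma2).
Proof.
move=> e0 te; elim: N te => [|N IH] te.
  rewrite mul0r mulr0 /gnorm L2norm_eq0//= => w.
  by rewrite /gsum big_ord0.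
have e1 : gnorm N.+1 t <= gnorm N t + `|t N| * Num.sqrt sigma2.
  rewrite -lee_fin EFinD -!gnormE.
  have E : gsum N.+1 t = (fun w => gsum N t w + g N w *: t N).
    by apply/funext => w; rewrite /gsum big_ord_recr.
  have sN : strongly_measurable (fun w => g N w *: t N).
    by apply: strongly_measurableZ; [exact: gaussian_measurable|exact: strongly_measurable_cst].
  have m := strongly_measurable_norm (strongly_measurableD (gsum_strongly_measurable N t) sN).
  have eL : L2norm P (gsum N.+1 t) = L2norm P (fun w => gsum N t w + g N w *: t N) by congr L2norm.
  have hD := L2normD P (gsum_norm_measurable N t) (strongly_measurable_norm sN) m.
  rewrite eL; apply: (le_trans hD).
  rewrite leeD2l//; apply/L2norm_leP; first by rewrite mulr_ge0 ?sqrtr_ge0.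
  under eq_integral do rewrite normrZ mulrC exprMn real_normK ?num_real// EFinM.
  rewrite ge0_integralZl_EFin ?exprn_ge0//; last 2 first.
  - by move=> w _; rewrite lee_fin sqr_ge0.
  - by apply/measurable_EFinP; apply: measurable_funX; exact: gaussian_measurable.
  rewrite ExE ?gaussian_variance//; last exact: gaussian_sqr_integ.
  by rewrite -EFinM lee_fin exprMn sqr_sqrtr// ltW// sigma2_gt0.
apply: (le_trans e1); rewrite -natr1 mulrDl mulrDr mul1r lerD//.
  by apply: IH => j jN; apply: te; rewrite ltnS ltnW.
by rewrite ler_wpM2r ?sqrtr_ge0// te.
Qed.

Lemma gnorm_perturb N t u (e : R) : 0 <= e -> (forall j, (j < N)%N -> `|t j - u j| <= e) ->
  gnorm N t <= gnorm N u + e * (N%:R * Num.sqrt sigma2).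
Proof.
move=> e0 te.
have -> : gnorm N t = gnorm N (fun j => u j + (t j - u j)).
  by congr gnorm; apply/funext => j; rewrite addrC subrK.
by rewrite (le_trans (gnormD _ _ _))// lerD2l gnorm_le_sum.
Qed.

Lemma gaussian_dual_integ (F : dual Z) f j : strongly_measurable f -> (L2norm P f < +oo)%E ->
  integ (fun w => g j w * F (f w)).
Proof.
move=> mf f2.
have h2 : (fun w => F (f w) : R) \in Lfun P 2%:E.
  apply: Lfun2P; first exact: strongly_measurable_dual.
  have hn := norm_Lfun2 (strongly_measurable_norm mf) f2.
  have /integrableP[_] := Lfun2_integrable_sqr (Lfun2Z `|F| hn).
  apply: le_lt_trans; apply: ge0_le_integral => //.
  - by move=> w _; rewrite lee_fin sqr_ge0.
  - by apply/measurable_EFinP; apply: measurable_funX; exact: strongly_measurable_dual.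
  - apply: measurableT_comp => //; apply/measurable_EFinP; apply: measurable_funX.
    by apply: measurable_funM => //; exact: strongly_measurable_norm.
  - move=> w _ /=; rewrite lee_fin [leRHS]ger0_norm ?sqr_ge0//.
    rewrite -(real_normK (num_real (F (f w) : R))) lerXn2r ?nnegrE ?mulr_ge0//.
    exact: dual_le.
exact: Lfun2_integ (gaussian_Lfun2 g_gauss j) h2.
Qed.

Lemma gaussian_gsum_dual (F : dual Z) N t j :
  Ex (fun w => g j w * F (gsum N t w)) = (j < N)%:R * (sigma2 * F (t j)).
Proof.
have -> : (fun w => g j w * F (gsum N t w)) = (fun w => \sum_(i < N) F (t i) * (g j w * g i w)).
  apply/funext => w; rewrite /gsum dual_sum mulr_sumr; apply: eq_bigr => i _.
  by rewrite dualZ mulrA mulrC.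
have ii (i : 'I_N) : integ (fun w => g j w * g i w).
  exact: Lfun2_integ (gaussian_Lfun2 g_gauss j) (gaussian_Lfun2 g_gauss i).
rewrite Ex_sum; last by move=> i; exact: integZ.
under eq_bigr do rewrite ExZ// gaussian_covariance//.
have [jN|jN] := ltnP j N.
  rewrite (bigD1 (Ordinal jN))//= eqxx mul1r big1 ?addr0; first by rewrite mul1r mulrC.
  by move=> i; rewrite -val_eqE/= eq_sym => /negPf ->; rewrite mul0r mulr0.
rewrite mul0r big1// => i _; rewrite gtn_eqF ?mul0r ?mulr0//.
exact: leq_trans (ltn_ord i) jN.
Qed.

End OneSpace.

(** The sum is the expectation of the functional [gsum N phi w] applied to [f w], so the
    Cauchy-Schwarz inequality for the two norms applies. *)
Lemma gnorm_pairing (Z : normedModType R) N (phi : nat -> dual Z) (f : Omega -> Z) :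
  strongly_measurable f -> (L2norm P f < +oo)%E ->
  \sum_(j < N) Ex (fun w => g j w * phi j (f w)) <= gnorm N phi * fine (L2norm P f).
Proof.
move=> mf f2.
pose k w : R := \sum_(j < N) g j w * phi j (f w).
have kE w : k w = gsum N phi w (f w).
  by rewrite /gsum sumfE; apply: eq_bigr => j _.
have mk : measurable_fun setT k.
  apply: measurable_sum => j; apply: measurable_funM; first exact: gaussian_measurable.
  exact: strongly_measurable_dual.
have [ik] := L2_pairing (gsum_norm_measurable N phi) (strongly_measurable_norm mf)
    (gsum_L2_lty N phi) f2 mk (fun w => eq_ind_r (fun x => `|x| <= _) (dual_le _ _) (kE w)).
rewrite Ex_sum; first exact: le_trans (ler_norm _).
by move=> j; exact: gaussian_dual_integ.
Qed.

Lemma gnorm_duality (Z : normedModType R) N (phi : nat -> dual Z) (t : nat -> Z) :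
  sigma2 * (\sum_(j < N) phi j (t j)) <= gnorm N phi * gnorm N t.
Proof.
have := gnorm_pairing N phi (gsum_strongly_measurable N t) (gsum_L2_lty N t).
apply: le_trans; rewrite mulr_sumr; apply: ler_sum => j _.
by rewrite gaussian_gsum_dual ltn_ord mul1r.
Qed.

End GaussianSums.

(** * Gaussian series and the l-norm *)

Section RieszFischer.
Context d (Omega : measurableType d) {R : realType} (P : probability Omega R).

Lemma L1_le_L2 (h : Omega -> R) (e : R) : 0 < e -> measurable_fun setT h ->
  (\int[P]_w (h w ^+ 2)%:E <= (e ^+ 2)%:E)%E -> (\int[P]_w `|h w|%:E <= e%:E)%E.
Proof.
move=> e0 mh he.
have h2 : (L2norm P (h : Omega -> R^o) <= e%:E)%E.
  apply/L2norm_leP; first exact: ltW.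
  by under eq_integral do rewrite real_normK ?num_real//.
have one2 : (L2norm P (fun _ : Omega => 1%R : R^o) <= 1%:E)%E.
  apply/L2norm_leP => //; under eq_integral do rewrite normr1.
  by rewrite !expr1n [leLHS]integral_cst1.
have := @L2_holder _ _ _ P R^o R^o h (fun _ => 1).
move=> /(_ (measurableT_comp (@normr_measurable _ _) mh)).
move=> /(_ (measurable_cst _)); under eq_integral do rewrite normr1 mulr1.
move=> /le_trans; apply; rewrite -[e%:E]mule1; apply: lee_pmul => //; exact: L2norm_ge0.
Qed.

(** Completeness of $L_2$ with the rate kept and with a limit defined everywhere. A rapidly
    convergent subsequence converges a.e., and Fatou's lemma carries the Cauchy bound [tau n] over
    to the limit. *)
Lemma Riesz_Fischer (f : nat -> Omega -> R) (tau : nat -> R) :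
  (forall n, measurable_fun setT (f n)) ->
  (forall n m, (n <= m)%N -> (\int[P]_w ((f m w - f n w) ^+ 2)%:E <= (tau n)%:E)%E) ->
  (forall e, 0 < e -> exists N, forall n, (N <= n)%N -> tau n <= e) ->
  exists2 G : Omega -> R, measurable_fun setT G &
    forall n, (\int[P]_w ((f n w - G w) ^+ 2)%:E <= (tau n)%:E)%E.
Proof.
move=> mf htau tau0.
pose c k : R := ((2 ^ k.+1)%:R)^-1.
have c0 k : 0 < c k by rewrite invr_gt0 ltr0n expn_gt0.
have /choice[N hN] : forall k, exists N, forall n, (N <= n)%N -> tau n <= c k ^+ 2.
  by move=> k; apply: tau0; rewrite exprn_gt0.
pose phi k := (\sum_(i < k.+1) (N i).+1)%N.
have phiS k : phi k.+1 = (phi k + (N k.+1).+1)%N by rewrite /phi big_ord_recr.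
have phi_mono a b : (a <= b)%N -> (phi a <= phi b)%N.
  by move=> /subnKC <-; elim: (b - a)%N => [|k IH]; rewrite ?addn0// addnS phiS (leq_trans IH)// leq_addr.
have phiN k : (N k <= phi k)%N.
  by rewrite /phi big_ord_recr/=; exact: leq_trans (leqnSn _) (leq_addl _ _).
have phik k : (k <= phi k)%N.
  by elim: k => // k IH; rewrite phiS addnS ltnS (leq_trans IH)// leq_addr.
pose D k w := f (phi k.+1) w - f (phi k) w.
have mD k : measurable_fun setT (D k) by exact: measurable_funB.
have mnD k : measurable_fun setT (fun w => (`|D k w|)%:E).
  by apply/measurable_EFinP; exact: measurableT_comp.
have iD k : (\int[P]_w `|D k w|%:E <= (c k)%:E)%E.
  apply: L1_le_L2 => //; apply: (le_trans (htau _ _ (phi_mono _ _ (leqnSn k)))).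
  by rewrite lee_fin; exact: hN (phiN k).
pose h w := (\sum_(0 <= k <oo) (`|D k w|)%:E)%E.
have h0 w : (0 <= h w)%E by apply: nneseries_ge0 => k _ _; rewrite lee_fin.
have mh : measurable_fun setT h.
  by apply: ge0_emeasurable_sum => // k x _ _; rewrite lee_fin.
have ih : P.-integrable setT h.
  apply/integrableP; split=> //; under eq_integral do rewrite gee0_abs//.
  rewrite /h integral_nneseries//.
  apply: (@le_lt_trans _ _ 1%:E); last exact: ltry.
  apply: le_trans (epsilon_trick0 xpredT ler01).
  apply: lee_nneseries => [k _ _|k _]; first exact: integral_ge0.
  by rewrite div1r; exact: iD.
pose B := [set w | (h w < +oo)%E].
have mB : measurable B by rewrite -[B]setTI; exact: emeasurable_fun_infty_o.
have cvB w : B w -> cvgn (fun k => f (phi k) w : R^o).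
  move=> Bw; have cs : cvgn (series (fun k => D k w : R^o)).
    apply: normed_cvg; apply: nondecreasing_is_cvgn.
      by apply: nondecreasing_series => k _ _; exact: normr_ge0.
    exists (fine (h w)) => _ [n _ <-]; rewrite -lee_fin fineK ?ge0_fin_numE//.
    by rewrite /series/= -sumEFin; apply: nneseries_lim_ge => k _ _; rewrite lee_fin.
  have -> : (fun k => f (phi k) w) = (fun k => f (phi 0) w + series (fun k => D k w : R^o) k).
    by apply/funext => k; rewrite /series/= telescope_sumr// addrC subrK.
  by apply: is_cvgD => //; exact: is_cvg_cst.
(* Cutting down to the convergence set [B] makes the limit exist at every point. *)
pose H k w := \1_B w * f (phi k) w.
pose G w := limn (fun k => H k w : R^o).
have cvH w : (fun k => H k w) @ \oo --> G w.
  rewrite /G /H indicE; have [Bw|Bw] := pselect (B w).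
    rewrite mem_set//; under eq_fun do rewrite mul1r.
    by move/cvB: Bw; exact.
  rewrite memNset//; under eq_fun do rewrite mul0r.
  by apply/cvg_ex; exists 0; exact: cvg_cst.
have mH k : measurable_fun setT (H k).
  by apply: measurable_funM => //; exact: measurable_indic.
have mG : measurable_fun setT G.
  by apply: (measurable_fun_cvg mH) => w _; exact: cvH.
exists G => // n.
have aeB : {ae P, forall w, B w}.
  have := integrable_ae measurableT ih; apply: filterS => w /(_ I).
  by rewrite ge0_fin_numE.
(* The shift by [n] puts the index [phi (k + n)] beyond [n], where [htau] applies. *)
pose E k w := ((f n w - H (k + n)%N w) ^+ 2)%:E.
have mE k : measurable_fun setT (E k).
  by apply/measurable_EFinP; apply: measurable_funX; exact: measurable_funB.
have cvE w : (fun k => E k w) @ \oo --> ((f n w - G w) ^+ 2)%:E.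
  apply: cvg_EFin; first by near=> k.
  rewrite (_ : fine \o _ = (fun k => (f n w - H (k + n)%N w) * (f n w - H (k + n)%N w))).
    rewrite expr2; have cvd : (f n w - H (k + n)%N w) @[k --> \oo] --> f n w - G w.
      apply: cvgB; first exact: cvg_cst.
      by have := cvH w; rewrite -(cvg_shiftn n).
    by apply: cvgM; exact: cvd.
  by apply/funext => k; rewrite /= expr2.
have -> : (\int[P]_w ((f n w - G w) ^+ 2)%:E = \int[P]_w limn_einf (fun k => E k w))%E.
  by apply: eq_integral => w _; rewrite (cvg_limn_einf_sup (cvE w)).
apply: le_trans (fatou P measurableT mE _) _.
  by move=> k w _; rewrite lee_fin sqr_ge0.
rewrite limn_einf_lim; apply: lime_le; first exact: is_cvg_einfs.
apply: nearW => m; apply: (@le_trans _ _ (\int[P]_w E m w)%E).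
  by apply: ereal_inf_lbound; exists m => /=.
have -> : (\int[P]_w E m w = \int[P]_w ((f (phi (m + n)%N) w - f n w) ^+ 2)%:E)%E.
  apply: ge0_ae_eq_integral => //.
  - by apply/measurable_EFinP; apply: measurable_funX; exact: measurable_funB.
  - by move=> w _; rewrite lee_fin sqr_ge0.
  - by move=> w _; rewrite lee_fin sqr_ge0.
  - apply: filterS aeB => w Bw _; rewrite /E /H indicE mem_set// mul1r.
    by rewrite -sqrrN opprB.
by apply: htau; apply: leq_trans (phik _); exact: leq_addl.
Unshelve. all: by end_near. Qed.

Lemma L2norm_comb_le (Z : normedModType R) (I : Type) (r : seq I) (h : I -> Omega -> R)
    (u : I -> Z) (c : R) : (forall i, measurable_fun setT (h i)) -> 0 <= c ->
  (forall i, (\int[P]_w (h i w ^+ 2)%:E <= (c ^+ 2)%:E)%E) ->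
  (L2norm P (fun w => (\sum_(i <- r) h i w *: u i)%R) <= (c * \sum_(i <- r) `|u i|)%:E)%E.
Proof.
move=> mh c0 hc.
have sm i : strongly_measurable (fun w => h i w *: u i).
  by apply: strongly_measurableZ => //; exact: strongly_measurable_cst.
have sms s : strongly_measurable (fun w => \sum_(i <- s) h i w *: u i).
  by apply: strongly_measurable_sum.
elim: r => [|i r IH].
  rewrite big_nil mulr0 L2norm_eq0// => w; by rewrite big_nil.
rewrite big_cons mulrDr EFinD.
have := L2normD P (strongly_measurable_norm (sm i)) (strongly_measurable_norm (sms r))
   (strongly_measurable_norm (strongly_measurableD (sm i) (sms r))).
have -> : (fun w => h i w *: u i + \sum_(j <- r) h j w *: u j) =
    (fun w => \sum_(j <- i :: r) h j w *: u j).
  by apply/funext => w; rewrite big_cons.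
move=> /le_trans; apply; apply: leeD => //.
apply/L2norm_leP; first by rewrite mulr_ge0.
under eq_integral do rewrite normrZ mulrC exprMn real_normK ?num_real// EFinM.
rewrite ge0_integralZl_EFin ?exprn_ge0//; last 2 first.
- by move=> w _; rewrite lee_fin sqr_ge0.
- by apply/measurable_EFinP; exact: measurable_funX.
by rewrite exprMn [X in (_ <= X%:E)%E]mulrC EFinM; apply: (@lee_wpmul2l _ _ _ _ _ (hc i)); rewrite lee_fin sqr_ge0.
Qed.

End RieszFischer.

Section GaussianSeries.
Context d (Omega : measurableType d) {R : realType} {P : probability Omega R}.
Variable g : nat -> {RV P >-> R}.
Hypotheses (g_gauss : standard_gaussian g) (g_indep : independent g).
Local Notation Ex f := (Rintegral P setT f).
Local Notation integ f := (P.-integrable setT (EFin \o (f : Omega -> R))).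
Local Notation sigma2 := (sigma2 g).
Local Notation gsum := (gsum g).
Local Notation gnorm := (gnorm g).

Lemma gaussian_comb_sqr N (b : nat -> R) :
  (\int[P]_w ((\sum_(j < N) b j * g j w) ^+ 2)%:E = (sigma2 * \sum_(j < N) b j ^+ 2)%:E)%E.
Proof.
have ii (i j : 'I_N) : integ (fun w => g i w * g j w).
  exact: Lfun2_integ (gaussian_Lfun2 g_gauss i) (gaussian_Lfun2 g_gauss j).
have iS (i : 'I_N) : integ (fun w => \sum_(j < N) b i * b j * (g i w * g j w)).
  by apply: integ_sum => j; exact: integZ.
have E : (fun w => (\sum_(j < N) b j * g j w) ^+ 2) =
    (fun w => \sum_(i < N) \sum_(j < N) b i * b j * (g i w * g j w)).
  apply/funext => w; rewrite expr2 mulr_suml; apply: eq_bigr => i _.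
  by rewrite mulr_sumr; apply: eq_bigr => j _; rewrite mulrACA.
rewrite ExE E; last by apply: integ_sum.
rewrite Ex_sum//; congr EFin; rewrite mulr_sumr; apply: eq_bigr => i _.
rewrite Ex_sum; last by move=> j; exact: integZ.
rewrite (bigD1 i)//= ExZ// gaussian_covariance// eqxx mul1r big1 ?addr0; last first.
  move=> j ji; rewrite ExZ// gaussian_covariance//.
  by rewrite val_eqE eq_sym (negPf ji) mul0r mulr0.
by rewrite mulrC expr2.
Qed.

Lemma gaussian_series (a : nat -> R) (C : R) : (forall N, \sum_(j < N) a j ^+ 2 <= C) ->
  exists2 G : Omega -> R, measurable_fun setT G &
    forall e, 0 < e -> exists N0, forall N, (N0 <= N)%N ->
      (\int[P]_w ((\sum_(j < N) a j * g j w - G w) ^+ 2)%:E <= e%:E)%E.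
Proof.
move=> aC; pose s N := \sum_(j < N) a j ^+ 2.
have s_mono n m : (n <= m)%N -> s n <= s m.
  move=> nm; rewrite -(subnKC nm) /s big_split_ord/= lerDl sumr_ge0// => i _.
  exact: sqr_ge0.
have cs : cvgn s.
  apply: nondecreasing_is_cvgn => //.
  by exists C => _ [N _ <-]; exact: aC.
have s20 := ltW (sigma2_gt0 g_gauss).
have [||e e0|G mG hG] := @Riesz_Fischer _ _ _ P (fun N w => \sum_(j < N) a j * g j w)
    (fun N => sigma2 * (limn s - s N)).
- move=> N; by apply: measurable_sum => j; exact: measurable_funM.
- move=> n m nm; pose b j := if (n <= j)%N then a j else 0.
  have -> : (fun w => ((\sum_(j < m) a j * g j w - \sum_(j < n) a j * g j w) ^+ 2)%:E) =
      (fun w => ((\sum_(j < m) b j * g j w) ^+ 2)%:E).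
    apply/funext => w; congr (_ ^+ 2)%:E; rewrite -(subnKC nm) !big_split_ord/=.
    rewrite [X in _ = X + _]big1 => [|j _]; last by rewrite /b leqNgt ltn_ord mul0r.
    rewrite add0r addrAC subrr add0r; apply: eq_bigr => j _.
    by rewrite /b leq_addr.
  rewrite gaussian_comb_sqr lee_fin ler_wpM2l//.
  rewrite (le_trans _ (lerB (nondecreasing_cvgn_le s_mono cs m) (lexx _)))//.
  rewrite /s -(subnKC nm) !big_split_ord/= [X in X + _ <= _]big1 => [|j _]; last first.
    by rewrite /b leqNgt ltn_ord expr0n.
  rewrite add0r addrAC subrr add0r ler_sum// => j _.
  by rewrite /b leq_addr.
- have e1 : 0 < e / sigma2 by rewrite divr_gt0// sigma2_gt0.
  have /cvgrPdist_le/(_ _ e1)[N0 _ hN] := cs.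
  exists N0 => n N0n; rewrite mulrC -ler_pdivlMr ?sigma2_gt0//.
  exact: le_trans (ler_norm _) (hN _ N0n).
exists G => // e e0; have e1 : 0 < e / sigma2 by rewrite divr_gt0// sigma2_gt0.
have /cvgrPdist_le/(_ _ e1)[N0 _ hN] := cs.
exists N0 => n N0n; apply: (le_trans (hG n)).
rewrite lee_fin mulrC -ler_pdivlMr ?sigma2_gt0//.
exact: le_trans (ler_norm _) (hN _ N0n).
Qed.

Section EllNorm.
Variables (Z : normedModType R) (T : bop (@ell2 R) Z).
Local Notation Te := (fun j => T (ell2_unit j)).

(** A finite rank operator splits the series into finitely many scalar Gaussian series, with
    coefficients $\psi_i(e_j)$ that are square summable by [dual_unit_le]. *)
Lemma gaussian_sum_ex : finite_rank T -> exists F : Omega -> Z, in_L2 P F /\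
  forall e, 0 < e -> exists N0, forall N, (N0 <= N)%N ->
    (L2norm P (fun w => (gsum N Te w - F w)%R) <= e%:E)%E.
Proof.
move=> /finite_rank_expansion[n [psi [u Tu]]].
have /choice[G hG] : forall i : 'I_n, exists G : Omega -> R, measurable_fun setT G /\
    forall e, 0 < e -> exists N0, forall N, (N0 <= N)%N ->
      (\int[P]_w ((\sum_(j < N) psi i (ell2_unit j) * g j w - G w) ^+ 2)%:E <= e%:E)%E.
  move=> i; have [|G mG hG] := @gaussian_series (fun j => psi i (ell2_unit j)) (`|psi i| ^+ 2).
    by move=> N; exact: dual_unit_le.
  by exists G.
pose F w := \sum_(i < n) G i w *: u i.
have mF : strongly_measurable F.
  apply: strongly_measurable_sum => i; apply: strongly_measurableZ; first by case: (hG i).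
  exact: strongly_measurable_cst.
have FE N w : gsum N Te w - F w =
    \sum_(i < n) (\sum_(j < N) psi i (ell2_unit j) * g j w - G i w) *: u i.
  rewrite /gsum /F; under eq_bigr do rewrite Tu scaler_sumr.
  rewrite exchange_big/= -sumrB; apply: eq_bigr => i _.
  rewrite scalerBl scaler_suml; congr (_ - _); apply: eq_bigr => j _.
  by rewrite scalerA mulrC.
have cvF e : 0 < e -> exists N0, forall N, (N0 <= N)%N ->
    (L2norm P (fun w => (gsum N Te w - F w)%R) <= e%:E)%E.
  move=> e0; pose U := 1 + \sum_(i < n) `|u i|.
  have U0 : 0 < U by rewrite ltr_wpDr// sumr_ge0.
  have e1 : 0 < (e / U) ^+ 2 by rewrite exprn_gt0// divr_gt0.
  have /choice[N0 hN] : forall i : 'I_n, exists N0, forall N, (N0 <= N)%N ->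
      (\int[P]_w ((\sum_(j < N) psi i (ell2_unit j) * g j w - G i w) ^+ 2)%:E
         <= ((e / U) ^+ 2)%:E)%E.
    by move=> i; have [_ /(_ _ e1)] := hG i.
  exists (\max_i N0 i) => N hNN; under eq_fun do rewrite FE.
  have h := @L2norm_comb_le _ _ _ P Z 'I_n (index_enum _)
    (fun i w => \sum_(j < N) psi i (ell2_unit j) * g j w - G i w) u (e / U).
  apply: (le_trans (h _ _ _)).
  - move=> i; apply: measurable_funB; last by case: (hG i).
    by apply: measurable_sum => j; apply: measurable_funM => //; exact: gaussian_measurable.
  - by rewrite divr_ge0// ltW.
  - by move=> i; apply: hN; apply: leq_trans hNN; exact: (@leq_bigmax _ N0 i).
  - by rewrite lee_fin mulrAC ler_pdivrMr// ler_pM2l// lerDr.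
exists F; split=> //; split=> //.
have [N0 /(_ N0 (leqnn _)) hN] := cvF 1 ltr01.
have E : F = (fun w => gsum N0 Te w + (-1) *: (gsum N0 Te w - F w)).
  by apply/funext => w; rewrite scaleN1r opprB addrC subrK.
have m1 := gsum_strongly_measurable g N0 Te.
have m2 : strongly_measurable (fun w => gsum N0 Te w - F w) by exact: strongly_measurableB.
have m3 : strongly_measurable (fun w => (-1) *: (gsum N0 Te w - F w)).
  by apply: strongly_measurableZ => //; exact: measurable_cst.
have := L2normD P (strongly_measurable_norm m1) (strongly_measurable_norm m3)
   (strongly_measurable_norm (strongly_measurableD m1 m3)).
rewrite -E => /le_lt_trans; apply; apply: lte_add_pinfty; first exact: gsum_L2_lty.
rewrite L2normZ; last exact: strongly_measurable_norm.
by rewrite normrN1 mul1e (le_lt_trans hN)// ltry.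
Qed.

Lemma L2norm_cvg0P (f : nat -> Omega -> Z) : (L2norm P (f N) @[N --> \oo] --> 0%E) <->
  forall e, 0 < e -> exists N0, forall N, (N0 <= N)%N -> (L2norm P (f N) <= e%:E)%E.
Proof.
split=> [/fine_cvgP[[N1 _ h1] /cvgrPdist_le h2] e e0|h].
  have [N2 _ hN2] := h2 _ e0.
  exists (maxn N1 N2) => N; rewrite geq_max => /andP[N1N N2N].
  rewrite -[L2norm P _]fineK; last exact: (h1 N N1N).
  by rewrite lee_fin; have := hN2 N N2N; rewrite /= sub0r normrN => /(le_trans (ler_norm _)).
apply/fine_cvgP; split.
  have [N0 hN] := h 1 ltr01; exists N0 => // N N0N.
  by rewrite ge0_fin_numE ?L2norm_ge0// (le_lt_trans (hN N N0N))// ltry.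
apply/cvgrPdist_le => e e0; have [N0 hN] := h e e0; exists N0 => // N N0N /=.
have hf : (L2norm P (f N)) \is a fin_num.
  by rewrite ge0_fin_numE ?L2norm_ge0// (le_lt_trans (hN N N0N))// ltry.
rewrite sub0r normrN ger0_norm ?fine_ge0 ?L2norm_ge0//.
by rewrite -lee_fin fineK//; exact: hN.
Qed.

Lemma L2norm_triangle (a b : Omega -> Z) : strongly_measurable a -> strongly_measurable b ->
  (L2norm P a <= L2norm P b + L2norm P (fun w => (a w - b w)%R))%E.
Proof.
move=> ma mb; have mab := strongly_measurableB ma mb.
have := L2normD P (strongly_measurable_norm mb) (strongly_measurable_norm mab)
   (strongly_measurable_norm (strongly_measurableD mb mab)).
by under eq_fun do rewrite addrC subrK.
Qed.

Lemma L2norm_subC (a b : Omega -> Z) : strongly_measurable a -> strongly_measurable b ->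
  L2norm P (fun w => a w - b w) = L2norm P (fun w => b w - a w).
Proof.
move=> ma mb; apply/eqP; rewrite eq_le; apply/andP; split.
  apply: L2norm_mono => [||w]; last by rewrite distrC.
  - by apply: strongly_measurable_norm; exact: strongly_measurableB.
  - by apply: strongly_measurable_norm; exact: strongly_measurableB.
apply: L2norm_mono => [||w]; last by rewrite distrC.
- by apply: strongly_measurable_norm; exact: strongly_measurableB.
- by apply: strongly_measurable_norm; exact: strongly_measurableB.
Qed.

(** Convergence of the series is essential here: the default of [gaussian_sum] is the zero function,
    whose norm bounds nothing. *)
Lemma gnorm_le_ell (e : R) : finite_rank T -> 0 < e ->
  exists N0, forall N, (N0 <= N)%N -> ((gnorm N Te)%:E <= ell_norm g T + e%:E)%E.
Proof.
move=> fT e0; rewrite /ell_norm /gaussian_sum; case: xgetP => [F -> [[mF F2] cF]|nF].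
  have [N0 hN] := (L2norm_cvg0P _).1 cF _ e0.
  exists N0 => N N0N; rewrite -gnormE//.
  apply: le_trans (L2norm_triangle (gsum_strongly_measurable g N Te) mF) _.
  by rewrite leeD2l// hN.
have [F [inF cF]] := gaussian_sum_ex fT.
by exfalso; apply: (nF F); split=> //; apply/L2norm_cvg0P.
Qed.

(** If the series diverges, the default has norm 0 and the bound is trivial. *)
Lemma ell_norm_le (C : R) : 0 <= C ->
  (exists N0, forall N, (N0 <= N)%N -> gnorm N Te <= C) -> (ell_norm g T <= C%:E)%E.
Proof.
move=> C0 [N1 hC]; rewrite /ell_norm /gaussian_sum; case: xgetP => [F -> [[mF F2] cF]|_].
  apply/lee_addgt0Pr => e e0.
  have [N0 hN] := (L2norm_cvg0P _).1 cF _ e0.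
  have mg := gsum_strongly_measurable g (maxn N0 N1) Te.
  apply: le_trans (L2norm_triangle mF mg) _.
  rewrite gnormE// leeD ?lee_fin ?hC ?leq_maxr//.
  by rewrite L2norm_subC//; apply: hN; exact: leq_maxl.
by rewrite L2norm_eq0.
Qed.

End EllNorm.
End GaussianSeries.

(** * Gaussian averages under finite cotype *)

Section FamilyAverages.
Context d (Omega : measurableType d) {R : realType} {P : probability Omega R}.
Variable g : nat -> {RV P >-> R}.
Hypotheses (g_gauss : standard_gaussian g) (g_indep : independent g).
Local Notation Ex f := (Rintegral P setT f).
Local Notation integ f := (P.-integrable setT (EFin \o (f : Omega -> R))).
Local Notation gsum := (gsum g).
Local Notation gnorm := (gnorm g).

Lemma gsum_exchange (V : normedModType R) (I : finType) N (a : I -> nat -> R) (x : I -> V) w :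
  gsum N (fun j => \sum_i a i j *: x i) w = \sum_i (\sum_(j < N) a i j * g j w) *: x i.
Proof.
rewrite /gsum; under eq_bigr do rewrite scaler_sumr.
rewrite exchange_big/=; apply: eq_bigr => i _; rewrite scaler_suml.
by apply: eq_bigr => j _; rewrite scalerA mulrC.
Qed.

Lemma gaussian_comb_mgf_le N (a : nat -> R) (s : R) : \sum_(j < N) a j ^+ 2 <= 1 ->
  (\int[P]_w (expR (s * \sum_(j < N) a j * g j w))%:E <= (expR (s ^+ 2 / 2))%:E)%E.
Proof.
move=> a1; under eq_integral do rewrite mulr_sumr.
under eq_integral do under eq_bigr do rewrite mulrA.
rewrite (gaussian_comb_mgf g_gauss g_indep N (fun j => s * a j)) lee_fin ler_expR.
under eq_bigr do rewrite exprMn -mulrA [_ ^+ 2 / 2]mulrC mulrA.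
by rewrite -mulr_sumr ler_piMr// divr_ge0// sqr_ge0.
Qed.

(** The constant does not see [I], [N] or the matrix: the exponential moments of $\sum_ja_{ij}g_j$
    are at most those of one standard Gaussian, and the mass of [nu] is bounded. The inequality
    $y^2\le1+y^{q+1}$ turns the power into a second moment. *)
Lemma summing_gnorm_le (V : normedModType R) (I : finType) (x : I -> V) (q : nat) (C : R)
    N (a : I -> nat -> R) : (1 < q.+1)%N -> 0 <= C ->
  (forall (n : nat) (f : 'I_n -> I -> R), (forall i, \sum_k `|f k i| <= 1) ->
    \sum_k `|\sum_i f k i *: x i| ^+ q.+1 <= C) ->
  (forall i, \sum_(j < N) a i j ^+ 2 <= 1) ->
  gnorm N (fun j => \sum_i a i j *: x i) <=
    1 + (q.+1%:R * (2 * C) + 1) *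
        (expR (2 * q.+1%:R) * (2 * expR ((2 * q.+1%:R) ^+ 2 / 2))).
Proof.
move=> q1 C0 sumC a1; have [nu [nu0 nu1 hnu]] := Pisier_exponential sumC.
set Q := 2 * q.+1%:R in hnu *; set B := (X in 1 + X).
have B0 : 0 <= B by rewrite !(mulr_ge0, addr_ge0, expR_ge0)// mulr_ge0.
have hB : (\int[P]_w (`|gsum N (fun j => \sum_i a i j *: x i) w| ^+ 2)%:E <= (1 + B)%:E)%E.
  pose h i w := \sum_(j < N) a i j * g j w.
  have mh i : measurable_fun setT (h i) by apply: measurable_sum => j; exact: measurable_funM.
  have me i s : measurable_fun setT (fun w => (expR (s * h i w))%:E).
    apply/measurable_EFinP; apply: measurableT_comp => //; exact: measurable_funM.
  apply: (@le_trans _ _ (\int[P]_w (1%:E + \sum_i (nu i * expR Q)%:E *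
      ((expR (Q * h i w))%:E + (expR (- Q * h i w))%:E)))%E).
    apply: ge0_le_integral => //.
    - by apply/measurable_EFinP; apply: measurable_funX; exact: gsum_norm_measurable.
    - apply: emeasurable_funD => //; apply: emeasurable_sum => i.
      by apply: emeasurable_funM => //; exact: emeasurable_funD.
    - move=> w _; rewrite gsum_exchange.
      have -> : (\sum_i (nu i * expR Q)%:E * ((expR (Q * h i w))%:E + (expR (- Q * h i w))%:E))%E
          = (\sum_i nu i * (expR Q * (expR (Q * h i w) + expR (- Q * h i w))))%:E.
        by rewrite -sumEFin; apply: eq_bigr => i _; rewrite -EFinD -EFinM mulrA.
      rewrite -EFinD lee_fin; apply: le_trans (lerD (lexx 1) (hnu (h^~ w))).
      set y := `|_|; have y0 : 0 <= y by exact: normr_ge0.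
      have [y1|y1] := leP y 1.
        by rewrite (le_trans (exprn_ile1 2 y0 y1))// lerDl exprn_ge0.
      by rewrite (le_trans (ler_weXn2l (ltW y1) q1))// lerDr.
  rewrite ge0_integralD//; last 2 first.
  - move=> w _; apply: sume_ge0 => i _; rewrite -EFinD -EFinM lee_fin.
    by rewrite !(mulr_ge0, addr_ge0, expR_ge0)//.
  - apply: emeasurable_sum => i.
    by apply: emeasurable_funM => //; exact: emeasurable_funD.
  rewrite [X in (X + _)%E]integral_cst1 EFinD leeD2l//.
  rewrite ge0_integral_sum//; last 2 first.
  - by move=> i; apply: emeasurable_funM => //; exact: emeasurable_funD.
  - move=> i w _; rewrite -EFinD -EFinM lee_fin.
    by rewrite !(mulr_ge0, addr_ge0, expR_ge0)//.
  apply: (@le_trans _ _ (\sum_i (nu i * (expR Q * (2 * expR (Q ^+ 2 / 2))))%:E)%E).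
    apply: lee_sum => i _; rewrite ge0_integralZl_EFin//; last 3 first.
    - by move=> w _; rewrite -EFinD lee_fin addr_ge0 ?expR_ge0.
    - exact: emeasurable_funD.
    - by rewrite mulr_ge0 ?expR_ge0.
    rewrite [X in (_ <= X%:E)%E]mulrA [X in (_ <= X)%E]EFinM; apply: lee_wpmul2l.
      by rewrite lee_fin mulr_ge0 ?expR_ge0.
    rewrite ge0_integralD//.
    rewrite mulr_natl mulr2n EFinD; apply: leeD; first exact: gaussian_comb_mgf_le.
    by rewrite -[Q ^+ 2]sqrrN; exact: gaussian_comb_mgf_le.
  by rewrite sumEFin lee_fin -mulr_suml ler_wpM2r// !mulr_ge0 ?expR_ge0.
have B1 : 0 <= 1 + B by rewrite addr_ge0.
rewrite -lee_fin -gnormE//; apply/L2norm_leP => //; apply: (le_trans hB).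
by rewrite lee_fin expr2 ler_peMl// lerDl.
Qed.

(** For all signs the function $\sum_k\pm f_k$ is bounded by 1, so [x] sends it into the unit ball,
    and the Rademacher average is at most 1. *)
Lemma cotype_summing (V : normedModType R) (I : finType) (x : I -> V) (q : nat) (C : R) :
  (forall n (y : 'I_n -> V), \sum_i `|y i| ^+ q.+1 <= C * rademacher_average y ^+ q.+1) ->
  0 <= C -> bounded_family x 1 ->
  forall (n : nat) (f : 'I_n -> I -> R), (forall i, \sum_k `|f k i| <= 1) ->
    \sum_k `|\sum_i f k i *: x i| ^+ q.+1 <= C.
Proof.
move=> cot C0 bx n f f1; apply: le_trans (cot _ _) _; rewrite ler_piMr// exprn_ile1//.
  exact: sqrtr_ge0.
apply: rademacher_average_le => // eps.
rewrite (_ : \sum_(_ < _) _ = \sum_i (\sum_k (-1) ^+ eps k * f k i) *: x i).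
  apply: bx => i; rewrite (le_trans (ler_norm_sum _ _ _))// (le_trans _ (f1 i))//.
  by apply: ler_sum => k _; rewrite normrM normrX normrN1 expr1n mul1r.
under eq_bigr do rewrite scaler_sumr.
rewrite exchange_big/=; apply: eq_bigr => i _; rewrite scaler_suml.
by apply: eq_bigr => k _; rewrite scalerA.
Qed.

(* The contractive matrix [a] plays the operator from l_2 to l_oo^I, the family [x] the
   operator from l_oo^I to V: this bounds the l-norm by gamma_infty. *)
Lemma cotype_family_gnorm (V : normedModType R) : finite_cotype V ->
  exists2 M : R, 0 < M & forall (I : finType) N (a : I -> nat -> R) (x : I -> V) (r c : R),
    0 < r -> 0 < c ->
    (forall i, \sum_(j < N) a i j ^+ 2 <= r ^+ 2) -> bounded_family x c ->
    gnorm N (fun j => \sum_i a i j *: x i) <= M * (r * c).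
Proof.
move=> /finite_cotype_nat[q [C [q1 C0 cot]]].
(* The constant is that of [summing_gnorm_le], filled in by unification; dividing by [r] and [c]
   reduces to the normalized case. *)
eexists; last first.
  move=> I N a x r c r0 c0 ar bx.
  have bx1 : bounded_family (fun i => c^-1 *: x i) 1.
    move=> b b1; have := bx b b1.
    rewrite (_ : \sum_i b i *: (c^-1 *: x i) = c^-1 *: \sum_i b i *: x i).
      by move=> h; rewrite normrZ gtr0_norm ?invr_gt0// mulrC ler_pdivrMr// mul1r.
    by rewrite scaler_sumr; apply: eq_bigr => i _; rewrite !scalerA mulrC.
  have := @summing_gnorm_le V I _ q C N (fun i j => r^-1 * a i j) q1 C0 (cotype_summing cot C0 bx1).
  have a1 i : \sum_(j < N) (r^-1 * a i j) ^+ 2 <= 1.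
    under eq_bigr do rewrite exprMn.
    by rewrite -mulr_sumr exprVn mulrC ler_pdivrMr ?exprn_gt0// mul1r.
  move/(_ a1).
  have -> : (fun j => \sum_i (r^-1 * a i j) *: (c^-1 *: x i)) =
      (fun j => (r * c)^-1 *: \sum_i a i j *: x i).
    apply/funext => j; rewrite scaler_sumr; apply: eq_bigr => i _.
    by rewrite !scalerA invfM; congr (_ *: _); ring.
  rewrite gnormZ// gtr0_norm ?invr_gt0 ?mulr_gt0// [X in X <= _]mulrC ler_pdivrMr ?mulr_gt0//.
  exact.
rewrite ltr_pwDl//.
by rewrite !(mulr_ge0, addr_ge0, expR_ge0)// mulr_ge0.
Qed.

End FamilyAverages.

(** * Norming by simple functions *)

Section Cells.
Context d (Omega : measurableType d) {R : realType} {P : probability Omega R}.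
Variable g : nat -> {RV P >-> R}.
Hypotheses (g_gauss : standard_gaussian g) (g_indep : independent g).
Local Notation Ex f := (Rintegral P setT f).
Local Notation integ f := (P.-integrable setT (EFin \o (f : Omega -> R))).
Local Notation gsum := (gsum g).
Local Notation gnorm := (gnorm g).

Lemma Ex_norm_le_L2norm (Z : normedModType R) (f : Omega -> Z) : norm_measurable f ->
  (L2norm P f < +oo)%E -> Ex (fun w => `|f w|) <= fine (L2norm P f).
Proof.
move=> mf f2.
have one2 : (L2norm P (fun _ : Omega => 1%R : R^o) <= 1%:E)%E.
  apply/L2norm_leP => //; under eq_integral do rewrite normr1.
  by rewrite !expr1n [leLHS]integral_cst1.
have one_lty := le_lt_trans one2 (ltry 1).
have [||_] := @L2_pairing _ _ _ P Z R^o f (fun _ => 1) (fun w => `|f w|) mf _ f2 one_lty mf.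
- exact: measurable_cst.
- by move=> w; rewrite normr1 mulr1 normr_id.
move=> /(le_trans (ler_norm _))/le_trans; apply; rewrite ler_piMr ?fine_ge0 ?L2norm_ge0//.
by rewrite -lee_fin fineK// ge0_fin_numE ?L2norm_ge0.
Qed.

Section OnePartition.
Variables (I : finType) (kappa : Omega -> I).
Hypothesis mkappa : forall k, measurable (kappa @^-1` [set k]).

(** Gaussian coefficient of the indicator of a cell; the function equal to $u_k$ on cell [k] has the
    coefficients $\sum_km_{kj}u_k$. *)
Definition cell_mean (k : I) (j : nat) : R := Ex (fun w => g j w * \1_(kappa @^-1` [set k]) w).

Lemma indic_partition (V : lmodType R) (F : I -> V) w :
  F (kappa w) = \sum_k \1_(kappa @^-1` [set k]) w *: F k.
Proof.
rewrite (bigD1 (kappa w))//= indicE mem_set// scale1r big1 ?addr0// => k kw.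
by rewrite indicE memNset ?scale0r// => /= e; rewrite e eqxx in kw.
Qed.

Lemma strongly_measurable_finite (Z : normedModType R) (u : I -> Z) :
  strongly_measurable (fun w => u (kappa w)).
Proof.
apply: finite_valued_strongly_measurable.
exact: (finite_valued_comp u (finite_valued_fin mkappa)).
Qed.

Lemma finite_L2_lty (Z : normedModType R) (u : I -> Z) : (L2norm P (fun w => u (kappa w)) < +oo)%E.
Proof.
have U0 : 0 <= \sum_k `|u k| by exact: sumr_ge0.
apply: (@le_lt_trans _ _ (\sum_k `|u k|)%:E); last exact: ltry.
apply/L2norm_leP => //.
apply: (@le_trans _ _ (\int[P]_w (cst ((\sum_k `|u k|) ^+ 2)%:E w))%E).
  apply: ge0_le_integral => //.
  - apply/measurable_EFinP; apply: measurable_funX.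
    exact: strongly_measurable_norm (strongly_measurable_finite u).
  - by move=> w _ /=; rewrite lee_fin lerXn2r ?nnegrE// (bigD1 (kappa w))//= lerDl sumr_ge0.
by rewrite integral_cst//= [X in (_ * X)%E](_ : _ = 1%E) ?mule1//; exact: probability_setT.
Qed.

Lemma integ_cell k j : integ (fun w => g j w * \1_(kappa @^-1` [set k]) w).
Proof.
apply: integ_le (integ_norm (gaussian_integ g_gauss j)) _.
  by apply: measurable_funM => //; exact: measurable_indic.
by move=> w; rewrite normrM indicE; case: (_ \in _); rewrite ?normr1 ?mulr1// normr0 mulr0.
Qed.

Lemma cell_meanE (F : I -> R) j : integ (fun w => g j w * F (kappa w)) /\
  Ex (fun w => g j w * F (kappa w)) = \sum_k cell_mean k j * F k.
Proof.
have E : (fun w => g j w * F (kappa w)) =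
    (fun w => \sum_k F k * (g j w * \1_(kappa @^-1` [set k]) w)).
  apply/funext => w; have -> : F (kappa w) = \sum_k \1_(kappa @^-1` [set k]) w * F k.
    exact: (@indic_partition R^o F w).
  by rewrite mulr_sumr; apply: eq_bigr => k _; rewrite [LHS]mulrA [LHS]mulrC.
rewrite E; split; first by apply: integ_sum => k; apply: integZ; exact: integ_cell.
rewrite Ex_sum; last by move=> k; apply: integZ; exact: integ_cell.
by apply: eq_bigr => k _; rewrite ExZ; [rewrite mulrC|exact: integ_cell].
Qed.

Lemma cell_mean_gsum (Z : normedModType R) N (t : nat -> Z) (psi : I -> dual Z) :
  integ (fun w => psi (kappa w) (gsum N t w)) /\
  Ex (fun w => psi (kappa w) (gsum N t w)) =
    \sum_(j < N) \sum_k cell_mean k j * psi k (t j).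
Proof.
have E : (fun w => psi (kappa w) (gsum N t w)) =
    (fun w => \sum_(j < N) g j w * (fun k => psi k (t j) : R) (kappa w)).
  apply/funext => w; rewrite /gsum dual_sum; apply: eq_bigr => j _.
  by rewrite dualZ.
rewrite E; split.
  by apply: integ_sum => j; have [] := cell_meanE (fun k => psi k (t j)) j.
rewrite Ex_sum; last by move=> j; have [] := cell_meanE (fun k => psi k (t j)) j.
by apply: eq_bigr => j _; have [] := cell_meanE (fun k => psi k (t j)) j.
Qed.

Lemma cell_pairing (Z : normedModType R) N (t : nat -> Z) (psi : I -> dual Z) :
  \sum_(j < N) \sum_k cell_mean k j * psi k (t j) <=
    fine (L2norm P (fun w => psi (kappa w))) * gnorm N t.
Proof.
have [ik <-] := cell_mean_gsum N t psi.
have [_] := L2_pairing (strongly_measurable_norm (strongly_measurable_finite psi))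
  (gsum_norm_measurable g N t) (finite_L2_lty psi) (gsum_L2_lty g_gauss N t)
  ((measurable_EFinP _ _).1 (measurable_int _ ik)) (fun w => dual_le _ _).
exact: le_trans (ler_norm _).
Qed.

End OnePartition.

Section Norming.
Variables (Z U : normedModType R) (b : U -> dual Z).
Hypotheses (b_le : forall u, `|b u| <= `|u|)
  (b_norming : forall v e, 0 < e -> exists u, `|u| <= `|v| /\ `|v| ^+ 2 - e * `|v| <= b u v).

Definition tame N (L : R) : set Omega := [set w | forall j, (j < N)%N -> `|g j w| <= L].

Lemma measurable_tame N L : measurable (tame N L).
Proof.
rewrite (_ : tame N L = \bigcap_(j in `I_N) [set w | `|g j w| <= L]).
  apply: fin_bigcap_measurable => [|j _]; first exact: finite_II.
  rewrite -[X in measurable X]setTI; apply: measurable_fun_le => //.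
  by apply: measurableT_comp.
by apply/seteqP; split=> w h j; exact: h.
Qed.

(** [b] will be the identity of the dual for sums in [X], and the embedding of [X] into its bidual
    for sums in the dual. On the tame set the Gaussian sum is within $\delta T$ of a function [s']
    constant on cells. Testing with almost norming values [u] gives $\sigma^2-\delta(1+T)\sigma\le
    c\sigma$ for the $L_2$ norm $\sigma$ of [s'], and $\sigma$ is cancelled. *)
Lemma truncated_gnorm_le N (t : nat -> Z) (c L : R) : 0 <= c -> 0 < L ->
  (forall (I : finType) (kappa : Omega -> I) (u : I -> U),
    (forall k, measurable (kappa @^-1` [set k])) ->
    \sum_(j < N) \sum_k cell_mean kappa k j * b (u k) (t j) <=
      c * fine (L2norm P (fun w => u (kappa w)))) ->
  (L2norm P (fun w => (\1_(tame N L) w *: gsum N t w)%R) <= c%:E)%E.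
Proof.
move=> c0 L0 hc; have mA := measurable_tame N L; set A := tame N L in mA *.
pose T := \sum_(j < N) `|t j|.
have T0 : 0 <= T by exact: sumr_ge0.
have T1 : 0 < 1 + 2 * T by rewrite ltr_pwDl// mulr_ge0.
apply/lee_addgt0Pr => e e0.
(* The norming step loses $\delta(1+T)$, the return from [s'] to the Gaussian sum loses $\delta
   T$. *)
pose delta := e / (1 + 2 * T).
have d0 : 0 < delta by exact: divr_gt0.
have [I0 [kappa0 [a [mk0 ha]]]] := quantization N (fun j => gaussian_measurable g j) L0 d0.
pose I : finType := (I0 * bool)%type.
(* The boolean separates the tame set from its complement, where rounding gives no control and both
   [s'] and [u] are 0. *)
pose kappa w : I := (kappa0 w, `[< A w >]).
have mkappa k : measurable (kappa @^-1` [set k]).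
  case: k => k [].
    rewrite (_ : _ @^-1` _ = kappa0 @^-1` [set k] `&` A); first exact: measurableI.
    by apply/seteqP; split=> w /= => [[? /asboolP]|[? Aw]]//; congr pair => //; exact/asboolP.
  rewrite (_ : _ @^-1` _ = kappa0 @^-1` [set k] `\` A); first exact: measurableD.
  apply/seteqP; split=> w /= => [[? /negbT/asboolPn]|[? Aw]]//; congr pair => //.
  exact/asboolPn.
pose s k := \sum_(j < N) a k j *: t j.
have /choice[u0 hu0] : forall k, exists u, `|u| <= `|s k| /\
    `|s k| ^+ 2 - delta * `|s k| <= b u (s k).
  by move=> k; exact: b_norming.
pose s' (k : I) : Z := if k.2 then s k.1 else 0.
pose u (k : I) : U := if k.2 then u0 k.1 else 0.
have us k : `|u k| <= `|s' k|.
  by case: k => k []; rewrite /u /s' /= ?normr0//; case: (hu0 k).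
have As w : A w -> `|gsum N t w - s (kappa0 w)| <= delta * T.
  move=> Aw; rewrite /gsum /s -sumrB mulr_sumr; apply: le_trans (ler_norm_sum _ _ _) _.
  by apply: ler_sum => j _; rewrite -scalerBl normrZ ler_wpM2r// ha.
have hs := strongly_measurable_finite mkappa s'.
have hs2 := finite_L2_lty mkappa s'.
set sigma := fine (L2norm P (fun w => s' (kappa w))).
have sigma0 : 0 <= sigma by rewrite fine_ge0// L2norm_ge0.
have hu : fine (L2norm P (fun w => u (kappa w))) <= sigma.
  apply: fine_le; rewrite ?ge0_fin_numE ?L2norm_ge0//; first exact: finite_L2_lty.
  apply: L2norm_mono => //; last exact: strongly_measurable_norm.
  exact: strongly_measurable_norm (strongly_measurable_finite mkappa u).
have sq : Ex (fun w => `|s' (kappa w)| ^+ 2) = sigma ^+ 2.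
  by rewrite /Rintegral L2norm_sqr_fin.
have nL2 := norm_Lfun2 (strongly_measurable_norm hs) hs2.
have isq : integ (fun w => `|s' (kappa w)| ^+ 2) by exact: Lfun2_integrable_sqr.
have i1 : integ (fun w => `|s' (kappa w)|) by exact: Lfun2_integ1.
have one : Ex (fun w => `|s' (kappa w)|) <= sigma.
  exact: Ex_norm_le_L2norm (strongly_measurable_norm hs) hs2.
have key : sigma ^+ 2 - delta * (1 + T) * sigma <= c * sigma.
  have [iB EB] := cell_mean_gsum mkappa N t (fun k => b (u k)).
  apply: (@le_trans _ _ (Ex (fun w => b (u (kappa w)) (gsum N t w)))); last first.
    by rewrite EB; apply: (le_trans (hc I kappa u mkappa)); rewrite ler_wpM2l.
  apply: (@le_trans _ _ (Ex (fun w => `|s' (kappa w)| ^+ 2 - delta * (1 + T) * `|s' (kappa w)|))).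
    rewrite RintegralB//; last exact: integZ.
    by rewrite ExZ// sq lerB// ler_wpM2l// mulr_ge0// ?ltW// ltr_pwDl.
  apply: le_Ex => [|//|w]; first by apply: integB => //; exact: integZ.
  have [Aw|Aw] := pselect (A w); last first.
    have -> : kappa w = (kappa0 w, false) by rewrite /kappa; congr pair; exact/asboolPn.
    rewrite /s' /u /= normr0 expr0n mulr0 subr0.
    have b0 : b 0 = 0 by apply/eqP; rewrite -normr_le0 (le_trans (b_le _))// normr0.
    by rewrite b0.
  have -> : kappa w = (kappa0 w, true) by rewrite /kappa; congr pair; exact/asboolP.
  rewrite /s' /u /=; have [u1 u2] := hu0 (kappa0 w).
  rewrite -[gsum N t w](subrK (s (kappa0 w))) dualD.
  have h3 : `|b (u0 (kappa0 w)) (gsum N t w - s (kappa0 w))| <= `|s (kappa0 w)| * (delta * T).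
    apply: (le_trans (dual_le _ _)); apply: ler_pM => //; last exact: As.
    exact: le_trans (b_le _) u1.
  move: h3; rewrite ler_norml => /andP[h3 _]; move: u2 h3; lra.
have sigmale : sigma <= c + delta * (1 + T).
  move: sigma0; rewrite le_eqVlt => /predU1P[<-|s0].
    by rewrite addr_ge0// mulr_ge0 ?ltW// ltr_pwDl.
  rewrite -(ler_pM2r s0); move: key; lra.
have mg := gsum_strongly_measurable g N t.
have mAg : strongly_measurable (fun w => \1_A w *: gsum N t w).
  by apply: strongly_measurableZ => //; exact: measurable_indic.
apply: le_trans (L2norm_triangle mAg hs) _.
have dT : (L2norm P (fun w => (\1_A w *: gsum N t w - s' (kappa w))%R) <= (delta * T)%:E)%E.
  have dT0 : 0 <= delta * T by rewrite mulr_ge0// ltW.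
  apply/L2norm_leP => //.
  apply: (@le_trans _ _ (\int[P]_w (cst ((delta * T) ^+ 2)%:E w))%E).
    apply: ge0_le_integral => //.
    - apply/measurable_EFinP; apply: measurable_funX.
      exact: strongly_measurable_norm (strongly_measurableB mAg hs).
    - move=> w _ /=; rewrite lee_fin lerXn2r ?nnegrE// indicE.
      have [Aw|Aw] := pselect (A w).
        by rewrite mem_set// scale1r /s' /= asboolT//=; exact: As.
      by rewrite memNset// scale0r /s' /= asboolF//= subr0 normr0.
  by rewrite integral_cst//= [X in (_ * X)%E](_ : _ = 1%E) ?mule1//; exact: probability_setT.
have -> : L2norm P (fun w => s' (kappa w)) = sigma%:E by rewrite fineK// ge0_fin_numE ?L2norm_ge0.
apply: le_trans (leeD (lexx _) dT) _; rewrite -!EFinD lee_fin.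
have : delta * (1 + 2 * T) = e by rewrite /delta divfK// gt_eqF.
move: sigmale; lra.
Qed.

(** Monotone convergence along the tame sets, which exhaust the space. *)
Lemma gnorm_norming N (t : nat -> Z) (c : R) : 0 <= c ->
  (forall (I : finType) (kappa : Omega -> I) (u : I -> U),
    (forall k, measurable (kappa @^-1` [set k])) ->
    \sum_(j < N) \sum_k cell_mean kappa k j * b (u k) (t j) <=
      c * fine (L2norm P (fun w => u (kappa w)))) ->
  gnorm N t <= c.
Proof.
move=> c0 hc; rewrite -lee_fin -gnormE//; apply/L2norm_leP => //.
pose A n := tame N n.+1%:R.
have mA n : measurable (A n) by exact: measurable_tame.
have uA : \bigcup_n A n = setT.
  apply/seteqP; split=> // w _; pose S := \sum_(j < N) `|g j w|.
  have S0 : 0 <= S by exact: sumr_ge0.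
  exists (Num.bound S) => // j jN; apply: (@le_trans _ _ S).
    by rewrite /S (bigD1 (Ordinal jN))//= lerDl sumr_ge0.
  by rewrite (le_trans (ltW (archi_boundP S0)))// ler_nat.
have mf : measurable_fun setT (fun w => (`|gsum N t w| ^+ 2)%:E).
  by apply/measurable_EFinP; apply: measurable_funX; exact: gsum_norm_measurable.
have ndA : {homo A : n m / (n <= m)%N >-> (n <= m)%O}.
  move=> n m nm; apply/subsetPset => w Aw j jN; apply: (le_trans (Aw j jN)).
  by rewrite ler_nat.
have mfA n : measurable_fun (A n) (fun w => (`|gsum N t w| ^+ 2)%:E) by exact: measurable_funTS.
have f0 n w : A n w -> (0 <= (`|gsum N t w| ^+ 2)%:E)%E by move=> _; rewrite lee_fin sqr_ge0.
have := ge0_nondecreasing_set_cvg_integral (mu := P) ndA mA mfA f0.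
rewrite uA => cv; rewrite -(cvg_lim _ cv)//; apply: lime_le.
  by apply/cvg_ex; eexists; exact: cv.
apply: nearW => n; rewrite integral_mkcond.
have [h _] := L2norm_leP P (fun w => \1_(A n) w *: gsum N t w) c0.
have hn := h (truncated_gnorm_le c0 (ltr0Sn _ n) hc).
apply: le_trans hn; apply: ge0_le_integral => //.
- by move=> w _; rewrite patchE; case: ifP => // _; rewrite lee_fin sqr_ge0.
- by apply/(measurable_restrictT _ (mA n)).
- apply/measurable_EFinP; apply: measurable_funX; apply: strongly_measurable_norm.
  apply: strongly_measurableZ; first exact: measurable_indic.
  exact: gsum_strongly_measurable.
- move=> w _; rewrite patchE indicE; case: ifP => [_|_]; first by rewrite scale1r.
  by rewrite lee_fin sqr_ge0.
Qed.

End Norming.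
End Cells.

(** * Trace duality *)

Section Duality.
Context {R : realType}.

Lemma scalar_sum (V : lmodType R) (f : V -> R) (I : Type) (r : seq I) (x : I -> V) :
  scalar f -> f (\sum_(i <- r) x i) = \sum_(i <- r) f (x i).
Proof.
move=> lf; have f0 : f 0 = 0.
  by have := lf (-1) 0 0; rewrite scaler0 addr0 mulN1r addNr.
have fD u v : f (u + v) = f u + f v by have := lf 1 u v; rewrite scale1r mul1r.
by elim: r => [|i r IH]; rewrite ?big_nil ?big_cons// fD IH.
Qed.

Lemma opnorm_norming (V : normedModType R) (F : dual V) (e : R) : 0 < e ->
  exists v, `|v| <= 1 /\ `|F| - e <= F v.
Proof.
move=> e0; have [_ [v /= v1 <-] hv] := sup_adherent e0 (opnorm_has_sup F).
have [Fv|Fv] := leP 0 (F v : R).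
  by exists v; split=> //; rewrite ltW// -[ltRHS]ger0_norm.
exists (- v); split; first by rewrite normrN.
by rewrite dualN ltW// -[ltRHS]ltr0_norm.
Qed.

Lemma finite_rank_op (V W : normedModType R) n (F : 'I_n -> dual V) (u : 'I_n -> W) :
  exists T : bop V W, finite_rank T /\ forall v, T v = \sum_i F i v *: u i.
Proof.
pose f v := \sum_i (F i v : R) *: u i.
have bf : f \in @bounded_linear R V W.
  apply/bounded_linearP; split.
    move=> a x y; rewrite /f scaler_sumr -big_split/=; apply: eq_bigr => i _.
    by rewrite dualD dualZ scalerDl scalerA.
  exists (\sum_i `|F i| * `|u i|) => x; rewrite mulr_suml.
  rewrite (le_trans (ler_norm_sum _ _ _))//; apply: ler_sum => i _.
  by rewrite normrZ mulrAC ler_wpM2r//; exact: dual_le.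
exists (Bop bf); split=> //.
by exists n, u => v; exists (fun i => F i v).
Qed.

Lemma coord_op (W : normedModType R) N (t : nat -> W) :
  exists T : bop (@ell2 R) W, [/\ finite_rank T,
    forall h, T h = \sum_(j < N) coord j h *: t j &
    forall j, T (ell2_unit j) = if (j < N)%N then t j else 0].
Proof.
have /choice[F hF] : forall j : 'I_N, exists F : dual (@ell2 R), forall h, F h = coord j h.
  move=> j; have [|F [hF _]] := @fun_of_comb_bounded R N (fun k => (k == j)%:R) 1 ler01.
    rewrite expr1n (bigD1 j)//= eqxx expr1n big1 ?addr0// => k kj.
    by rewrite (_ : (_ == _) = false) ?expr0n//; exact: negbTE.
  exists F => h; rewrite hF (bigD1 j)//= eqxx mul1r big1 ?addr0// => k kj.
  by rewrite (_ : (_ == _) = false) ?mul0r//; exact: negbTE.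
have [T [fT hT]] := finite_rank_op F (fun j : 'I_N => t j).
have TE h : T h = \sum_(j < N) coord j h *: t j.
  by rewrite hT; apply: eq_bigr => j _; rewrite hF.
exists T; split=> // j; rewrite TE; case: ltnP => jN.
  rewrite (bigD1 (Ordinal jN))//= coord_unit eqxx scale1r big1 ?addr0// => k kj.
  by rewrite coord_unit -val_eqE/= in kj *; rewrite (negPf kj) scale0r.
rewrite big1// => k _; rewrite coord_unit.
by rewrite (_ : (_ == _) = false) ?scale0r//; apply/negbTE; rewrite neq_ltn (leq_trans (ltn_ord k) jN) ?orbT.
Qed.

(* Hahn-Banach extension from X^n to the space of families indexed by signs, with the
   supremum norm. *)
Lemma sign_functionals (X : normedModType R) (I : finType) (phi : I -> dual X) (C : R) :
  0 <= C ->
  (forall (x : I -> X) c, 0 < c -> bounded_family x c -> \sum_i phi i (x i) <= C * c) ->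
  exists psi : {ffun I -> bool} -> dual X,
    (forall i v, phi i v = \sum_(eps : {ffun I -> bool}) (-1) ^+ eps i * psi eps v) /\
    \sum_eps `|psi eps| <= C.
Proof.
move=> C0 hphi; pose E := {ffun I -> bool}.
have lJ : linear (fun (x : I -> X) (eps : E) => \sum_i (-1) ^+ eps i *: x i).
  move=> a x y; apply/funext => eps; rewrite !fctE scaler_sumr -big_split/=.
  by apply: eq_bigr => i _; rewrite scalerDr !scalerA mulrC.
pose Jm := GRing.isLinear.Build R (I -> X) (E -> X) *:%R _ lJ.
pose J : {linear (I -> X) -> (E -> X)} := HB.pack (fun (x : I -> X) (eps : E) => \sum_i (-1) ^+ eps i *: x i) Jm.
pose mx (z : E -> X) := \big[Num.max/0]_eps `|z eps|.
have mxP z eps : `|z eps| <= mx z by apply: le_bigmax.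
have mx_le z c : 0 <= c -> (forall eps, `|z eps| <= c) -> mx z <= c.
  by move=> c0 zc; apply: bigmax_le.
have mx0 z : 0 <= mx z by apply: bigmax_ge_id.
have sp : sublinear (fun z => C * mx z).
  split=> [x y|a x a0].
    rewrite -mulrDr ler_wpM2l//; apply: mx_le => [|eps]; first by rewrite addr_ge0.
    by rewrite (le_trans (ler_normD _ _))// lerD.
  rewrite mulrCA ler_wpM2l//; apply: mx_le => [|eps]; first by rewrite mulr_ge0// ltW.
  by rewrite normrZ gtr0_norm// ler_wpM2l// ltW.
have lphi : scalar (fun x : I -> X => \sum_i phi i (x i) : R).
  move=> a x y; rewrite mulr_sumr -big_split/=; apply: eq_bigr => i _.
  by rewrite dualD dualZ.
have [|f [lf fp fJ]] := Hahn_Banach (J := J) sp lphi.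
  move=> x; apply/ler_addgt0Pr => e e0.
  (* [hphi] asks for a positive constant, while [mx (J x)] may vanish. *)
  have e1 : 0 < e / (C + 1) by rewrite divr_gt0// ltr_wpDl.
  apply: (@le_trans _ _ (C * (mx (J x) + e / (C + 1)))).
    apply: hphi; first by apply: ltr_wpDl.
    by apply: bounded_family_signs => eps; rewrite (le_trans (mxP (J x) eps))// lerDl ltW.
  rewrite mulrDr lerD2l mulrA ler_pdivrMr ?ltr_wpDl// mulrC ler_wpM2l ?ltW//.
  by rewrite ltrDl.
(* [psi eps] is the extended functional restricted to the coordinate [eps]; duality turns the
   supremum norm into the l_1 sum of the norms of the [psi eps]. *)
pose del (eps : E) (v : X) : E -> X := fun eps' => if eps' == eps then v else 0.
have mdel eps v : mx (del eps v) <= `|v|.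
  by apply: mx_le => // eps'; rewrite /del; case: ifP => //; rewrite normr0.
have ldel eps a u v : del eps (a *: u + v) = a *: del eps u + del eps v.
  by apply/funext => eps'; rewrite !fctE /del; case: ifP => //; rewrite scaler0 addr0.
have /choice[psi hpsi] : forall eps, exists F : dual X, forall v, F v = f (del eps v).
  move=> eps; have [||F [hF _]] := @dual_of_bound R X (fun v => f (del eps v)) C C0.
  - by move=> a u v; rewrite ldel lf.
  - by move=> v; rewrite (le_trans (fp _))// ler_wpM2l.
  by exists F.
have fE z : f z = \sum_eps psi eps (z eps).
  transitivity (f (\sum_eps del eps (z eps))); last first.
    by rewrite scalar_sum//; apply: eq_bigr => eps _; rewrite hpsi.
  congr f; apply/funext => eps; rewrite fct_sumE (bigD1 eps)//= /del eqxx big1 ?addr0// => k ke.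
  by rewrite eq_sym (negPf ke).
exists psi; split.
  move=> i v; have := fJ (fun k => if k == i then v else 0).
  rewrite [RHS](bigD1 i)//= eqxx [X in _ + X]big1 ?addr0 => [<-|k ki]; last first.
    by rewrite (negPf ki) dual0.
  rewrite fE; apply: eq_bigr => eps _; rewrite /= (bigD1 i)//= eqxx big1 ?addr0 ?dualZ// => k ki.
  by rewrite (negPf ki) scaler0.
apply/ler_addgt0Pr => e e0.
pose e' := e / (#|E|%:R + 1).
have c0 : 0 < #|E|%:R + 1 :> R by rewrite ltr_wpDl.
have e'0 : 0 < e' by rewrite divr_gt0.
have /choice[z hz] : forall eps, exists v, `|v| <= 1 /\ `|psi eps| - e' <= psi eps v.
  by move=> eps; exact: opnorm_norming.
have : \sum_eps (`|psi eps| - e') <= C.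
  apply: (@le_trans _ _ (f z)); first by rewrite fE; apply: ler_sum => eps _; case: (hz eps).
  rewrite (le_trans (fp _))// ler_piMr//; apply: mx_le => // eps.
  by case: (hz eps).
rewrite sumrB sumr_const -[X in _ - X]mulr_natl => h.
have : #|E|%:R * e' <= e.
  by rewrite /e' mulrA ler_pdivrMr// mulrC ler_wpM2l ?ltW// ltrDl.
by move: h; lra.
Qed.

Lemma weak_l1_norm_ub (V : normedModType R) n (y : 'I_n -> V) (F : dual V) : `|F| <= 1 ->
  \sum_(i < n) `|F (y i)| <= weak_l1_norm y.
Proof.
move=> F1; apply: ub_le_sup; last by exists F.
exists (\sum_(i < n) `|y i|) => _ [G /= G1 <-]; apply: ler_sum => i _.
by rewrite (le_trans (dual_le _ _))// ler_piMl.
Qed.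

Lemma weak_l1_norm_signs (V : normedModType R) n (y : 'I_n -> V) (eps : {ffun 'I_n -> bool}) :
  `|\sum_i (-1) ^+ eps i *: y i| <= weak_l1_norm y.
Proof.
have [F [F1 <-]] := norming_functional (\sum_i (-1) ^+ eps i *: y i).
apply: le_trans (weak_l1_norm_ub y F1); rewrite dual_sum; apply: ler_sum => i _.
by rewrite dualZ (le_trans (ler_norm _))// normrM normrX normrN1 expr1n mul1r.
Qed.

(** The inner sums add up to the trace pairing of [phi] with the family $t_j=\sum_ia_{ij}x_i$, so
    [C] bounds the norm of [phi] dual to the discrete $\gamma_\infty$. *)
Definition dual_bound (X : normedModType R) N (phi : nat -> dual X) (C : R) : Prop :=
  forall (I : finType) (a : I -> nat -> R) (x : I -> X) (c : R), 0 < c ->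
    (forall i, \sum_(j < N) a i j ^+ 2 <= 1) -> bounded_family x c ->
    \sum_i \sum_(j < N) a i j * phi j (x i) <= C * c.

(** The elements [y i] lie in the bidual, while [dual_bound] tests on [X] only. The bridge is
    [sign_functionals] for the functionals $\phi'_i=\sum_ja_{ij}\phi_j$, where the row is
    $(y_i(\phi_j))_j$ normalized: then
    $\sum_iy_i(\phi'_i)=\sum_\varepsilon(\sum_i\varepsilon_iy_i)(\psi_\varepsilon)$, and each sign
    combination of the [y i] is bounded by their weak l_1 norm. *)
Lemma pi1_adjoint_le (X : normedModType R) N (phi : nat -> dual X)
    (S : bop (@ell2 R) (dual X)) (C : R) : 0 <= C ->
  (forall h, S h = \sum_(j < N) coord j h *: phi j) -> dual_bound N phi C ->
  (pi1 (adjoint S) <= C%:E)%E.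
Proof.
move=> C0 hS hphi; apply: ereal_inf_lbound; exists C => //; split=> // n y.
pose nu i := Num.sqrt (\sum_(j < N) (y i (phi j) : R) ^+ 2).
have nu2 i : \sum_(j < N) (y i (phi j) : R) ^+ 2 = nu i ^+ 2.
  by rewrite sqr_sqrtr// sumr_ge0// => j _; exact: sqr_ge0.
(* If [nu i] is 0, the convention for its inverse makes this the zero row. *)
pose a i (j : nat) : R := (nu i)^-1 * y i (phi j).
have a1 i : \sum_(j < N) a i j ^+ 2 <= 1.
  under eq_bigr do rewrite exprMn.
  rewrite -mulr_sumr nu2 exprVn; have [->|n0] := eqVneq (nu i) 0.
    by rewrite expr0n mulr0.
  by rewrite mulVf// expf_neq0.
have aE i : \sum_(j < N) a i j * y i (phi j) = nu i.
  under eq_bigr do rewrite -mulrA -expr2.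
  rewrite -mulr_sumr nu2 expr2; have [->|n0] := eqVneq (nu i) 0.
    by rewrite !mulr0.
  by rewrite mulKf.
have adj_le i : `|adjoint S (y i)| <= nu i.
  apply: dual_norm_le; first exact: sqrtr_ge0.
  move=> h; rewrite [X in X <= _](_ : _ = y i (S h))// hS dual_sum.
  under eq_bigr do rewrite dualZ mulrC.
  apply: sum_mul_le => //; [exact: sqrtr_ge0|by rewrite nu2|exact: sum_coord_le].
pose phi' i : dual X := \sum_(j < N) a i j *: phi j.
have [x c c0 xc|psi [hpsi psiC]] := @sign_functionals X 'I_n phi' C C0.
  have := hphi 'I_n a x c c0 a1 xc; congr (_ <= _); apply: eq_bigr => i _.
  by rewrite /phi' sumfE; apply: eq_bigr => j _.
have phiE i : phi' i = \sum_(eps : {ffun 'I_n -> bool}) (-1) ^+ eps i *: psi eps.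
  by apply/val_inj/funext => v; rewrite [LHS]hpsi [RHS]sumfE.
apply: (@le_trans _ _ (\sum_i y i (phi' i))).
  apply: ler_sum => i _; apply: (le_trans (adj_le i)); rewrite -(aE i) /phi' dual_sum.
  by apply: ler_sum => j _; rewrite dualZ.
under eq_bigr do rewrite phiE dual_sum.
rewrite exchange_big/= mulrC.
apply: (@le_trans _ _ (\sum_eps weak_l1_norm y * `|psi eps|)); last first.
  rewrite -mulr_sumr ler_wpM2l// (le_trans _ (weak_l1_norm_signs y [ffun=> false]))//.
apply: ler_sum => eps _; apply: (@le_trans _ _ ((\sum_i (-1) ^+ eps i *: y i) (psi eps) : R)).
  by rewrite sumfE; apply: ler_sum => i _; rewrite dualZ.
apply: (le_trans (ler_norm _)); apply: (le_trans (dual_le _ _)).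
by rewrite ler_wpM2r// weak_l1_norm_signs.
Qed.

End Duality.

(** * The gauge of families that factor through finite l_oo *)

Section Gauge.
Context {R : realType} (X : normedModType R) (N : nat).
Implicit Types (t : nat -> X).

(* The families [t] arising as [t j = B (A e_j)] with [A] contractive from l_2 to a finite
   l_oo and [B] of norm at most [c]. *)
Definition representable t (c : R) : Prop :=
  exists (I : finType) (a : I -> nat -> R) (x : I -> X),
    [/\ forall i, \sum_(j < N) a i j ^+ 2 <= 1, bounded_family x c &
      forall j, (j < N)%N -> t j = \sum_i a i j *: x i].

(** The direct sum of the two l_oo spaces: the rows stay contractive and the norms of the families
    add. *)
Lemma representableD t u c e : representable t c -> representable u e ->
  representable (t + u) (c + e).
Proof.
move=> [I [a [x [a1 xc hx]]]] [J [b [y [b1 ye hy]]]].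
exists (I + J)%type, (fun k => match k with inl i => a i | inr j => b j end),
  (fun k => match k with inl i => x i | inr j => y j end); split=> [[]//|s s1|j jN].
  rewrite big_sumType/=; apply: (le_trans (ler_normD _ _)); apply: lerD.
    by apply: xc => i; exact: s1.
  by apply: ye => i; exact: s1.
by rewrite big_sumType/= -hx// -hy.
Qed.

Lemma representableZ t c (s : R) : 0 <= s -> representable t c ->
  representable (s *: t) (s * c).
Proof.
move=> s0 [I [a [x [a1 xc hx]]]]; exists I, a, (fun i => s *: x i); split=> //.
  exact: bounded_familyZ.
move=> j jN; rewrite !fctE hx// scaler_sumr; apply: eq_bigr => i _.
by rewrite !scalerA mulrC.
Qed.

Lemma representable_unit (i : nat) (v : X) :
  representable (fun j => if j == i then v else 0) `|v|.
Proof.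
exists unit, (fun _ j => (j == i)%:R), (fun=> v); split=> [_|s s1|j jN].
- have [iN|iN] := ltnP i N.
    rewrite (bigD1 (Ordinal iN))//= eqxx expr1n big1 ?addr0// => k.
    by rewrite -val_eqE/= => /negPf ->; rewrite expr0n.
  by rewrite big1// => k _; rewrite (_ : (_ == _) = false) ?expr0n//; apply/negbTE; rewrite neq_ltn (leq_trans (ltn_ord k) iN).
- by rewrite (big_pred1 tt) => [|[]]//; rewrite normrZ ler_piMl.
- by rewrite (big_pred1 tt) => [|[]]//; case: ifP => _; rewrite ?scale1r// scale0r.
Qed.

Lemma representable_ge0 t c : representable t c -> 0 <= c.
Proof. by move=> [I [a [x [_ /bounded_family_ge0]]]]. Qed.

Lemma representable_ext t u c : (forall j, (j < N)%N -> t j = u j) ->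
  representable t c -> representable u c.
Proof.
move=> tu [I [a [x [a1 xc hx]]]]; exists I, a, x; split=> // j jN.
by rewrite -tu// hx.
Qed.

Lemma representable0 : representable 0 0.
Proof.
have := representableZ (lexx 0) (representable_unit 0 0).
by rewrite mul0r; apply: representable_ext => j _; rewrite fctE scale0r.
Qed.

Lemma representable_ex t : exists c, representable t c.
Proof.
suff h n : exists c, representable (fun j => if (j < n)%N then t j else 0) c.
  have [c hc] := h N; exists c; apply: representable_ext hc => j jN.
  by rewrite jN.
elim: n => [|n [c hc]].
  by exists 0; apply: representable_ext representable0 => j _.
exists (c + `|t n|); apply: representable_ext (representableD hc (representable_unit n (t n))) => j _.
rewrite fctE ltnS; case: (ltngtP j n) => [||->]; rewrite ?addr0 ?add0r//.
Qed.

Definition gauge t : R := inf [set c | representable t c].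

Lemma gauge_has_inf t : has_inf [set c | representable t c].
Proof.
split; first by have [c hc] := representable_ex t; exists c.
by exists 0 => c /representable_ge0.
Qed.

Lemma gauge_le t c : representable t c -> gauge t <= c.
Proof. by move=> hc; apply: ge_inf => //; case: (gauge_has_inf t). Qed.

Lemma gauge_adherent t e : 0 < e -> exists2 c, representable t c & c < gauge t + e.
Proof. by move=> e0; have [c hc ce] := inf_adherent e0 (gauge_has_inf t); exists c. Qed.

Lemma gauge_sublinear : sublinear gauge.
Proof.
split=> [t u|s t s0]; apply/ler_addgt0Pr => e e0.
  have e2 : 0 < e / 2 by rewrite divr_gt0.
  have [c hc ce] := gauge_adherent t e2; have [c' hc' ce'] := gauge_adherent u e2.
  by apply: (le_trans (gauge_le (representableD hc hc'))); lra.
have [c hc ce] := gauge_adherent t (divr_gt0 e0 s0).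
apply: (le_trans (gauge_le (representableZ (ltW s0) hc))).
by have := ltW ce; rewrite -(ler_pM2l s0) mulrDr [s * (e / s)]mulrC divfK ?gt_eqF.
Qed.

(* Hahn-Banach duality between the gauge of the unit ball of gamma_infty and the trace
   pairing. *)
Lemma gauge_duality t : exists phi : nat -> dual X,
  dual_bound N phi 1 /\
  forall e, 0 < e -> exists2 c, representable t c & c <= \sum_(j < N) phi j (t j) + e.
Proof.
have [f [lf fle ft]] := sublinear_support t gauge_sublinear.
(* [gauge] sees the first [N] entries only, so the supporting functional vanishes on families that
   are zero there. *)
have lf0 u : (forall j, (j < N)%N -> u j = 0) -> f u <= 0.
  move=> u0; rewrite (le_trans (fle u))// gauge_le//.
  by apply: representable_ext representable0 => j jN; rewrite u0.
pose del (i : nat) (v : X) : nat -> X := fun j => if j == i then v else 0.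
have /choice[phi hphi] : forall i, exists F : dual X, forall v, F v = f (del i v).
  move=> i; have [||F [hF _]] := @dual_of_bound R X (fun v => f (del i v)) 1 ler01.
  - move=> s u v; rewrite -lf; congr f; apply/funext => j; rewrite !fctE /del.
    by case: ifP => //; rewrite scaler0 addr0.
  - by move=> v; rewrite mul1r (le_trans (fle _))// gauge_le//; exact: representable_unit.
  by exists F.
have fE u : f u = \sum_(j < N) phi j (u j).
  have -> : \sum_(j < N) (phi j (u j) : R) = f (\sum_(j < N) del j (u j)).
    by rewrite scalar_sum//; apply: eq_bigr => j _; rewrite hphi.
  set u' := \sum_(j < N) _.
  have uu' j : (j < N)%N -> u j = u' j.
    move=> jN; rewrite /u' fct_sumE (bigD1 (Ordinal jN))//= /del eqxx big1 ?addr0// => k.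
    by rewrite -val_eqE/= eq_sym => /negPf ->.
  have h1 : f (u - u') <= 0 by apply: lf0 => j jN; rewrite !fctE uu'// subrr.
  have h2 : f (u' - u) <= 0 by apply: lf0 => j jN; rewrite !fctE uu'// subrr.
  have e1 : f (u - u') = f u - f u'.
    by rewrite (_ : u - u' = (-1) *: u' + u) ?lf ?mulN1r 1?addrC// scaleN1r addrC.
  have e2 : f (u' - u) = f u' - f u.
    by rewrite (_ : u' - u = (-1) *: u + u') ?lf ?mulN1r 1?addrC// scaleN1r addrC.
  by move: h1 h2; rewrite e1 e2; lra.
exists phi; split.
  move=> I a x c c0 a1 xc; rewrite mul1r exchange_big/=.
  apply: (@le_trans _ _ (f (fun j => \sum_i a i j *: x i))).
    rewrite fE; apply: ler_sum => j _; rewrite dual_sum.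
    by apply: ler_sum => i _; rewrite dualZ.
  by rewrite (le_trans (fle _))// gauge_le//; exists I, a, x.
move=> e e0; have [c hc ce] := gauge_adherent t e0.
by exists c => //; rewrite -fE ft ltW.
Qed.

End Gauge.

(** * Passing between operators and families *)

Section GammaInfty.
Context {R : realType} (X : normedModType R).
Implicit Types T : bop (@ell2 R) X.

Lemma gamma_infty_ge0 T : (0 <= gamma_infty T)%E.
Proof.
apply: le_ereal_inf_tmp => _ [d [Y [nu [A [B [_ ->]]]]]].
by rewrite lee_fin mulr_ge0.
Qed.

Lemma gamma_infty_discrete T (c : R) N (delta : R) : (gamma_infty T < c%:E)%E -> 0 < delta ->
  exists (I : finType) (a : I -> nat -> R) (x : I -> X),
    [/\ forall i, \sum_(j < N) a i j ^+ 2 <= 1, bounded_family x c &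
      forall j, (j < N)%N -> `|T (ell2_unit j) - \sum_i a i j *: x i| <= delta].
Proof.
move=> /ereal_inf_lt[_ [d [Y [nu [A [B [-> ->]]]]]]] ABc d0.
rewrite lte_fin in ABc.
(* This choice gives $(\|A\|+e)\|B\|\le c$, so the factor $\|A\|+e$ can be moved from the rows to
   the family. *)
pose e := Num.min delta ((c - `|A| * `|B|) / (`|B| + 1)).
have B1 : 0 < `|B| + 1 by rewrite ltr_wpDl.
have e0 : 0 < e by rewrite lt_min d0 divr_gt0// subr_gt0.
have [I [a [x [aA xB hx]]]] := Linfty_discretization A B N e0.
have s0 : 0 < `|A| + e by rewrite ltr_wpDl.
exists I, (fun i j => (`|A| + e)^-1 * a i j), (fun i => (`|A| + e) *: x i); split.
- move=> i; under eq_bigr do rewrite exprMn.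
  by rewrite -mulr_sumr exprVn mulrC ler_pdivrMr ?exprn_gt0// mul1r.
- have xs := bounded_familyZ (ltW s0) xB => b b1; apply: (le_trans (xs b b1)).
  have : e * (`|B| + 1) <= c - `|A| * `|B| by rewrite -ler_pdivlMr// ge_min lexx orbT.
  by rewrite mulrDr mulr1 mulrDl; have := ltW e0; lra.
- move=> j jN; rewrite (eq_bigr (fun i => a i j *: x i)) => [|i _].
    by apply: (le_trans (hx j jN)); rewrite ge_min lexx.
  by rewrite scalerA mulrAC mulVf ?mul1r// gt_eqF.
Qed.

Lemma gamma_infty_representable T N (t : nat -> X) (c : R) :
  (forall h, T h = \sum_(j < N) coord j h *: t j) ->
  representable N t c -> (gamma_infty T <= c%:E)%E.
Proof.
move=> hT [I [a [x [a1 xc hx]]]].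
have /choice[alpha ha] : forall i, exists F : dual (@ell2 R),
    (forall h, F h = \sum_(j < N) a i j * coord j h) /\ `|F| <= 1.
  by move=> i; apply: fun_of_comb_bounded => //; rewrite expr1n; exact: a1.
apply: (gamma_infty_le (alpha := alpha) (x := x)) => // [i|h]; first by case: (ha i).
rewrite hT; under eq_bigr => j _ do rewrite hx// scaler_sumr.
rewrite exchange_big/=; apply: eq_bigr => i _; have [-> _] := ha i.
by rewrite scaler_suml; apply: eq_bigr => j _; rewrite scalerA mulrC.
Qed.

(* The part of [T] living on the tail of the coordinates is absorbed by finitely many extra
   coordinates of the l_oo space, at the cost [eta]. *)
Lemma gamma_infty_tail T (eta : R) : finite_rank T -> 0 < eta ->
  exists N0, forall N, (N0 <= N)%N -> forall c,
    representable N (fun j => T (ell2_unit j)) c -> (gamma_infty T <= (c + eta)%:E)%E.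
Proof.
move=> /finite_rank_expansion[n [psi [u Tu]]] eta0.
pose U := 1 + \sum_(k < n) `|u k|.
have U0 : 0 < U by rewrite ltr_wpDr// sumr_ge0.
pose e := eta / U; have e0 : 0 < e by rewrite divr_gt0.
have /choice[N0 hN0] : forall k : 'I_n, exists N0, forall N, (N0 <= N)%N ->
    forall h, `|psi k (h - proj N h)| <= e * `|h|.
  by move=> k; exact: dual_tail.
exists (\max_k N0 k)%N => N hN c [I [a [x [a1 xc hx]]]].
have Tx j (jN : (j < N)%N) : T (ell2_unit j) = \sum_i a i j *: x i := hx j jN.
have /choice[alpha ha] : forall i, exists F : dual (@ell2 R),
    (forall h, F h = \sum_(j < N) a i j * coord j h) /\ `|F| <= 1.
  by move=> i; apply: fun_of_comb_bounded => //; rewrite expr1n; exact: a1.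
have /choice[beta hb] : forall k : 'I_n, exists F : dual (@ell2 R),
    (forall h, F h = e^-1 * psi k (h - proj N h)) /\ `|F| <= 1.
  move=> k; apply: dual_of_bound => [//|s f h|h].
    rewrite !dualB !dual_proj dualD dualZ.
    have -> : \sum_(j < N) coord j (s *: f + h) * psi k (ell2_unit j) =
       s * (\sum_(j < N) coord j f * psi k (ell2_unit j)) +
       \sum_(j < N) coord j h * psi k (ell2_unit j) :> R.
      rewrite mulr_sumr -big_split/=; apply: eq_bigr => j _.
      by rewrite coordD coordZ mulrDl mulrA.
    ring.
  rewrite mul1r ler_pdivrMl// (le_trans (ler_norm _))//; apply: hN0.
  by apply: leq_trans hN; exact: (@leq_bigmax _ N0 k).
apply: (gamma_infty_le
  (alpha := fun s : I + 'I_n => match s with inl i => alpha i | inr k => beta k end)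
  (x := fun s : I + 'I_n => match s with inl i => x i | inr k => e *: u k end)).
- by case=> [i|k]; [case: (ha i)|case: (hb k)].
- move=> s s1; rewrite big_sumType/= (le_trans (ler_normD _ _))// lerD//.
    by apply: xc => i; exact: s1.
  apply: (@le_trans _ _ (\sum_(k < n) e * `|u k|)).
    rewrite (le_trans (ler_norm_sum _ _ _))//; apply: ler_sum => k _.
    by rewrite normrZ (normrZ e) (gtr0_norm e0) ler_piMl// mulr_ge0// ltW.
  by rewrite -mulr_sumr /e mulrAC ler_pdivrMr// ler_wpM2l ?ltW// ltrDr.
- move=> h; rewrite big_sumType/=.
  have -> : T h = T (proj N h) + T (h - proj N h) by rewrite -linearD addrC subrK.
  congr (_ + _).
    rewrite proj_apply.
    rewrite (eq_bigr (fun j : 'I_N => \sum_i coord j h *: (a i j *: x i))) => [|j _]; last first.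
      by rewrite Tx// scaler_sumr.
    rewrite exchange_big/=; apply: eq_bigr => i _; have [-> _] := ha i.
    by rewrite scaler_suml; apply: eq_bigr => j _; rewrite scalerA mulrC.
  rewrite Tu; apply: eq_bigr => k _; have [-> _] := hb k.
  by rewrite scalerA mulrAC mulVf ?mul1r// gt_eqF.
Qed.

End GammaInfty.

(** * The two implications *)

Section Equivalence.
Context d (Omega : measurableType d) {R : realType} {P : probability Omega R}.
Variable g : nat -> {RV P >-> R}.
Hypotheses (g_gauss : standard_gaussian g) (g_indep : independent g).
Variable X : completeNormedModType R.
Local Notation Ex f := (Rintegral P setT f).
Local Notation gsum := (gsum g).
Local Notation gnorm := (gnorm g).
Local Notation sigma2 := (sigma2 g).
Implicit Types T : bop (@ell2 R) X.

Lemma gnorm_ext (Z : normedModType R) N (t u : nat -> Z) :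
  (forall j, (j < N)%N -> t j = u j) -> gnorm N t = gnorm N u.
Proof.
move=> tu; congr (fine (L2norm P _)); apply/funext => w.
by apply: eq_bigr => j _; rewrite tu.
Qed.

Lemma gnorm_tail (Z : normedModType R) N M (t : nat -> Z) : (N <= M)%N ->
  (forall j, (N <= j)%N -> t j = 0) -> gnorm M t = gnorm N t.
Proof.
move=> NM t0; congr (fine (L2norm P _)); apply/funext => w.
rewrite /gsum -(subnKC NM) big_split_ord/= [X in _ + X]big1 ?addr0// => j _.
by rewrite t0 ?scaler0// leq_addr.
Qed.

Lemma le_of_small (x y K : R) : 0 <= K -> (forall e, 0 < e -> x <= y + e * K) -> x <= y.
Proof.
move=> K0 h; apply/ler_addgt0Pr => e e0.
apply: (le_trans (h (e / (K + 1)) _)); first by rewrite divr_gt0// ltr_wpDl.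
by rewrite lerD2l mulrAC ler_pdivrMr ?ltr_wpDl// ler_wpM2l ?ltW// ltrDl.
Qed.

Lemma cotype_ell_norm_le : finite_cotype X ->
  exists2 M : R, 0 < M & forall T, (ell_norm g T <= M%:E * gamma_infty T)%E.
Proof.
move=> /(cotype_family_gnorm g_gauss g_indep)[M M0 hM]; exists M => // T.
have s0 : 0 <= Num.sqrt sigma2 by exact: sqrtr_ge0.
have main c : (gamma_infty T < c%:E)%E -> (ell_norm g T <= (M * c)%:E)%E.
  move=> Tc; have c0 : 0 < c by rewrite -lte_fin (le_lt_trans (gamma_infty_ge0 T)).
  apply: ell_norm_le => //; first by rewrite mulr_ge0 ?ltW.
  (* [N] is fixed before the discretization error [e], so the perturbation of the Gaussian norm,
     proportional to [e] times [N], tends to 0. *)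
  exists 0%N => N _; apply: (@le_of_small _ _ (N%:R * Num.sqrt sigma2)).
    by rewrite mulr_ge0.
  move=> e e0; have [I [a [x [a1 xc hx]]]] := gamma_infty_discrete N Tc e0.
  apply: (le_trans (gnorm_perturb g_gauss (ltW e0) hx)); rewrite lerD2r.
  have := hM I N a x 1 c ltr01 c0; rewrite mul1r; apply=> //.
  by move=> i; rewrite expr1n; exact: a1.
have [Too|Tfin] := eqVneq (gamma_infty T) +oo%E.
  by rewrite Too gt0_muley ?leey// lte_fin.
have Tf : gamma_infty T \is a fin_num.
  by rewrite ge0_fin_numE ?gamma_infty_ge0// lt_neqAle Tfin leey.
apply/lee_addgt0Pr => e e0.
have := main (fine (gamma_infty T) + e / M); rewrite EFinD fineK//.
rewrite lteDl ?lte_fin ?divr_gt0// => /(_ isT)/le_trans; apply.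
by rewrite mulrDr EFinD EFinM fineK// mulrC divfK// gt_eqF.
Qed.

Lemma GAP_gnorm_le : GAP g (dual X) -> exists2 K : R, 0 < K &
  forall N (phi : nat -> dual X) (C : R), 0 <= C -> dual_bound N phi C -> gnorm N phi <= K * C.
Proof.
move=> [K0 hK]; pose K := Num.max K0 1; have K1 : 0 < K by rewrite lt_max ltr01 orbT.
exists K => // N phi C C0 hphi; have [S [fS SE Su]] := coord_op N phi.
apply/ler_addgt0Pr => e e0; have [N0 hN] := gnorm_le_ell g_gauss g_indep fS e0.
rewrite -lee_fin EFinD; have := hN (maxn N N0) (leq_maxr _ _).
rewrite (@gnorm_tail _ N) ?leq_maxl//; last by move=> j; rewrite Su leqNgt => /negPf ->.
rewrite (@gnorm_ext _ N _ phi); last by move=> j jN; rewrite Su jN.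
move=> /le_trans; apply; rewrite leeD2r//; apply: (le_trans (hK S fS)).
have pS := pi1_adjoint_le C0 SE hphi.
have p0 : (0 <= pi1 (adjoint S))%E.
  by apply: le_ereal_inf_tmp => _ [r [r0 _] <-]; rewrite lee_fin.
apply: (@le_trans _ _ (K%:E * pi1 (adjoint S))%E).
  by apply: lee_wpmul2r => //; rewrite lee_fin le_max lexx.
by rewrite EFinM; apply: lee_wpmul2l => //; rewrite lee_fin ltW.
Qed.

Lemma GAP_gamma_le_ell : GAP g (dual X) -> exists2 K : R, 0 < K &
  forall T, finite_rank T -> (gamma_infty T <= K%:E * ell_norm g T)%E.
Proof.
move=> /GAP_gnorm_le[K K0 hK]; have s0 := sigma2_gt0 g_gauss.
exists (K / sigma2); first by rewrite divr_gt0.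
move=> T fT; have K'0 : 0 < K / sigma2 by rewrite divr_gt0.
have [Too|Tfin] := eqVneq (ell_norm g T) +oo%E.
  by rewrite Too gt0_muley ?leey// lte_fin.
have Tf : ell_norm g T \is a fin_num.
  by rewrite ge0_fin_numE ?L2norm_ge0// lt_neqAle Tfin leey.
apply/lee_addgt0Pr => e e0.
(* The losses are [e1] from the gauge, [e1] from the tail of [T], and [K / sigma2 * e1] from
   replacing the l-norm by a partial sum. *)
pose e1 := e / (K / sigma2 + 2).
have K2 : 0 < K / sigma2 + 2 by rewrite addr_gt0.
have e10 : 0 < e1 by rewrite divr_gt0.
have [N1 hN1] := gnorm_le_ell g_gauss g_indep fT e10.
have [N2 hN2] := gamma_infty_tail fT e10.
pose N := maxn N1 N2; pose t j := T (ell2_unit j).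
have [phi [phi1 hphi]] := gauge_duality N t.
have [c hc cle] := hphi e1 e10.
apply: (le_trans (hN2 N (leq_maxr _ _) c hc)).
have h1 : gnorm N t <= fine (ell_norm g T) + e1.
  by rewrite -lee_fin EFinD (fineK Tf); exact: (hN1 _ (leq_maxl _ _)).
have h2 : \sum_(j < N) phi j (t j) <= K / sigma2 * gnorm N t.
  rewrite mulrAC ler_pdivlMr// mulrC; apply: le_trans (gnorm_duality g_gauss g_indep N phi t) _.
  by rewrite ler_wpM2r ?gnorm_ge0//; have := hK N phi 1 ler01 phi1; rewrite mulr1.
rewrite -[X in (_ <= _ * X + _)%E]fineK// -EFinM -EFinD lee_fin.
have h3 : K / sigma2 * gnorm N t <= K / sigma2 * (fine (ell_norm g T) + e1).
  by rewrite ler_wpM2l// ltW.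
have h4 : e = e1 * (K / sigma2 + 2) by rewrite /e1 divfK// gt_eqF.
rewrite h4; move: cle h2 h3; lra.
Qed.

(** Gaussian projections are symmetric: pairing the coefficients of [f] with a simple dual-valued
    [u] equals pairing [f] with the Gaussian sum of the coefficients [phi] of [u]. By GAP it is
    enough to bound [phi] in the dual norm. For a representable family [t] that pairing is the
    expectation of [u] applied to the Gaussian sum of [t], and cotype bounds the norm of this
    sum. *)
Lemma GAP_cotype_K_convex : GAP g (dual X) -> finite_cotype X -> K_convex g X.
Proof.
move=> /GAP_gnorm_le[K K0 hK] /(cotype_family_gnorm g_gauss g_indep)[M M0 hM].
exists (K * M) => n f [mf f2].
pose b j := bochner_integral P (fun w => g j w *: f w).
rewrite -[X in (_ <= _ * X)%E]fineK; last by rewrite ge0_fin_numE ?L2norm_ge0.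
rewrite -EFinM [X in (X <= _)%E](gnormE g_gauss n b) lee_fin.
have F0 : 0 <= fine (L2norm P f) by rewrite fine_ge0// L2norm_ge0.
apply: (@gnorm_norming _ _ _ _ _ g_gauss X (dual X) id) => //.
- move=> v e e0; have [F [F1 Fv]] := norming_functional v.
  exists (`|v| *: F); split; first by rewrite normrZ normr_id ler_piMr.
  by rewrite scalefE Fv -expr2 gerBl mulr_ge0// ltW.
- by rewrite !mulr_ge0// ltW.
move=> I kappa u mkappa; set F := fine (L2norm P (fun w => u (kappa w))).
have Fu0 : 0 <= F by rewrite fine_ge0// L2norm_ge0.
(* Where [b j] is 0 the integral may be a default value unrelated to [f]. Dropping these indices on
   the dual side keeps the identity with the expectation valid. *)
pose phi j : dual X := if b j == 0 then 0 else \sum_k cell_mean g kappa k j *: u k.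
have -> : \sum_(j < n) \sum_k cell_mean g kappa k j * u k (b j) =
    \sum_(j < n) Ex (fun w => g j w * phi j (f w)) :> R.
  apply: eq_bigr => j _; rewrite /phi.
  have [bj0|bj0] := eqVneq (b j) 0.
    rewrite bj0 big1 => [|k _]; last by rewrite dual0 mulr0.
    rewrite (_ : (fun w => _) = (fun=> 0)) ?Rintegral_cst ?mul0r//.
    by apply/funext => w; rewrite zerofE mulr0.
  have [[h _]|h] := bochner_integral_dual P (fun w => g j w *: f w)
      (\sum_k cell_mean g kappa k j *: u k : dual X); last by move: bj0; rewrite /b h eqxx.
  transitivity ((\sum_k cell_mean g kappa k j *: u k : dual X) (b j) : R).
    by rewrite sumfE; apply: eq_bigr => k _; rewrite scalefE.
  rewrite [LHS]h; congr Rintegral; apply/funext => w.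
  by rewrite dualZ.
apply: (le_trans (gnorm_pairing g_gauss n phi mf f2)).
have -> : K * M * fine (L2norm P f) * F = K * (M * F) * fine (L2norm P f) by ring.
rewrite ler_wpM2r//; apply: hK; first by rewrite mulr_ge0// ltW.
move=> J a x c c0 a1 xc.
pose t j : X := if b j == 0 then 0 else \sum_i a i j *: x i.
apply: (@le_trans _ _ (\sum_(j < n) \sum_k cell_mean g kappa k j * u k (t j))).
  rewrite exchange_big/=; apply: ler_sum => j _; rewrite /phi /t.
  have [bj0|bj0] := eqVneq (b j) 0.
    rewrite !big1// => k _; first by rewrite dual0 mulr0.
    by rewrite zerofE mulr0.
  under eq_bigr do rewrite sumfE mulr_sumr.
  rewrite exchange_big/=; apply: ler_sum => k _; rewrite dual_sum mulr_sumr.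
  by apply: ler_sum => i _; rewrite dualZ [leRHS]mulrCA; exact: lexx.
apply: (le_trans (cell_pairing g_gauss mkappa n t u)).
rewrite -/F [M * F]mulrC -mulrA ler_wpM2l//.
(* Deleting the same columns from the matrix keeps the rows contractive. *)
pose a' i j := if b j == 0 then 0 else a i j.
have -> : t = (fun j => \sum_i a' i j *: x i).
  apply/funext => j; rewrite /t /a'; case: ifP => // _.
  by rewrite big1// => i _; rewrite scale0r.
have := hM J n a' x 1 c ltr01 c0; rewrite mul1r; apply=> // i.
rewrite expr1n; apply: le_trans (a1 i); apply: ler_sum => j _; rewrite /a'.
by case: ifP => // _; rewrite expr0n sqr_ge0.
Qed.

End Equivalence.

(** * From K-convexity and equivalence of norms to GAP and cotype *)

Section Converse.
Context d (Omega : measurableType d) {R : realType} {P : probability Omega R}.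
Variable g : nat -> {RV P >-> R}.
Hypotheses (g_gauss : standard_gaussian g) (g_indep : independent g).
Variable X : completeNormedModType R.
Local Notation Ex f := (Rintegral P setT f).
Local Notation gsum := (gsum g).
Local Notation gnorm := (gnorm g).

Lemma evaluation (x : X) : exists F : dual (dual X), (forall f, F f = f x) /\ `|F| <= `|x|.
Proof.
have [||F [hF F1]] := @dual_of_bound R (dual X) (fun f => f x : R) `|x| (normr_ge0 x).
- by move=> a u v; rewrite addfE scalefE.
- by move=> f; rewrite mulrC (le_trans (ler_norm _))// dual_le.
by exists F.
Qed.

Definition canonical (x : X) : dual (dual X) := sval (cid (evaluation x)).

Lemma canonicalE x f : canonical x f = f x.
Proof. by rewrite /canonical; case: cid => F []. Qed.

Lemma canonical_le x : `|canonical x| <= `|x|.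
Proof. by rewrite /canonical; case: cid => F []. Qed.

Lemma sum_enum_val (V : nmodType) (I : finType) (F : I -> V) :
  \sum_(k < #|I|) F (enum_val k) = \sum_i F i.
Proof.
rewrite [RHS](reindex (@enum_val I predT))//.
by exists enum_rank => i _; [exact: enum_valK|exact: enum_rankK].
Qed.

(** The summing inequality of the adjoint is tested on the canonical images of the [x i]. A
    functional on the bidual restricts to one on [X], so the weak l_1 norm of these images is at
    most [c]. Evaluating the adjoint at the unit ball vector $\sum_ja_{ij}e_j$ recovers the [i]-th
    term of the trace. *)
Lemma summing_family_le (T : bop (@ell2 R) (dual X)) (r : R) N (I : finType)
    (a : I -> nat -> R) (x : I -> X) (c : R) : 0 <= r ->
  (forall n (y : 'I_n -> dual (dual X)), \sum_(i < n) `|adjoint T (y i)| <= r * weak_l1_norm y) ->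
  (forall i, \sum_(j < N) a i j ^+ 2 <= 1) -> bounded_family x c ->
  \sum_i \sum_(j < N) a i j * T (ell2_unit j) (x i) <= r * c.
Proof.
move=> r0 hr a1 xc.
pose y (k : 'I_#|I|) := canonical (x (enum_val k)).
have yc : weak_l1_norm y <= c.
  apply: ge_sup.
    exists (\sum_(i < #|I|) `|(0 : dual (dual (dual X))) (y i)|), 0 => //=.
    by rewrite normr0.
  move=> _ [F /= F1 <-].
  have [||f [hf f1]] := @dual_of_bound R X (fun v => F (canonical v) : R) 1 ler01.
  - move=> s u v; rewrite -dualZ -dualD; congr (F _ : R); apply/val_inj/funext => f.
    transitivity (s * canonical u f + canonical v f : R) => //.
    by rewrite [LHS]canonicalE dualD dualZ !canonicalE.
  - by move=> v; rewrite mul1r; exact: le_trans (dual_le1 _ F1) (canonical_le v).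
  apply: (@le_trans _ _ (\sum_i `|f (x i)|)).
    rewrite -(sum_enum_val (fun i => `|f (x i)| : R)).
    by apply: ler_sum => i _; rewrite hf.
  apply: (le_trans (bounded_family_functional f xc)); rewrite ler_piMl//.
  exact: bounded_family_ge0 xc.
apply: (@le_trans _ _ (r * weak_l1_norm y)); last by rewrite ler_wpM2l.
apply: le_trans (hr _ y).
have -> : \sum_(k < #|I|) `|adjoint T (y k)| = \sum_i `|adjoint T (canonical (x i))|.
  exact: (sum_enum_val (fun i => `|adjoint T (canonical (x i))|)).
apply: ler_sum => i _.
pose h : ell2 := \sum_(j < N) a i j *: ell2_unit j.
have h1 : `|h| <= 1 by apply: comb_norm_le => //; rewrite expr1n.
have -> : \sum_(j < N) a i j * T (ell2_unit j) (x i) = adjoint T (canonical (x i)) h.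
  rewrite [RHS](_ : _ = canonical (x i) (T h))// canonicalE /h linear_sum sumfE.
  by apply: eq_bigr => j _; rewrite linearZ.
exact: le_trans (ler_norm _) (le_trans (dual_le _ _) (ler_piMr _ h1)).
Qed.

Lemma K_convex_GAP : K_convex g X ->
  (exists2 K : R, 0 < K & forall T : bop (@ell2 R) X, finite_rank T ->
    (gamma_infty T <= K%:E * ell_norm g T)%E) -> GAP g (dual X).
Proof.
move=> [C0 hC0] [K K0 hK]; pose C := Num.max C0 1.
have C1 : 0 < C by rewrite lt_max ltr01 orbT.
have hC n (f : Omega -> X) : in_L2 P f -> gnorm n (fun j => bochner_integral P (fun w => g j w *: f w)) <=
    C * fine (L2norm P f).
  move=> hf; rewrite -lee_fin -gnormE// EFinM fineK; last first.
    by rewrite ge0_fin_numE ?L2norm_ge0//; case: hf.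
  apply: (le_trans (hC0 n f hf)); apply: lee_wpmul2r; first exact: L2norm_ge0.
  by rewrite lee_fin le_max lexx.
exists (K * C) => T fT.
have KC : 0 < K * C by rewrite mulr_gt0.
rewrite -lee_pdivrMl//; apply: le_ereal_inf_tmp => _ [r [r0 hr] <-].
rewrite lee_pdivrMl// -EFinM.
apply: ell_norm_le => //; first by rewrite !mulr_ge0// ltW.
exists 0%N => N _; pose phi j := T (ell2_unit j).
apply: (@gnorm_norming _ _ _ _ _ g_gauss (dual X) X canonical) => //.
- exact: canonical_le.
- move=> F e e0; have [v [v1 Fv]] := opnorm_norming F e0.
  exists (`|F| *: v); rewrite normrZ normr_id ler_piMr//; split=> //.
  by rewrite canonicalE dualZ expr2 [e * _]mulrC -mulrBr ler_wpM2l.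
- by rewrite !mulr_ge0// ltW.
move=> I kappa u mkappa; set F := fine (L2norm P (fun w => u (kappa w))).
have F0 : 0 <= F by rewrite fine_ge0// L2norm_ge0.
(* These are the Gaussian coefficients of the test function, so K-convexity bounds [gnorm N x] by
   its $L_2$ norm. *)
pose x j := \sum_k cell_mean g kappa k j *: u k.
have xE j : bochner_integral P (fun w => g j w *: u (kappa w)) = x j.
  by rewrite bochner_integral_finite//; exact: gaussian_integ.
have xF : gnorm N x <= C * F.
  have := hC N (fun w => u (kappa w)); rewrite (funext xE); apply.
  by split; [exact: strongly_measurable_finite|exact: finite_L2_lty].
have -> : \sum_(j < N) \sum_k cell_mean g kappa k j * canonical (u k) (T (ell2_unit j)) =
    \sum_(j < N) phi j (x j) :> R.
  apply: eq_bigr => j _; rewrite /x dual_sum; apply: eq_bigr => k _.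
  by rewrite canonicalE dualZ.
have [S [fS SE Su]] := coord_op N x.
have Sell : (ell_norm g S <= (C * F)%:E)%E.
  apply: ell_norm_le => //; first by rewrite mulr_ge0// ltW.
  exists N => M NM; rewrite (@gnorm_tail _ _ _ _ _ _ N)//.
    by rewrite (@gnorm_ext _ _ _ _ _ _ N _ x)// => j jN; rewrite Su jN.
  by move=> j; rewrite Su leqNgt => /negPf ->.
have Sgam : (gamma_infty S <= (K * (C * F))%:E)%E.
  by apply: (le_trans (hK S fS)); rewrite EFinM; apply: lee_wpmul2l => //; rewrite lee_fin ltW.
(* Both errors are linear in [e]: $re$ from the strict bound on $\gamma_\infty(S)$, and
   $e\sum_j\|\phi_j\|$ from the discretization. *)
apply: (@le_of_small _ _ _ (r + \sum_(j < N) `|phi j|)).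
  by rewrite addr_ge0// sumr_ge0.
move=> e e0.
have Slt : (gamma_infty S < (K * (C * F) + e)%:E)%E.
  by apply: le_lt_trans Sgam _; rewrite lte_fin ltrDl.
have [J [a [y [a1 yc hy]]]] := gamma_infty_discrete N Slt e0.
have h1 := summing_family_le r0 hr a1 yc.
have h2 : \sum_(j < N) phi j (x j) <=
    \sum_i \sum_(j < N) a i j * T (ell2_unit j) (y i) + e * \sum_(j < N) `|phi j|.
  rewrite exchange_big/= mulr_sumr -big_split/=; apply: ler_sum => j _.
  have -> : phi j (x j) = phi j (\sum_i a i j *: y i) + phi j (x j - \sum_i a i j *: y i) :> R.
    by rewrite -dualD addrC subrK.
  apply: lerD.
    by rewrite dual_sum; apply: ler_sum => i _; rewrite dualZ.
  rewrite (le_trans (ler_norm _))// (le_trans (dual_le _ _))// mulrC ler_wpM2r//.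
  by have := hy j (ltn_ord j); rewrite Su ltn_ord.
apply: (le_trans h2); apply: (le_trans (lerD h1 (lexx _))).
rewrite le_eqVlt; apply/orP; left; apply/eqP; ring.
Qed.

Lemma ell_gamma_finite_cotype (K : R) :
  (forall T : bop (@ell2 R) X, finite_rank T -> (ell_norm g T <= K%:E * gamma_infty T)%E) ->
  0 < K -> finite_cotype X.
Proof.
move=> hK K0; pose c1 := Ex (fun w => `|g 0 w|).
have c10 : 0 < c1 := gaussian_abs_mean_gt0 g_gauss.
(* The two bounds on the Gaussian norm will give $\sqrt N\,c_1\le2(2K+1)$, that is $N\le B$; [N] is
   chosen larger. *)
pose B := (2 * (K * 2 + 1) / c1) ^+ 2.
have B0 : 0 <= B by exact: sqr_ge0.
pose N := (Num.bound B).+1.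
have BN : B < N%:R by rewrite (lt_trans (archi_boundP B0))// ltr_nat.
pose I : finType := {ffun 'I_N -> bool}.
have I0 : (0 < #|I|)%N by apply/card_gt0P; exists [ffun=> false].
have [[theta [t0 t1 hdom]]|[x [x2 xc]]] := average_domination_dichotomy X I0.
  exact: average_domination_cotype t0 t1 I0 hdom.
exfalso.
have N0 : 0 < N%:R :> R by rewrite ltr0n.
pose s : R := Num.sqrt N%:R.
have s0 : 0 < s by rewrite sqrtr_gt0.
have s2 : s ^+ 2 = N%:R by rewrite sqr_sqrtr// ltW.
pose sg (eps : I) (j : nat) : R := if insub j is Some k then (-1) ^+ eps k else 0.
have sgE eps (j : 'I_N) : sg eps j = (-1) ^+ eps j by rewrite /sg valK.
pose a (eps : I) j := s^-1 * sg eps j.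
have a1 eps : \sum_(j < N) a eps j ^+ 2 <= 1.
  under eq_bigr do rewrite exprMn sgE -exprM mulnC exprM sqrrN expr1n expr1n mulr1.
  by rewrite sumr_const card_ord -mulr_natr exprVn s2 mulVf// gt_eqF.
pose t j := \sum_eps a eps j *: x eps.
have [T [fT TE Tu]] := coord_op N t.
have gam : (gamma_infty T <= 2%:E)%E.
  by apply: gamma_infty_representable TE _; exists I, a, x.
have [N1 hN1] := gnorm_le_ell g_gauss g_indep fT ltr01.
have up : gnorm N t <= K * 2 + 1.
  have := hN1 (maxn N N1) (leq_maxr _ _).
  rewrite (@gnorm_tail _ _ _ _ _ _ N) ?leq_maxl//; last by move=> j; rewrite Tu leqNgt => /negPf ->.
  rewrite (@gnorm_ext _ _ _ _ _ _ N _ t); last by move=> j jN; rewrite Tu jN.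
  rewrite -lee_fin => /le_trans; apply; rewrite EFinD leeD2r//.
  apply: (le_trans (hK T fT)); rewrite EFinM; apply: lee_wpmul2l => //.
  by rewrite lee_fin ltW.
have low : N%:R * c1 * (s^-1 / 2) <= gnorm N t.
  apply: le_trans (Ex_norm_le_L2norm (gsum_norm_measurable g N t) (gsum_L2_lty g_gauss N t)).
  have iS : P.-integrable setT (EFin \o (fun w => \sum_(j < N) `|g j w|)).
    by apply: integ_sum => j; apply: integ_norm; exact: gaussian_integ.
  have -> : N%:R * c1 * (s^-1 / 2) = Ex (fun w => s^-1 / 2 * \sum_(j < N) `|g j w|).
    rewrite ExZ// Ex_sum; last by move=> j; apply: integ_norm; exact: gaussian_integ.
    under eq_bigr do rewrite gaussian_abs_mean//.
    transitivity (s^-1 / 2 * (N%:R * c1)); first by rewrite mulrC.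
    by congr (_ * _); rewrite sumr_const card_ord mulr_natl.
  apply: le_Ex; first exact: integZ.
    exact: Lfun2_integ1 (norm_Lfun2 (gsum_norm_measurable g N t) (gsum_L2_lty g_gauss N t)).
  move=> w; rewrite gsum_exchange.
  (* Only the coordinate with the sign pattern of $g(w)$ is used. Its coefficient is
     $N^{-1/2}\sum_j|g_j(w)|$, and [xc] bounds it by twice the norm of the sum. *)
  pose eps : I := [ffun j : 'I_N => g j w < 0].
  have := xc (fun eps => \sum_(j < N) a eps j * g j w) eps.
  have -> : \sum_(j < N) a eps j * g j w = s^-1 * \sum_(j < N) `|g j w|.
    rewrite mulr_sumr; apply: eq_bigr => j _; rewrite /a sgE ffunE -mulrA; congr (_ * _).
    exact/esym/normrEsign.
  have S0 : 0 <= \sum_(j < N) `|g j w| by exact: sumr_ge0.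
  rewrite ger0_norm; last by rewrite mulr_ge0 ?invr_ge0 ?(ltW s0).
  lra.
have key : s * c1 <= 2 * (K * 2 + 1).
  have e : N%:R * c1 * (s^-1 / 2) = s * c1 / 2 by rewrite -s2; field; rewrite gt_eqF.
  by move: low up; rewrite e; lra.
have : N%:R <= B.
  rewrite -s2 /B lerXn2r ?nnegrE ?(ltW s0)//; last by rewrite ler_pdivlMr.
  by rewrite divr_ge0 ?(ltW c10)// mulr_ge0// addr_ge0// mulr_ge0// ltW.
by rewrite leNgt BN.
Qed.

End Converse.

Theorem theorem1p7 (R : realType) (d : measure_display)
    (Omega : measurableType d) (P : probability Omega R)
    (g : nat -> {RV P >-> R})
    (g_gauss : standard_gaussian g) (g_indep : independent g)
    (X : completeNormedModType R) :
  (K_convex g X /\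
   exists K : R, 0 < K /\
     forall T : bop (@ell2 R) X, finite_rank T ->
       (K^-1%:E * gamma_infty T <= ell_norm g T)%E /\
       (ell_norm g T <= K%:E * gamma_infty T)%E)
  <->
  (GAP g (dual X) /\ finite_cotype X).
Proof.
split=> [[Kc [K [K0 hK]]]|[gap cot]].
  split; last by apply: (ell_gamma_finite_cotype g_gauss g_indep _ K0) => T /hK[].
  apply: (K_convex_GAP g_gauss Kc); exists K => // T /hK[h _].
  by rewrite -lee_pdivrMl.
split; first exact: GAP_cotype_K_convex.
have [M M0 hM] := cotype_ell_norm_le g_gauss g_indep cot.
have [K K0 hK] := GAP_gamma_le_ell g_gauss g_indep gap.
pose L := Num.max M K; have L0 : 0 < L by rewrite lt_max M0.
exists L; split=> // T fT; split.
  rewrite lee_pdivrMl//; apply: (le_trans (hK T fT)); apply: lee_wpmul2r.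
    exact: L2norm_ge0.
  by rewrite lee_fin le_max lexx orbT.
apply: (le_trans (hM T)); apply: lee_wpmul2r; first exact: gamma_infty_ge0.
by rewrite lee_fin le_max lexx.
Qed.
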